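(* Let $\mathbb{M}^2$ be a compact connected Riemannian surface with non-negative Gaussian curvature $K_{\mathbb{M}}\geq 0$ (respectively, non-positive Gaussian curvature $K_{\mathbb{M}}\leq 0$), and assume that $K_{\mathbb{M}}>0$ (respectively, $K_{\mathbb{M}}<0$) on a dense subset of $\mathbb{M}^2$. (i) The only entire solutions $u$ on $\mathbb{M}^2$ to $$(1+|Du|^2)^2K=(1+|Du|^2)K_{\mathbb{M}}+\det(D^2u),$$ where $K$ is a smooth function on $\mathbb{M}^2$ satisfying $K\geq K_{\mathbb{M}}$ (respectively, $K\leq K_{\mathbb{M}}$), are the constant functions, and $K=K_{\mathbb{M}}$ necessarily. (ii) The only entire solutions $u$ on $\mathbb{M}^2$ to $$(1-|Du|^2)^2K=(1-|Du|^2)K_{\mathbb{M}}-\det(D^2u),\qquad |Du|^2<1,$$ where $K$ is a smooth function on $\mathbb{M}^2$ satisfying $K\leq K_{\mathbb{M}}$ (respectively, $K\geq K_{\mathbb{M}}$), are the constant functions, and $K=K_{\mathbb{M}}$ necessarily.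
   Context: Manifolds are smooth and without boundary. An entire solution is a smooth function $u\in\mathcal{C}^\infty(\mathbb{M}^2)$ defined on all of $\mathbb{M}^2$ satisfying the equation (and, in (ii), the condition $|Du|^2<1$) at every point. $Du$ and $D^2u$ are the gradient and the Hessian of $u$ with respect to the metric $\langle\cdot,\cdot\rangle_{\mathbb{M}}$ of $\mathbb{M}^2$, $|Du|^2=\langle Du,Du\rangle_{\mathbb{M}}$, and $\det(D^2u)$ is the determinant of the matrix of $D^2u$ in a local orthonormal frame of $\mathbb{M}^2$. *)

(* Defs.v *)
From HB Require Import structures.
From mathcomp Require Import all_boot all_order all_algebra.
From mathcomp Require Import boolp classical_sets functions reals topology.
From mathcomp Require Import normedtype derive.
From mathcomp Require Import ring.

Set Implicit Arguments.
Unset Strict Implicit.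
Unset Printing Implicit Defensive.

Import Order.TTheory GRing.Theory Num.Theory.
Import numFieldNormedType.Exports.

Local Open Scope classical_set_scope.
Local Open Scope ring_scope.

Section Plane.
Context {R : realType}.

Definition partial (i : 'I_2) (f : 'rV[R]_2 -> R) : 'rV[R]_2 -> R :=
  'D_(delta_mx 0 i) f.

Definition iter_partial (s : seq 'I_2) (f : 'rV[R]_2 -> R) : 'rV[R]_2 -> R :=
  foldr partial f s.

(* For U open this is C^oo regularity on U: the partial derivatives of all
   orders exist and are continuous at every point of U. *)
Definition smooth_on (U : set 'rV[R]_2) (f : 'rV[R]_2 -> R) : Prop :=
  forall (s : seq 'I_2) (x : 'rV[R]_2), U x ->
    {for x, continuous (iter_partial s f)} /\
    forall i : 'I_2, derivable (iter_partial s f) x (delta_mx 0 i).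

(* J a c = d_a t^c, so that a row vector v is pushed forward to v *m J. *)
Definition jacobian_mx (t : 'rV[R]_2 -> 'rV[R]_2) (x : 'rV[R]_2) : 'M[R]_2 :=
  \matrix_(a, c) partial a (fun y => t y 0 c) x.

Definition posdef_mx (A : 'M[R]_2) : Prop :=
  A^T = A /\ forall v : 'rV[R]_2, v != 0 -> 0 < (v *m A *m v^T) 0 0.

Variable G : 'rV[R]_2 -> 'M[R]_2.

(* Gamma^k_{a b} *)
Definition christoffel (k a b : 'I_2) (x : 'rV[R]_2) : R :=
  2^-1 * \sum_l invmx (G x) k l *
    (partial a (fun y => G y b l) x + partial b (fun y => G y a l) x
     - partial l (fun y => G y a b) x).

(* The d_m-component of R(d_i, d_j) d_k, with
   R(X, Y) = [nabla_X, nabla_Y] - nabla_[X, Y]. *)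
Definition riemann (m i j k : 'I_2) (x : 'rV[R]_2) : R :=
  partial i (christoffel m j k) x - partial j (christoffel m i k) x
  + \sum_l (christoffel l j k x * christoffel m i l x
            - christoffel l i k x * christoffel m j l x).

(* <R(d_0, d_1) d_1, d_0> / (|d_0|^2 |d_1|^2 - <d_0, d_1>^2);
   equal to 1 on the unit sphere. *)
Definition gauss_coord (x : 'rV[R]_2) : R :=
  (\sum_m riemann m 0 1 1 x * G x m 0) / \det (G x).

Definition grad_coord (f : 'rV[R]_2 -> R) (x : 'rV[R]_2) : 'rV[R]_2 :=
  (\row_i partial i f x) *m invmx (G x).

Definition norm2_coord (x v : 'rV[R]_2) : R := (v *m G x *m v^T) 0 0.

(* D^2 f (d_a, d_b) *)
Definition hess_coord (f : 'rV[R]_2 -> R) (x : 'rV[R]_2) : 'M[R]_2 :=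
  \matrix_(a, b) (partial a (partial b f) x
                  - \sum_c christoffel c a b x * partial c f x).

End Plane.

(* The rows of E are the components of the frame vectors. *)
Definition orthonormal_frame {R : realType} (A : 'M[R]_2) : set 'M[R]_2 :=
  [set E | E *m A *m E^T = 1%:M].

(* Determinant of the matrix (H (e_i, e_j)) in an orthonormal frame (e_0, e_1)
   of the inner product A; by the two lemmas below, such a frame exists and its
   choice is immaterial. *)
Definition frame_det {R : realType} (A H : 'M[R]_2) : R :=
  let E := xget 0 (orthonormal_frame A) in \det (E *m H *m E^T).

Lemma orthonormal_frame_ex {R : realType} (A : 'M[R]_2) :
  posdef_mx A -> exists E, orthonormal_frame A E.
Proof.
move=> [symA posA].
have sum2 (F : 'I_2 -> R) : \sum_i F i = F 0 + F 1.
  by rewrite !big_ord_recl big_ord0 addr0; congr (_ + F _); apply: val_inj.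
have A10 : A 1 0 = A 0 1 by rewrite -[in LHS]symA mxE.
set a := A 0 0; set b := A 0 1; set d := A 1 1.
have quadE (v : 'rV[R]_2) : (v *m A *m v^T) 0 0 =
    v 0 0 ^+ 2 * a + v 0 0 * v 0 1 * b *+ 2 + v 0 1 ^+ 2 * d.
  by rewrite !(mxE, sum2) A10 -/a -/b -/d; ring.
have a_gt0 : 0 < a.
  have := posA (\row_j (j == 0)%:R); rewrite quadE !mxE /= => H.
  have /H : (\row_j (j == 0)%:R : 'rV[R]_2) != 0.
    by apply/eqP => /rowP/(_ 0); rewrite !mxE /= => /eqP; rewrite oner_eq0.
  by rewrite expr1n mul1r mulr0 mul0r mul0rn expr0n mul0r !addr0.
have D_gt0 : 0 < a * d - b ^+ 2.
  have := posA (\row_j (if j == 0 then - b else a)); rewrite quadE !mxE /= => H.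
  have /H : (\row_j (if j == 0 then - b else a) : 'rV[R]_2) != 0.
    apply/eqP => /rowP/(_ 1); rewrite !mxE /= => a0.
    by rewrite a0 ltxx in a_gt0.
  have -> : (- b) ^+ 2 * a + (- b * a) * b *+ 2 + a ^+ 2 * d
          = a * (a * d - b ^+ 2) by ring.
  by rewrite pmulr_rgt0.
set s := Num.sqrt a; set t := Num.sqrt (a * (a * d - b ^+ 2)).
have s2 : s ^+ 2 = a by rewrite sqr_sqrtr // ltW.
have t2 : t ^+ 2 = a * (a * d - b ^+ 2) by rewrite sqr_sqrtr // mulr_ge0 // ltW.
have s0 : s != 0 by rewrite gt_eqF // sqrtr_gt0.
have t0 : t != 0 by rewrite gt_eqF // sqrtr_gt0 mulr_gt0.
exists (\matrix_(i, j) if i == 0 then (if j == 0 then s^-1 else 0)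
                       else (if j == 0 then - b / t else a / t)).
rewrite /orthonormal_frame /=; apply/matrixP => i j.
rewrite !(mxE, sum2) /= A10 -/a -/b -/d.
have I2 (k : 'I_2) : k = 0 \/ k = 1.
  by case: k => [[|[|]]] //= h; [left|right]; apply: val_inj.
case: (I2 i) => ->; case: (I2 j) => -> /=; rewrite ?mulr1n ?mulr0n.
- by rewrite -s2; field.
- by field; rewrite s0 t0.
- by field; rewrite s0 t0.
have -> : (- b / t * a + a / t * b) * (- b / t)
        + (- b / t * b + a / t * d) * (a / t) =
          a * (a * d - b ^+ 2) / t ^+ 2 by field.
by rewrite -t2 divff // expf_neq0.
Qed.

Lemma frame_detE {R : realType} (A H E : 'M[R]_2) :
  posdef_mx A -> orthonormal_frame A E -> frame_det A H = \det (E *m H *m E^T).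
Proof.
move=> posA hE; rewrite /frame_det.
have hF : orthonormal_frame A (xget 0 (orthonormal_frame A)).
  by have [F hF] := orthonormal_frame_ex posA; apply: xgetI hF.
have detE F : orthonormal_frame A F ->
    \det (F *m H *m F^T) = \det H / \det A.
  move=> /(congr1 determinant); rewrite !det_mulmx !det_tr det1 => F1.
  have A0 : \det A != 0.
    by apply: contra_eq_neq F1 => ->; rewrite mulr0 mul0r eq_sym oner_eq0.
  apply: (mulIf A0); rewrite divfK // -[RHS]mul1r -F1; ring.
by rewrite !detE.
Qed.

Record smooth_surface (R : realType) (M : topologicalType) := SmoothSurface {
  surf_hausdorff : hausdorff_space M;
  surf_second_countable : @second_countable M;
  atlas : Type;
  dom : atlas -> set M;
  chart : atlas -> M -> 'rV[R]_2;
  param : atlas -> 'rV[R]_2 -> M;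
  chart_at : M -> atlas;
  chart_at_dom : forall p, dom (chart_at p) p;
  dom_open : forall i, open (dom i);
  codom_open : forall i, open (chart i @` dom i);
  chartK : forall i p, dom i p -> param i (chart i p) = p;
  chart_cont : forall i, {within dom i, continuous (chart i)};
  param_cont : forall i, {within chart i @` dom i, continuous (param i)};
  transition_smooth : forall i j c,
    smooth_on (chart i @` (dom i `&` dom j))
              (fun x => chart j (param i x) 0 c) }.

Section Surface.
Context {R : realType} {M : topologicalType} (S : smooth_surface R M).

Definition transition (i j : atlas S) (x : 'rV[R]_2) : 'rV[R]_2 :=
  chart j (param i x).

Definition smooth_fun (f : M -> R) : Prop :=
  forall i : atlas S, smooth_on (chart i @` dom i) (f \o param i).

(* A smooth field of inner products, given by its component matrices in the
   charts, which obey the transformation law of covariant 2-tensors. *)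
Record riemannian_metric := RiemannianMetric {
  gmat : atlas S -> 'rV[R]_2 -> 'M[R]_2;
  gmat_smooth : forall i a b,
    smooth_on (chart i @` dom i) (fun x => gmat i x a b);
  gmat_posdef : forall i x, (chart i @` dom i) x -> posdef_mx (gmat i x);
  gmat_compat : forall i j x, (chart i @` (dom i `&` dom j)) x ->
    gmat i x = jacobian_mx (transition i j) x *m gmat j (transition i j x)
               *m (jacobian_mx (transition i j) x)^T }.

Variable g : riemannian_metric.

(* The next three quantities do not depend on the chart around p used to
   compute them. *)
Definition gauss_curvature (p : M) : R :=
  let i := chart_at S p in gauss_coord (gmat g i) (chart i p).

Definition grad_norm2 (u : M -> R) (p : M) : R :=
  let i := chart_at S p in
  norm2_coord (gmat g i) (chart i p)
    (grad_coord (gmat g i) (u \o param i) (chart i p)).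

Definition hess_det (u : M -> R) (p : M) : R :=
  let i := chart_at S p in
  frame_det (gmat g i (chart i p))
    (hess_coord (gmat g i) (u \o param i) (chart i p)).

Definition entire_solution_plus (K u : M -> R) : Prop :=
  smooth_fun u /\
  forall p, (1 + grad_norm2 u p) ^+ 2 * K p
            = (1 + grad_norm2 u p) * gauss_curvature p + hess_det u p.

Definition entire_solution_minus (K u : M -> R) : Prop :=
  smooth_fun u /\
  forall p, (1 - grad_norm2 u p) ^+ 2 * K p
            = (1 - grad_norm2 u p) * gauss_curvature p - hess_det u p
            /\ grad_norm2 u p < 1.

End Surface.

(* Main.v *)
Require Import Defs.
From HB Require Import structures.
From mathcomp Require Import all_boot all_order all_algebra.
From mathcomp Require Import boolp classical_sets functions reals topology.
From mathcomp Require Import normedtype landau derive realfun.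
From mathcomp Require Import ereal measure lebesgue_measure lebesgue_integral ftc.
From mathcomp Require Import ring lra.

(* Let W = |Du|^2 and let phi be a function of W.  By the Bochner formula the
   divergence of phi(W) (Delta u Du - DW / 2) is
     phi(W) (2 det D^2 u - K_M W) + 2 phi'(W) W det D^2 u.
   With phi = 1 in case (i) and phi(W) = 1 / (1 - W) in case (ii), the equation
   and the comparison of K with K_M show that this function has the sign of K_M
   and vanishes at a point where K_M <> 0 only if W = 0 there.  Since its
   integral over the compact surface is zero, W = 0 on a dense set, hence
   everywhere, and u is constant.

   The surface need not be orientable, so the integral is a sum of Lebesgue
   integrals of densities in charts, glued by a partition of unity; its
   consistency only requires the change of variables formula for densities
   supported near a point.  There, after shears, the chart transition maps a
   small rectangle to a region whose sides avoid the support, and the formula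
   follows from Green's theorem by writing the density as d_1 P and pulling
   back the form P dx_0.  The Laplacian is chart-independent by the Piola
   identity. *)

Set Implicit Arguments.
Unset Strict Implicit.
Unset Printing Implicit Defensive.

Import Order.TTheory GRing.Theory Num.Theory.
Import numFieldNormedType.Exports.

Local Open Scope classical_set_scope.
Local Open Scope ring_scope.

(** * Regularity of functions on the coordinate plane *)

Section PlaneCalculus.
Context {R : realType}.
Local Notation V := 'rV[R]_2.
Implicit Types (f h : V -> R) (x y v : V) (U : set V) (i j : 'I_2).
Local Notation e_ i := (delta_mx 0 i : V).

(** The coefficient of det D^2 u in the divergence is 2 (t phi(t))' at t = W. In case (ii) the
    equation gives det D^2 u = (1 - W) K_M - (1 - W)^2 K, and phi = 1 / (1 - t) is the choice for
    which (t phi)' = (1 - t)^(-2) cancels the factor of K; what remains is 2 (K_M - K) + K_M W / (1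
    - W). In case (i), phi = 1 leaves 2 (1 + W)^2 (K - K_M) + K_M W (1 + 2 W). The integral enters
    through three properties: it kills divergences, it is additive, and it is definite on
    non-negative continuous functions. The obstacle is the first: Green's formula holds for fields
    living in one chart, while the integral is spread over several charts by its own partition of
    unity. A second partition cuts the field into pieces so small that all these charts give the
    same integral of each piece. The cutoffs are powers of positive parts and only C^3, so
    regularity is counted by finite orders throughout. Plane integrals are iterated in one fixed
    order. *)

Lemma ord2P i : i = 0 \/ i = 1.
Proof. by case: i => [[|[|]]] //= H; [left|right]; apply: val_inj. Qed.

Lemma sum_ord2 (T : nmodType) (F : 'I_2 -> T) : \sum_i F i = F 0 + F 1.
Proof.
by rewrite !big_ord_recl big_ord0 addr0; congr (_ + F _); apply: val_inj.
Qed.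

Lemma row2E x : x = x 0 0 *: e_ 0 + x 0 1 *: e_ 1.
Proof.
apply/rowP => j; rewrite !mxE eqxx /=.
by case: (ord2P j) => -> /=; rewrite ?mulr1 ?mulr0 ?addr0 ?add0r.
Qed.

Lemma row2_eq x y : x 0 0 = y 0 0 -> x 0 1 = y 0 1 -> x = y.
Proof. by move=> h0 h1; rewrite (row2E x) (row2E y) h0 h1. Qed.

Lemma le_coord_norm x i : `|x 0 i| <= `|x|.
Proof.
by rewrite [leRHS]/Num.norm /= mx_normrE; apply/bigmax_geP; right; exists (0, i).
Qed.

Lemma row2_norm_lt x (e : R) : 0 < e -> `|x 0 0| < e -> `|x 0 1| < e -> `|x| < e.
Proof.
move=> e0 h0 h1; rewrite [ltLHS]/Num.norm /= mx_normrE; apply/bigmax_ltP; split=> //.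
by move=> [k i] _ /=; rewrite ord1; case: (ord2P i) => ->.
Qed.

Lemma continuous_coord i : continuous (fun x : V => x 0 i).
Proof. exact: coord_continuous. Qed.

Lemma row2_cvg (T : Type) (F : set_system T) (FF : Filter F) (k : T -> V) x :
  (forall i, (fun t => k t 0 i) @ F --> x 0 i) -> k @ F --> x.
Proof.
move=> kx A [P Px PA]; rewrite /nbhs /=.
have h (i : 'I_2) : F [set t | P 0 i (k t 0 i)] by apply: kx; exact: Px.
have : F ([set t | P 0 0 (k t 0 0)] `&` [set t | P 0 1 (k t 0 1)]) by exact: filterI.
apply: filterS => t [p0 p1]; apply: PA => a b; rewrite (ord1 a).
by case: (ord2P b) => ->.
Qed.

(** The coefficients are plain numbers; the bundled continuous linear map that a differential has to
    be is built inside the proof. *)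
Lemma is_diff_near f x (a b : R) :
  (forall eps : R, 0 < eps ->
     \forall u \near (0 : V), `|f (u + x) - (f x + (u 0 0 * a + u 0 1 * b))| <= eps * `|u|) ->
  is_diff x f (fun u : V => u 0 0 * a + u 0 1 * b).
Proof.
move=> fx; set df := fun u : V => _.
have lin : linear df by move=> k u v; rewrite /df !mxE /= /GRing.scale /=; ring.
pose dfM := GRing.isLinear.Build _ _ _ _ _ lin.
pose dfL : {linear V -> R} := HB.pack df dfM.
have dfc : continuous dfL.
  move=> u; rewrite /= /df; apply: (@continuousD _ _ _ (fun u : V => u 0 0 * a) (fun u : V => u 0 1 * b)).
    by apply: (@continuousM _ _ (fun u : V => u 0 0) (cst a)); [exact: continuous_coord|exact: cst_continuous].
  by apply: (@continuousM _ _ (fun u : V => u 0 1) (cst b)); [exact: continuous_coord|exact: cst_continuous].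
have fo : f \o shift x = cst (f x) + dfL +o_ (0 : V) id.
  by apply/eqaddoP => eps e0; exact: fx.
have E := diff_unique dfc fo.
apply: DiffDef => //; apply/diff_locallyP; rewrite E; split=> //.
Qed.

Lemma differentiable_near f x (a b : R) :
  (forall eps : R, 0 < eps ->
     \forall u \near (0 : V), `|f (u + x) - (f x + (u 0 0 * a + u 0 1 * b))| <= eps * `|u|) ->
  differentiable f x.
Proof. by move=> /is_diff_near H; exact: ex_diff. Qed.

Lemma differentiable_nearP f x : differentiable f x -> forall eps : R, 0 < eps ->
  \forall u \near (0 : V), `|f (u + x) - (f x + 'd f x u)| <= eps * `|u|.
Proof. by move=> /diff_locally /eqaddoP H eps e0; exact: H. Qed.

Lemma near_eq_differentiable f h x :
  (\forall y \near x, f y = h y) -> differentiable f x -> differentiable h x.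
Proof.
move=> fh df.
apply: (@differentiable_near _ _ ('d f x (e_ 0)) ('d f x (e_ 1))) => eps /(differentiable_nearP df) H.
have fh' : \forall u \near (0 : V), f (u + x) = h (u + x).
  by move: fh; rewrite (near_shift 0 x) /=; apply: filterS => u; rewrite /= subr0.
have fhx : f x = h x by have := nbhs_singleton fh.
near=> u.
have -> : h (u + x) = f (u + x) by apply/esym; near: u.
rewrite -fhx.
have -> : u 0 0 * 'd f x (e_ 0) + u 0 1 * 'd f x (e_ 1) = 'd f x u.
  by rewrite [in RHS](row2E u) linearD !linearZ.
by near: u.
Unshelve. all: by end_near. Qed.

Lemma partialE f x i : differentiable f x -> partial i f x = 'd f x (e_ i).
Proof. exact: deriveE. Qed.

Lemma diff_partial f x v : differentiable f x ->
  'd f x v = v 0 0 * partial 0 f x + v 0 1 * partial 1 f x.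
Proof.
move=> df; rewrite !partialE // [in LHS](row2E v) linearD !linearZ //.
Qed.

Lemma is_derive_line (W : normedModType R) (f : W -> R) (b v : W) (s : R) : derivable f (b + s *: v) v ->
  is_derive s (1 : R) (fun t : R => f (b + t *: v)) ('D_v f (b + s *: v)).
Proof.
move=> /derivableP df.
have E (h : R) : h *: v + (b + s *: v) = b + (h + s) *: v.
  by rewrite scalerDl addrCA.
apply: DeriveDef.
  have [d _] := df; move: d; rewrite /derivable /=.
  by under eq_fun do rewrite E; under [X in _ -> cvg (X @ _)]eq_fun do rewrite [_%:A]mulr1.
rewrite /derive /=.
by under eq_fun do rewrite [_%:A]mulr1; under [X in _ = lim (X @ _)]eq_fun do rewrite E.
Qed.

(** The parameter [t] may have either sign, and the intermediate point is located by its absolute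
    value only: this is the form that estimates on balls use. *)
Lemma line_MVT (W : normedModType R) (f : W -> R) (b v : W) (t : R) :
  (forall s : R, `|s| <= `|t| -> derivable f (b + s *: v) v) ->
  exists2 s : R, `|s| <= `|t| & f (b + t *: v) - f b = t * 'D_v f (b + s *: v).
Proof.
move=> df; pose phi s := f (b + s *: v).
have dphi s : `|s| <= `|t| -> is_derive s (1 : R) phi ('D_v f (b + s *: v)).
  by move=> /df; exact: is_derive_line.
have E0 : f b = phi 0 by rewrite /phi scale0r addr0.
have [t0|t0] := leP 0 t.
  have [||c ct E] := @MVT_segment _ phi (fun s => 'D_v f (b + s *: v)) 0 t t0.
  - move=> s; rewrite in_itv /= => /andP[s0 st]; apply: dphi.
    by rewrite !ger0_norm // ltW.
  - apply: derivable_within_continuous => s; rewrite in_itv /= => /andP[s0 st].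
    by apply: ex_derive; apply: dphi; rewrite !ger0_norm.
  exists c.
    by move: ct; rewrite in_itv /= => /andP[c0 ct]; rewrite !ger0_norm.
  by rewrite E0 -/(phi t) E subr0 mulrC.
have [||c ct E] := @MVT_segment _ phi (fun s => 'D_v f (b + s *: v)) t 0 (ltW t0).
- move=> s; rewrite in_itv /= => /andP[s0 st]; apply: dphi.
  by rewrite !ltr0_norm // lerN2 ltW.
- apply: derivable_within_continuous => s; rewrite in_itv /= => /andP[s0 st].
  by apply: ex_derive; apply: dphi; rewrite (ltr0_norm t0) ler0_norm // lerN2.
exists c.
  by move: ct; rewrite in_itv /= => /andP[c0 ct]; rewrite (ltr0_norm t0) ler0_norm // lerN2.
by rewrite E0 -/(phi t) -opprB E; ring.
Qed.

Lemma norm_delta i : `|e_ i| <= 1 :> R.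
Proof.
rewrite [leLHS]/Num.norm /= mx_normrE; apply/bigmax_leP; split=> // -[k j] _ /=.
by rewrite mxE; case: (_ && _); rewrite /= ?normr1 ?normr0.
Qed.

(** The increment is taken along a path with one side parallel to each axis; on each side the mean
    value theorem compares it with a partial derivative close to the one at [x]. *)
Lemma C1_differentiable f x :
  (forall i, \forall y \near x, derivable f y (e_ i)) ->
  (forall i, {for x, continuous (partial i f)}) -> differentiable f x.
Proof.
move=> df cf.
apply: (@differentiable_near _ _ (partial 0 f x) (partial 1 f x)) => eps e0.
have e2 : 0 < eps / 2 by rewrite divr_gt0.
have H i : \forall y \near x, derivable f y (e_ i) /\ `|partial i f x - partial i f y| <= eps / 2.
  near=> y; split; first by near: y; exact: df.
  near: y; have /cvgrPdist_le := cf i; exact.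
have /nbhs_ballP[r0 /= r0p B0] := H 0.
have /nbhs_ballP[r1 /= r1p B1] := H 1.
pose r := Num.min r0 r1.
have rp : 0 < r by rewrite lt_min r0p r1p.
(* Each coordinate displacement is at most [|u|], so half the radius keeps the whole path inside the
   ball. *)
apply/nbhs_ballP; exists (r / 2) => /=; first by rewrite divr_gt0.
move=> u; rewrite -ball_normE /= sub0r normrN => ur.
have bnd a c : `|a| <= `|u 0 0| -> `|c| <= `|u 0 1| ->
    ball x r (x + a *: e_ 0 + c *: e_ 1).
  move=> ha hc; rewrite -ball_normE /=.
  have -> : x - (x + a *: e_ 0 + c *: e_ 1) = - (a *: e_ 0 + c *: e_ 1).
    by rewrite -addrA opprD addrA subrr add0r.
  rewrite normrN (le_lt_trans (ler_normD _ _)) // !normrZ.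
  have h1 : `|a| * `|e_ 0| <= `|u|.
    by rewrite (le_trans (ler_piMr _ (norm_delta _))) // (le_trans ha) // le_coord_norm.
  have h2 : `|c| * `|e_ 1| <= `|u|.
    by rewrite (le_trans (ler_piMr _ (norm_delta _))) // (le_trans hc) // le_coord_norm.
  lra.
have [|s1 hs1 E1] := @line_MVT _ f (x + u 0 0 *: e_ 0) (e_ 1) (u 0 1).
- move=> s hs; apply: (proj1 (B1 _ _)); apply: le_ball (bnd _ _ _ hs) => //.
  by rewrite ge_min lexx orbT.
have [|s0 hs0 E0] := @line_MVT _ f x (e_ 0) (u 0 0).
- move=> s hs; apply: (proj1 (B0 _ _)).
  have := bnd s 0 hs; rewrite normr0 scale0r addr0 => /(_ (normr_ge0 _)); apply: le_ball.
  by rewrite ge_min lexx.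
have -> : u + x = x + u 0 0 *: e_ 0 + u 0 1 *: e_ 1 by rewrite {1}(row2E u) addrC addrA.
have -> : f (x + u 0 0 *: e_ 0 + u 0 1 *: e_ 1) -
   (f x + (u 0 0 * partial 0 f x + u 0 1 * partial 1 f x)) =
   u 0 0 * (partial 0 f (x + s0 *: e_ 0) - partial 0 f x) +
   u 0 1 * (partial 1 f (x + u 0 0 *: e_ 0 + s1 *: e_ 1) - partial 1 f x).
  rewrite !mulrBr /partial -E0 -E1; ring.
have h0 : `|partial 0 f (x + s0 *: e_ 0) - partial 0 f x| <= eps / 2.
  rewrite distrC; apply: (proj2 (B0 _ _)).
  have := bnd s0 0 hs0; rewrite normr0 scale0r addr0 => /(_ (normr_ge0 _)); apply: le_ball.
  by rewrite ge_min lexx.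
have h1 : `|partial 1 f (x + u 0 0 *: e_ 0 + s1 *: e_ 1) - partial 1 f x| <= eps / 2.
  rewrite distrC; apply: (proj2 (B1 _ _)); apply: le_ball (bnd _ _ _ hs1) => //.
  by rewrite ge_min lexx orbT.
rewrite (le_trans (ler_normD _ _)) // !normrM.
have -> : eps * `|u| = `|u| * (eps / 2) + `|u| * (eps / 2) by field.
by apply: lerD; apply: ler_pM => //; exact: le_coord_norm.
Unshelve. all: by end_near. Qed.

End PlaneCalculus.

(** * Functions of class C^k on a subset of the plane *)

Section CkFunctions.
Context {R : realType}.
Local Notation V := 'rV[R]_2.
Implicit Types (f h : V -> R) (x y v : V) (U : set V) (i j : 'I_2).
Local Notation e_ i := (delta_mx 0 i : V).

Lemma linear_row2 (L : {linear V -> R}) (a b : R) :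
  L (a *: e_ 0 + b *: e_ 1) = a * L (e_ 0) + b * L (e_ 1).
Proof. by rewrite linearD !linearZ. Qed.

Lemma is_diff_components (t : V -> V) x :
  (forall c, differentiable (fun y => t y 0 c) x) ->
  is_diff x t (fun v => 'd (fun y => t y 0 0) x v *: e_ 0 + 'd (fun y => t y 0 1) x v *: e_ 1).
Proof.
move=> dt.
have E : t = (fun y => t y 0 0 *: e_ 0) + (fun y => t y 0 1 *: e_ 1).
  by apply/funext => y; rewrite [LHS]row2E.
have d0 : is_diff x (fun y => t y 0 0 *: e_ 0) (fun v => 'd (fun y => t y 0 0) x v *: e_ 0).
  by apply: DiffDef; [exact: differentiableZl|rewrite diffZl].
have d1 : is_diff x (fun y => t y 0 1 *: e_ 1) (fun v => 'd (fun y => t y 0 1) x v *: e_ 1).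
  by apply: DiffDef; [exact: differentiableZl|rewrite diffZl].
by rewrite {1}E; exact: is_diffD.
Qed.

Lemma differentiable_comp_plane f (t : V -> V) x :
  (forall c, differentiable (fun y => t y 0 c) x) -> differentiable f (t x) ->
  differentiable (f \o t) x.
Proof.
move=> /is_diff_components dt df; apply: differentiable_comp => //.
Qed.

Lemma partial_comp f (t : V -> V) x i :
  (forall c, differentiable (fun y => t y 0 c) x) -> differentiable f (t x) ->
  partial i (f \o t) x =
  partial 0 f (t x) * partial i (fun y => t y 0 0) x +
  partial 1 f (t x) * partial i (fun y => t y 0 1) x.
Proof.
move=> dt df; have dt' := is_diff_components dt.
rewrite partialE; last exact: differentiable_comp_plane.
have -> : 'd (f \o t) x = 'd f (t x) \o 'd t x :> (V -> R).
  by apply: diff_comp => //; exact: ex_diff.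
have -> : ('d f (t x) \o 'd t x) (e_ i) = 'd f (t x) ('d t x (e_ i)) by [].
have -> : 'd t x (e_ i) = partial i (fun y => t y 0 0) x *: e_ 0 + partial i (fun y => t y 0 1) x *: e_ 1.
  by rewrite !partialE //; exact: (congr1 (fun F : V -> V => F (e_ i)) (@diff_val _ _ _ _ _ _ _ dt')).
by rewrite linear_row2 -!partialE //; congr (_ + _); exact: mulrC.
Qed.

Lemma differentiable_comp1 f (g : R -> R) x : differentiable f x ->
  derivable g (f x) 1 -> differentiable (g \o f) x.
Proof.
by move=> df /derivable1_diffP dg; exact: differentiable_comp.
Qed.

Lemma partial_comp1 f (g : R -> R) x i (d : R) : differentiable f x ->
  is_derive (f x) (1 : R) g d -> partial i (g \o f) x = d * partial i f x.
Proof.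
move=> df [dg0 <-]; have dg : differentiable g (f x) by exact/derivable1_diffP.
rewrite (partialE _ df) partialE; last exact: differentiable_comp1.
have -> : 'd (g \o f) x = 'd g (f x) \o 'd f x :> (V -> R) by exact: diff_comp.
have E (L : {linear R -> R}) (a : R) : L a = L 1 * a.
  by rewrite -[in LHS](mulr1 a) -[a * 1]/(a *: 1) linearZ mulrC.
by rewrite (deriveE _ dg) -E.
Qed.

(** A finite-order version of [smooth_on], needed for the cutoffs, which are only C^3.
    Differentiability is required instead of the mere existence of partial derivatives, so that the
    chain rule applies at once. Derivatives are those of the function on the whole plane. *)
Fixpoint Ck (k : nat) (U : set V) f : Prop :=
  if k is k'.+1 then
    (forall x, U x -> differentiable f x) /\ forall i, Ck k' U (partial i f)
  else forall x, U x -> {for x, continuous f}.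

Lemma CkS_diff k U f x : Ck k.+1 U f -> U x -> differentiable f x.
Proof. by move=> [H _]; exact: H. Qed.

Lemma CkS_partial k U f i : Ck k.+1 U f -> Ck k U (partial i f).
Proof. by move=> [_ H]; exact: H. Qed.

Lemma CkS k U f : Ck k.+1 U f -> Ck k U f.
Proof.
elim: k f => [|k IH] f [df pf] /=.
  by move=> x /df /differentiable_continuous.
by split=> [x|i]; [exact: df|apply: IH; exact: pf].
Qed.

Lemma Ck_le k l U f : (k <= l)%N -> Ck l U f -> Ck k U f.
Proof.
elim: l => [|l IH]; first by rewrite leqn0 => /eqP ->.
by rewrite leq_eqVlt => /predU1P[->//|kl] /CkS; exact: IH.
Qed.

Lemma Ck_cont k U f x : Ck k U f -> U x -> {for x, continuous f}.
Proof. by move=> /(@Ck_le 0 k _ _ (leq0n _)) H; exact: H. Qed.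

Lemma Ck_local k U f : (forall x, U x -> exists2 U', U' x & Ck k U' f) -> Ck k U f.
Proof.
elim: k f => [|k IH] f /= H.
  by move=> x Ux; have [U' U'x] := H x Ux; exact.
split=> [x Ux|i]; first by have [U' U'x [+ _]] := H x Ux; exact.
by apply: IH => x Ux; have [U' U'x [_ d]] := H x Ux; exists U'.
Qed.

Lemma eq_on_partial U f h x i : open U -> (forall y, U y -> f y = h y) -> U x ->
  partial i f x = partial i h x.
Proof.
move=> oU E Ux; apply: near_eq_derive; apply: filterS (open_nbhs_nbhs (conj oU Ux)).
exact: E.
Qed.

Lemma eq_on_Ck k U f h : open U -> (forall y, U y -> f y = h y) -> Ck k U f -> Ck k U h.
Proof.
move=> oU; elim: k f h => [|k IH] f h E /=.
  move=> cf x Ux; have := cf x Ux; rewrite /prop_for /continuous_at -(E x Ux).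
  have N : nbhs x U by exact: open_nbhs_nbhs.
  apply: cvg_trans; apply: (@near_eq_cvg _ _ (nbhs x) _ f h).
  by apply: filterS N => y /E.
move=> [df pf]; split=> [x Ux|i].
  apply: (@near_eq_differentiable _ f) (df x Ux).
  have N : nbhs x U by exact: open_nbhs_nbhs.
  by apply: filterS N => y /E.
by apply: IH (pf i) => y Uy; exact: (eq_on_partial _ oU E).
Qed.

Lemma smooth_on_Ck U f : open U -> smooth_on U f -> forall k, Ck k U f.
Proof.
move=> oU sf k.
(* The induction on [k] needs all iterated partials at once, as a partial derivative of one of them
   is another one. *)
suff H (s : seq 'I_2) : Ck k U (iter_partial s f) by exact: (H [::]).
elim: k s => [|k IH] s /=; first by move=> x /(sf s) [].
split=> [x Ux|i]; last exact: (IH (i :: s)).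
apply: C1_differentiable => i.
  by apply: filterS (open_nbhs_nbhs (conj oU Ux)) => y /(sf s) [].
by have [] := sf (i :: s) x Ux.
Qed.

Lemma partial_cst (c : R) i : partial i (cst c : V -> R) = cst 0.
Proof. by apply/funext => x; exact: derive_cst. Qed.

Lemma Ck_cst k U (c : R) : Ck k U (cst c).
Proof.
elim: k c => [|k IH] c /=; first by move=> x _; exact: cst_continuous.
by split=> [x _|i]; [exact: differentiable_cst|rewrite partial_cst].
Qed.

Lemma partialD f h x i : differentiable f x -> differentiable h x ->
  partial i (fun y => f y + h y) x = partial i f x + partial i h x.
Proof. by move=> df dh; exact: (deriveD (diff_derivable df) (diff_derivable dh)). Qed.

Lemma partialN f x i : differentiable f x ->
  partial i (fun y => - f y) x = - partial i f x.
Proof. by move=> df; exact: (deriveN (diff_derivable df)). Qed.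

Lemma partialB f h x i : differentiable f x -> differentiable h x ->
  partial i (fun y => f y - h y) x = partial i f x - partial i h x.
Proof. by move=> df dh; exact: (deriveB (diff_derivable df) (diff_derivable dh)). Qed.

Lemma partialM f h x i : differentiable f x -> differentiable h x ->
  partial i (fun y => f y * h y) x = f x * partial i h x + h x * partial i f x.
Proof. by move=> df dh; exact: (deriveM (diff_derivable df) (diff_derivable dh)). Qed.

Lemma differentiable_add f h x : differentiable f x -> differentiable h x ->
  differentiable (fun y => f y + h y) x.
Proof. exact: differentiableD. Qed.

Lemma differentiable_opp f x : differentiable f x ->
  differentiable (fun y => - f y) x.
Proof. exact: differentiableN. Qed.

Lemma differentiable_mul f h x : differentiable f x -> differentiable h x ->
  differentiable (fun y => f y * h y) x.
Proof. exact: differentiableM. Qed.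

Lemma CkD k U f h : open U -> Ck k U f -> Ck k U h -> Ck k U (fun y => f y + h y).
Proof.
move=> oU; elim: k f h => [|k IH] f h.
  by move=> cf ch x Ux; apply: (@continuousD _ _ _ f h); [exact: cf|exact: ch].
move=> [df pf] [dh ph]; split=> [x Ux|i].
  by apply: differentiable_add; [exact: df|exact: dh].
apply: (@eq_on_Ck _ _ (fun y => partial i f y + partial i h y)) => //.
  by move=> y Uy; rewrite partialD //; [exact: df|exact: dh].
exact: (IH _ _ (pf i) (ph i)).
Qed.

Lemma CkN k U f : open U -> Ck k U f -> Ck k U (fun y => - f y).
Proof.
move=> oU; elim: k f => [|k IH] f.
  by move=> cf x Ux; apply: (@continuousN _ _ _ f); exact: cf.
move=> [df pf]; split=> [x Ux|i].
  by apply: differentiable_opp; exact: df.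
apply: (@eq_on_Ck _ _ (fun y => - partial i f y)) => //.
  by move=> y Uy; rewrite partialN //; exact: df.
exact: (IH _ (pf i)).
Qed.

Lemma CkB k U f h : open U -> Ck k U f -> Ck k U h -> Ck k U (fun y => f y - h y).
Proof. by move=> oU cf ch; apply: CkD => //; exact: CkN. Qed.

Lemma CkM k U f h : open U -> Ck k U f -> Ck k U h -> Ck k U (fun y => f y * h y).
Proof.
move=> oU; elim: k f h => [|k IH] f h.
  by move=> cf ch x Ux; apply: (@continuousM _ _ f h); [exact: cf|exact: ch].
move=> Cf Ch; have [df pf] := Cf; have [dh ph] := Ch; split=> [x Ux|i].
  by apply: differentiable_mul; [exact: df|exact: dh].
apply: (@eq_on_Ck _ _ (fun y => f y * partial i h y + h y * partial i f y)) => //.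
  by move=> y Uy; rewrite partialM //; [exact: df|exact: dh].
apply: CkD => //.
  exact: (IH _ _ (CkS Cf) (ph i)).
exact: (IH _ _ (CkS Ch) (pf i)).
Qed.

Lemma Ck_sum k U (I : Type) (r : seq I) (F : I -> V -> R) : open U ->
  (forall a, Ck k U (F a)) -> Ck k U (fun y => \sum_(a <- r) F a y).
Proof.
move=> oU cF; elim: r => [|a r IH].
  by apply: (@eq_on_Ck _ _ (cst 0)) (Ck_cst _ _ _) => // y _; rewrite big_nil.
apply: (@eq_on_Ck _ _ (fun y => F a y + \sum_(b <- r) F b y)) => //.
  by move=> y _; rewrite big_cons.
exact: CkD.
Qed.

Lemma partial_coord (c i : 'I_2) : partial i (fun x : V => x 0 c) = cst (c == i)%:R.
Proof.
apply/funext => x; rewrite /partial deriveE; last exact: differentiable_coord.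
pose L := fun N : V => N 0 c.
have lin : linear L by move=> k u v; rewrite /L !mxE.
pose dfM := GRing.isLinear.Build _ _ _ _ _ lin.
pose dfL : {linear V -> R} := HB.pack L dfM.
by rewrite (@diff_lin _ _ _ dfL); [rewrite /= /L mxE eqxx|exact: coord_continuous].
Qed.

Lemma Ck_coord k U (c : 'I_2) : Ck k U (fun x : V => x 0 c).
Proof.
case: k => [|k]; first by move=> x _; exact: continuous_coord.
split=> [x _|i]; first exact: differentiable_coord.
by rewrite partial_coord; exact: Ck_cst.
Qed.

Lemma row2_continuous_at (T : topologicalType) (t : T -> V) (x : T) :
  (forall c, {for x, continuous (fun s : T => t s 0 c)}) -> {for x, continuous t}.
Proof. by move=> ct; apply: row2_cvg => c; exact: ct. Qed.

Lemma Ck_comp k U U' f (t : V -> V) : open U ->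
  (forall c, Ck k U (fun y => t y 0 c)) -> (forall x, U x -> U' (t x)) ->
  Ck k U' f -> Ck k U (f \o t).
Proof.
move=> oU; elim: k f => [|k IH] f ct tU cf.
  move=> x Ux; apply: continuous_comp; last by apply: cf; exact: tU.
  by apply: row2_continuous_at => c; exact: ct.
have dt x : U x -> forall c, differentiable (fun y => t y 0 c) x.
  by move=> Ux c; exact: CkS_diff (ct c) Ux.
have [df pf] := cf; split=> [x Ux|i].
  by apply: differentiable_comp_plane; [exact: dt|apply: df; exact: tU].
apply: (@eq_on_Ck _ _ (fun x => (partial 0 f \o t) x * partial i (fun y => t y 0 0) x +
                                (partial 1 f \o t) x * partial i (fun y => t y 0 1) x)) => //.
  by move=> y Uy; rewrite partial_comp //; [exact: dt|apply: df; exact: tU].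
have C c : Ck k U (partial c f \o t).
  by apply: (IH _ _ tU (pf c)) => c'; exact: CkS (ct c').
have D c : Ck k U (partial i (fun y => t y 0 c)) by exact: CkS_partial (ct c).
by apply: CkD => //; apply: CkM.
Qed.

(** The derivative of [1/f] is a polynomial in [1/f] and [partial i f], so that the induction on the
    order feeds itself. *)
Lemma CkV k U f : open U -> (forall x, U x -> f x != 0) -> Ck k U f ->
  Ck k U (fun y => (f y)^-1).
Proof.
move=> oU f0; elim: k => [|k IH].
  by move=> cf x Ux; apply: (@continuousV _ _ f); [exact: f0|exact: cf].
move=> Cf; have [df pf] := Cf.
have dV x : U x -> is_derive (f x) (1 : R) (@GRing.inv R) (- (f x)^-2).
  move=> Ux; have d : derivable (fun s : R => s) (f x) 1 by exact: derivable_id.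
  apply: DeriveDef; first exact: (derivableV (f0 x Ux) d).
  by rewrite (deriveV (f0 x Ux) d) derive_id; exact: mulr1.
split=> [x Ux|i].
  apply: (@differentiable_comp1 f (@GRing.inv R)); first exact: df.
  by have [] := dV x Ux.
apply: (@eq_on_Ck _ _ (fun y => (- ((f y)^-1 * (f y)^-1)) * partial i f y)) => //.
  move=> y Uy; rewrite (@partial_comp1 f (@GRing.inv R) y i _ (df y Uy) (dV y Uy)).
  by rewrite expr2 invfM.
have IHf := IH (CkS Cf).
by apply: CkM => //; last exact: (pf i); apply: CkN => //; exact: CkM.
Qed.

Lemma Ck_sqrt k U f : open U -> (forall x, U x -> 0 < f x) -> Ck k U f ->
  Ck k U (fun y => Num.sqrt (f y)).
Proof.
move=> oU f0; elim: k => [|k IH].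
  move=> cf x Ux; apply: (@continuous_comp _ _ _ f (@Num.sqrt R)); first exact: cf.
  exact: sqrt_continuous.
move=> Cf; have [df pf] := Cf.
have dV x : U x -> is_derive (f x) (1 : R) (@Num.sqrt R) ((2 * Num.sqrt (f x))^-1).
  by move=> Ux; exact: is_derive1_sqrt (f0 x Ux).
split=> [x Ux|i].
  apply: (@differentiable_comp1 f (@Num.sqrt R)); first exact: df.
  by have [] := dV x Ux.
apply: (@eq_on_Ck _ _ (fun y => (2 * Num.sqrt (f y))^-1 * partial i f y)) => //.
  by move=> y Uy; rewrite (@partial_comp1 f _ y i _ (df y Uy) (dV y Uy)).
have IHf := IH (CkS Cf).
apply: CkM => //; last exact: (pf i); apply: CkV => //.
  by move=> x Ux; rewrite mulf_neq0 ?gt_eqF ?sqrtr_gt0 ?f0.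
by apply: CkM => //; exact: (Ck_cst _ _ 2).
Qed.

(** The source of compactly supported cutoffs: for positive [n] this power of the positive part is
    of class C^(n-1), and its derivative is again of the same kind. *)
Definition pospow (n : nat) (t : R) : R := (Num.max 0 t) ^+ n.

Lemma is_derive_pospow (n : nat) (t : R) :
  is_derive t (1 : R) (pospow n.+2) (n.+2%:R * pospow n.+1 t).
Proof.
have [t0|t0|t0] := ltgtP t 0.
- have E : \forall s \near t, (cst 0 : R -> R) s = pospow n.+2 s.
    near=> s; rewrite /pospow max_l ?expr0n //=.
    by rewrite ltW //; near: s; exact: lt_nbhsl.
  apply: near_eq_is_derive E _.
  by rewrite /pospow max_l 1?ltW // expr0n mulr0; exact: is_derive_cst.
- have E : \forall s \near t, (fun s : R => s ^+ n.+2) s = pospow n.+2 s.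
    near=> s; rewrite /pospow max_r //.
    by rewrite ltW //; near: s; exact: lt_nbhsr.
  apply: near_eq_is_derive E _.
  rewrite /pospow max_r 1?ltW //.
  apply: DeriveDef; first exact: exprn_derivable.
  by rewrite exp_derive; exact: mulr1.
rewrite t0 /pospow max_l // expr0n mulr0 -/(pospow n.+2).
(* At 0 the difference quotient is at most |h|^(n+1), hence at most |h| as soon as |h| <= 1. *)
have C : (fun h : R => h^-1 *: ((pospow n.+2 \o shift 0) (h *: 1) - pospow n.+2 0)) @ 0^' --> (0 : R).
  apply/cvgrPdist_le => eps e0; near=> h.
  have h0 : h != 0 by near: h; exact: nbhs_dnbhs_neq.
  have h1 : `|h| <= Num.min 1 eps.
    near: h; apply: nbhs_dnbhs; apply/nbhs_ballP; exists (Num.min 1 eps) => /=.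
      by rewrite lt_min ltr01 e0.
    by move=> h; rewrite -ball_normE /= sub0r normrN => /ltW.
  have P0 : pospow n.+2 0 = 0 by rewrite /pospow max_l // expr0n.
  rewrite /= P0 subr0 addr0 [_%:A]mulr1 /pospow sub0r normrN normrM normrX normfV.
  have mh : `|Num.max 0 h| <= `|h|.
    by have [h0'|h0'] := leP h 0; rewrite ?normr0 ?normr_ge0.
  rewrite mulrC ler_pdivrMr ?normr_gt0 // (le_trans (lerXn2r _ _ _ mh)) ?nnegrE ?normr_ge0 //.
  move: h1; rewrite le_min => /andP[h1 h2].
  rewrite exprS mulrC ler_pM ?exprn_ge0 ?normr_ge0 // exprS.
  by rewrite (le_trans _ h2) // ler_piMr ?normr_ge0 // exprn_ile1 ?normr_ge0.
apply: DeriveDef; first by apply/cvg_ex; exists 0.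
by rewrite /derive; apply/cvg_lim.
Unshelve. all: by end_near. Qed.

Lemma continuous_pospow (n : nat) : continuous (pospow n).
Proof.
move=> t; have -> : pospow n = (fun s : R => s ^+ n) \o Num.max 0 by [].
apply: continuous_comp.
  by apply: (@continuous_max _ _ (fun=> 0) id) => //; exact: cst_continuous.
exact: exprn_continuous.
Qed.

Lemma Ck_pospow k n U f : open U -> (k <= n)%N -> Ck k U f -> Ck k U (fun y => pospow n.+1 (f y)).
Proof.
move=> oU; elim: k n => [|k IH] n kn.
  move=> cf x Ux; apply: (@continuous_comp _ _ _ f (pospow n.+1)); first exact: cf.
  exact: continuous_pospow.
case: n kn => [//|n kn] Cf; have [df pf] := Cf.
split=> [x Ux|i].
  apply: (@differentiable_comp1 f (pospow n.+2)); first exact: df.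
  by have [] := is_derive_pospow n (f x).
apply: (@eq_on_Ck _ _ (fun y => (n.+2%:R * pospow n.+1 (f y)) * partial i f y)) => //.
  by move=> y Uy; rewrite (@partial_comp1 f _ y i _ (df y Uy) (is_derive_pospow n (f y))).
apply: CkM => //; last exact: (pf i).
apply: CkM => //; first exact: (Ck_cst _ _ n.+2%:R).
exact: (IH _ kn (CkS Cf)).
Qed.

Lemma ler_dist_half (a b c eps : R) :
  `|a - c| <= eps / 2 -> `|b - c| <= eps / 2 -> `|a - b| <= eps.
Proof.
move=> h1 h2; rewrite -(subrK c a) -addrA (le_trans (ler_normD _ _)) //.
by rewrite (splitr eps) lerD // distrC.
Qed.

(** The second difference of [f] over a small square of side [t] is [t^2] times a mixed derivative
    at some point of the square, for either order of the two directions. The two values agree, and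
    continuity at [x] carries the equality there. *)
Lemma schwarz01 U f x : open U -> Ck 2 U f -> U x ->
  partial 0 (partial 1 f) x = partial 1 (partial 0 f) x.
Proof.
move=> oU Cf Ux.
have Cp k : Ck 1 U (partial k f) by exact: CkS_partial.
have c01 : {for x, continuous (partial 0 (partial 1 f))} by exact: (Ck_cont (CkS_partial _ (Cp _))).
have c10 : {for x, continuous (partial 1 (partial 0 f))} by exact: (Ck_cont (CkS_partial _ (Cp _))).
apply/eqP; rewrite -subr_eq0 -normr_le0; apply/ler_addgt0Pl => eps e0.
rewrite addr0.
have e2 : 0 < eps / 2 by rewrite divr_gt0.
have : \forall y \near x, U y /\ (`|partial 0 (partial 1 f) x - partial 0 (partial 1 f) y| <= eps / 2 /\
    `|partial 1 (partial 0 f) x - partial 1 (partial 0 f) y| <= eps / 2).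
  have N : nbhs x U by exact: open_nbhs_nbhs.
  have /cvgrPdist_le/(_ _ e2) N01 := c01.
  have /cvgrPdist_le/(_ _ e2) N10 := c10.
  by apply: filterS3 N N01 N10 => y h1 h2 h3; exact: (conj h1 (conj h2 h3)).
move=> /nbhs_ballP[r /= r0 B].
(* Two displacements of size at most [t] then stay within half the radius of the ball. *)
pose t := r / 4.
have t0 : 0 < t by rewrite divr_gt0.
have bnd a c : `|a| <= `|t| -> `|c| <= `|t| -> ball x r (x + a *: e_ 0 + c *: e_ 1).
  rewrite (gtr0_norm t0) => ha hc; rewrite -ball_normE /=.
  have -> : x - (x + a *: e_ 0 + c *: e_ 1) = - (a *: e_ 0 + c *: e_ 1).
    by rewrite -addrA opprD addrA subrr add0r.
  rewrite normrN (le_lt_trans (ler_normD _ _)) // !normrZ.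
  have h1 : `|a| * `|e_ 0| <= t by rewrite (le_trans (ler_piMr _ (norm_delta _))).
  have h2 : `|c| * `|e_ 1| <= t by rewrite (le_trans (ler_piMr _ (norm_delta _))).
  have : r = t * 4 by rewrite /t; field.
  lra.
have dU y : ball x r y -> differentiable f y by move=> /B[Uy _]; exact: CkS_diff Cf Uy.
have dpU y k : ball x r y -> differentiable (partial k f) y by move=> /B[Uy _]; exact: CkS_diff (Cp k) Uy.
have [z Bz Ez] : exists2 z, ball x r z &
   f (x + t *: e_ 0 + t *: e_ 1) - f (x + t *: e_ 0) - (f (x + t *: e_ 1) - f x) = t * (t * partial 1 (partial 0 f) z).
  pose h := fun y => f (y + t *: e_ 1) - f y.
  have sh y : ball x r (y + t *: e_ 1) -> differentiable (fun y => f (y + t *: e_ 1)) y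
     /\ partial 0 (fun y => f (y + t *: e_ 1)) y = partial 0 f (y + t *: e_ 1).
    move=> By; have dy c : differentiable (fun y : V => (y + t *: e_ 1) 0 c) y.
      under eq_fun do rewrite mxE.
      by apply: differentiable_add; [exact: differentiable_coord|exact: differentiable_cst].
    split; first by apply: (@differentiable_comp_plane f (fun y => y + t *: e_ 1)) => //; exact: dU.
    rewrite (@partial_comp f (fun y => y + t *: e_ 1)) //; last exact: dU.
    have E c : partial 0 (fun y : V => (y + t *: e_ 1) 0 c) y = (c == 0)%:R.
      under eq_fun do rewrite mxE.
      rewrite partialD; [|exact: differentiable_coord|exact: differentiable_cst].
      by rewrite partial_coord (partial_cst ((t *: e_ 1) 0 c)) addr0.
    by rewrite !E /= mulr1 mulr0 addr0.
  have Bs s : `|s| <= `|t| -> ball x r (x + s *: e_ 0).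
    by move=> hs; have := bnd s 0 hs; rewrite normr0 scale0r addr0; apply => //; exact: normr_ge0.
  have dh s : `|s| <= `|t| -> derivable h (x + s *: e_ 0) (e_ 0).
    move=> hs; apply: diff_derivable; apply: differentiableB; last by apply: dU; exact: Bs.
    by apply: (proj1 (sh _ _)); exact: bnd.
  have [s hs Es] := line_MVT dh.
  have [s' hs' Es'] := @line_MVT _ _ (partial 0 f) (x + s *: e_ 0) (e_ 1) t (fun s' (q : `|s'| <= `|t|) => diff_derivable (dpU _ 0 (bnd _ _ hs q))).
  exists (x + s *: e_ 0 + s' *: e_ 1); first exact: bnd.
  move: Es; rewrite /h => ->; congr (_ * _); rewrite -[RHS]Es'.
  rewrite -[LHS]/(partial 0 _ _) partialB.
  - by rewrite (proj2 (sh _ _)) //; exact: bnd.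
  - by apply: (proj1 (sh _ _)); exact: bnd.
  - by apply: dU; exact: Bs.
have [w Bw Ew] : exists2 w, ball x r w &
   f (x + t *: e_ 0 + t *: e_ 1) - f (x + t *: e_ 0) - (f (x + t *: e_ 1) - f x) = t * (t * partial 0 (partial 1 f) w).
  pose h := fun y => f (y + t *: e_ 0) - f y.
  have sh y : ball x r (y + t *: e_ 0) -> differentiable (fun y => f (y + t *: e_ 0)) y
     /\ partial 1 (fun y => f (y + t *: e_ 0)) y = partial 1 f (y + t *: e_ 0).
    move=> By; have dy c : differentiable (fun y : V => (y + t *: e_ 0) 0 c) y.
      under eq_fun do rewrite mxE.
      by apply: differentiable_add; [exact: differentiable_coord|exact: differentiable_cst].
    split; first by apply: (@differentiable_comp_plane f (fun y => y + t *: e_ 0)) => //; exact: dU.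
    rewrite (@partial_comp f (fun y => y + t *: e_ 0)) //; last exact: dU.
    have E c : partial 1 (fun y : V => (y + t *: e_ 0) 0 c) y = (c == 1)%:R.
      under eq_fun do rewrite mxE.
      rewrite partialD; [|exact: differentiable_coord|exact: differentiable_cst].
      by rewrite partial_coord (partial_cst ((t *: e_ 0) 0 c)) addr0.
    by rewrite !E /= mulr1 mulr0 add0r.
  have C a c : x + a *: e_ 0 + c *: e_ 1 = x + c *: e_ 1 + a *: e_ 0 by rewrite addrAC.
  have Bs s : `|s| <= `|t| -> ball x r (x + s *: e_ 1).
    by move=> hs; have := bnd 0 s; rewrite normr0 scale0r addr0; apply => //; exact: normr_ge0.
  have dh s : `|s| <= `|t| -> derivable h (x + s *: e_ 1) (e_ 1).
    move=> hs; apply: diff_derivable; apply: differentiableB; last by apply: dU; exact: Bs.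
    by apply: (proj1 (sh _ _)); rewrite -C; exact: bnd.
  have [s hs Es] := line_MVT dh.
  have Bb s' : `|s'| <= `|t| -> ball x r (x + s *: e_ 1 + s' *: e_ 0) by move=> h'; rewrite -C; exact: bnd.
  have [s' hs' Es'] := @line_MVT _ _ (partial 1 f) (x + s *: e_ 1) (e_ 0) t (fun s' (q : `|s'| <= `|t|) => diff_derivable (dpU _ 1 (Bb _ q))).
  exists (x + s *: e_ 1 + s' *: e_ 0); first exact: Bb.
  have -> : f (x + t *: e_ 0 + t *: e_ 1) - f (x + t *: e_ 0) - (f (x + t *: e_ 1) - f x)
     = h (x + t *: e_ 1) - h x by rewrite /h -C; ring.
  rewrite Es; congr (_ * _); rewrite -[RHS]Es'.
  rewrite -[LHS]/(partial 1 _ _) partialB.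
  - by rewrite (proj2 (sh _ _)) //; exact: Bb.
  - by apply: (proj1 (sh _ _)); exact: Bb.
  - by apply: dU; exact: Bs.
have E : partial 1 (partial 0 f) z = partial 0 (partial 1 f) w.
  by move: Ez; rewrite Ew => /(mulfI (lt0r_neq0 t0)) /(mulfI (lt0r_neq0 t0)) ->.
have [_ [_ hz]] := B z Bz; have [_ [hw _]] := B w Bw.
by rewrite E in hz; exact: (ler_dist_half hw hz).
Qed.

Lemma schwarz U f x i j : open U -> Ck 2 U f -> U x ->
  partial i (partial j f) x = partial j (partial i f) x.
Proof.
move=> oU Cf Ux; have E := schwarz01 oU Cf Ux.
have [->|->] := ord2P i; have [->|->] := ord2P j.
- reflexivity.
- exact: E.
- exact: (esym E).
- reflexivity.
Qed.

End CkFunctions.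

(** * Integrals over segments *)

Section SegmentIntegral.
Context {R : realType}.
Local Notation mu := (@lebesgue_measure R).
Implicit Types (f h : R -> R) (a b c d : R).

(** The integral is not oriented: it is 0 when [b < a], hence the hypotheses [a <= b] of several
    lemmas. *)
Definition itg a b f : R := (\int[mu]_(x in `[a, b]) f x)%R.

(** Continuity at the end points is two-sided: integrands are regular on a neighbourhood of the
    segment. *)
Definition seg_cont a b f := forall t, a <= t <= b -> {for t, continuous f}.

Lemma seg_cont_within a b f : seg_cont a b f -> {within `[a, b], continuous f}.
Proof.
move=> cf; apply: continuous_in_subspaceT => x; rewrite inE /= in_itv /=; exact: cf.
Qed.

Lemma seg_integrable a b f : seg_cont a b f -> mu.-integrable `[a, b] (EFin \o f).
Proof.
move=> /seg_cont_within cf; apply: continuous_compact_integrable => //.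
exact: segment_compact.
Qed.

Lemma eq_itg a b f h : (forall t, a <= t <= b -> f t = h t) -> itg a b f = itg a b h.
Proof. by move=> E; apply: eq_Rintegral => x; rewrite inE /= in_itv /=; exact: E. Qed.

Lemma itgD a b f h : seg_cont a b f -> seg_cont a b h ->
  itg a b (fun t => f t + h t) = itg a b f + itg a b h.
Proof. by move=> cf ch; apply: RintegralD => //; exact: seg_integrable. Qed.

Lemma itgB a b f h : seg_cont a b f -> seg_cont a b h ->
  itg a b (fun t => f t - h t) = itg a b f - itg a b h.
Proof. by move=> cf ch; apply: RintegralB => //; exact: seg_integrable. Qed.

Lemma itgZ a b f (k : R) : seg_cont a b f ->
  itg a b (fun t => k * f t) = k * itg a b f.
Proof. by move=> cf; apply: RintegralZl => //; exact: seg_integrable. Qed.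

Lemma itg0 a b : itg a b (fun=> 0) = 0.
Proof.
by rewrite /itg Rintegral_cst ?mul0r.
Qed.

Lemma itg_ge0 a b f : (forall t, a <= t <= b -> 0 <= f t) -> 0 <= itg a b f.
Proof. by move=> f0; apply: Rintegral_ge0 => x; rewrite /= in_itv /=; exact: f0. Qed.

Lemma seg_cst a b k : seg_cont a b (fun=> k).
Proof. by move=> t _; exact: cst_continuous. Qed.

Lemma itg_cst a b k : a <= b -> itg a b (fun=> k) = k * (b - a).
Proof.
move=> ab; rewrite /itg Rintegral_cst //; congr (_ * _).
rewrite -[RHS]/(fine (b - a)%:E); apply: (congr1 fine).
have /= E := lebesgue_measure_itv `[a, b]; apply: (etrans E).
by rewrite lte_fin; case: ltgtP ab => // -> _; rewrite subrr.
Qed.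

Lemma le_itg a b f h : seg_cont a b f -> seg_cont a b h ->
  (forall t, a <= t <= b -> f t <= h t) -> itg a b f <= itg a b h.
Proof.
by move=> cf ch fh; apply: le_Rintegral => //; exact: seg_integrable.
Qed.

Lemma itg_norm_le a b f (eps : R) : a <= b -> seg_cont a b f ->
  (forall t, a <= t <= b -> `|f t| <= eps) -> `|itg a b f| <= eps * (b - a).
Proof.
move=> ab cf fe; rewrite ler_norml -mulNr -!itg_cst //; apply/andP; split;
  apply: le_itg => //; try exact: seg_cst; move=> t /fe; rewrite ler_norml => /andP[] //.
Qed.

Lemma itg_FTC a b F f : a <= b -> seg_cont a b f ->
  (forall t, a <= t <= b -> is_derive t (1 : R) F (f t)) -> itg a b f = F b - F a.
Proof.
rewrite le_eqVlt => /predU1P[<- _ _|ab cf dF].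
  by rewrite subrr /itg set_itv1 Rintegral_set1.
have cF t : a <= t <= b -> {for t, continuous F}.
  move=> /dF d; apply: differentiable_continuous; apply/derivable1_diffP.
  exact: ex_derive.
have ab' := ltW ab.
rewrite /itg /Rintegral (@continuous_FTC2 _ f F a b ab) //.
- exact: seg_cont_within.
- split.
  + move=> t; rewrite in_itv /= => /andP[h1 h2]; apply: ex_derive.
    by apply: dF; rewrite !ltW.
  + by apply: cvg_at_right_filter; apply: cF; rewrite lexx.
  + by apply: cvg_at_left_filter; apply: cF; rewrite lexx andbT.
- move=> t; rewrite in_itv /= => /andP[h1 h2]; rewrite derive1E.
  by apply: derive_val; apply: dF; rewrite !ltW.
Qed.

Lemma itg_eq0 a b f c : seg_cont a b f -> (forall t, a <= t <= b -> 0 <= f t) ->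
  itg a b f = 0 -> a < c < b -> f c = 0.
Proof.
move=> cf f0 If /andP[ac cb]; apply/eqP; rewrite -[_ == _]negbK; apply/negP => fc.
have fcp : 0 < f c by rewrite lt_neqAle eq_sym fc f0 // !ltW.
have f2 : 0 < f c / 2 by rewrite divr_gt0.
have : \forall t \near c, a < t < b /\ f c / 2 <= f t.
  have cfc : {for c, continuous f} by apply: cf; rewrite !ltW.
  near=> t; split; last by near: t; apply: (cvgr_ge (f c) cfc); rewrite ltr_pdivrMr // ltr_pMr // ltr1n.
  apply/andP; split; near: t; [exact: lt_nbhsr|exact: lt_nbhsl].
move=> /nbhs_ballP[r /= r0 B].
(* Halving the radius gives a closed segment inside the ball, on which [f] is at least [f c / 2];
   its contribution to the integral is positive. *)
have r2 : 0 < r / 2 by rewrite divr_gt0.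
have Br t : c - r / 2 <= t <= c + r / 2 -> a < t < b /\ f c / 2 <= f t.
  move=> ht; apply: B; rewrite /ball /= ltr_distlC.
  by case/andP: ht => h1 h2; apply/andP; split; lra.
have Bl := Br (c - r / 2); have Brr := Br (c + r / 2).
have /andP[l1 _] : a < c - r / 2 < b by apply: (proj1 (Bl _)); apply/andP; split; lra.
have /andP[_ l2] : a < c + r / 2 < b by apply: (proj1 (Brr _)); apply/andP; split; lra.
suff : 0 < itg a b f by rewrite If ltxx.
have cr : seg_cont (c - r / 2) (c + r / 2) f.
  move=> t ht; apply: cf; have [/andP[q1 q2] _] := Br t ht.
  by rewrite !ltW.
apply: (@lt_le_trans _ _ (itg (c - r / 2) (c + r / 2) f)).
  apply: (@lt_le_trans _ _ (itg (c - r / 2) (c + r / 2) (fun=> f c / 2))).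
    rewrite itg_cst; last lra.
    by rewrite mulr_gt0 //; lra.
  apply: le_itg => //; first exact: seg_cst.
  by move=> t /Br[].
rewrite /itg /Rintegral; apply: fine_le.
- exact: integrable_fin_num (seg_integrable cr).
- exact: integrable_fin_num (seg_integrable cf).
apply: ge0_subset_integral => //.
- exact: measurable_int (seg_integrable cf).
- move=> x; rewrite /= !in_itv /= => /Br[/andP[q1 q2] _].
  by rewrite !ltW.
Unshelve. all: by end_near. Qed.

Section ParamIntegral.
Variables (T : topologicalType) (a b : R) (k : T -> R -> R).
Implicit Types p q : T.

Definition jointly_cont (k : T -> R -> R) p :=
  forall t, a <= t <= b -> {for (p, t), continuous (fun z : T * R => k z.1 z.2)}.

Lemma param_cont_seg p : jointly_cont k p -> seg_cont a b (k p).
Proof.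
move=> ck t ht; have -> : k p = (fun z : T * R => k z.1 z.2) \o (fun t => (p, t)) by [].
apply: continuous_comp; last exact: ck.
exact: (@cvg_pair _ _ _ (nbhs t) (nbhs p) (nbhs t) _ _ _ (fun=> p) id (cvg_cst p) cvg_id).
Qed.

(** Compactness of the segment turns joint continuity at each [(p, t)] into closeness uniform in
    [t]. *)
Lemma param_unif p : jointly_cont k p -> forall eps : R, 0 < eps ->
  \forall q \near p, forall t, a <= t <= b -> `|k q t - k p t| <= eps.
Proof.
move=> ck eps e0.
have /compact_near_coveringP cv : compact `[a, b] by exact: segment_compact.
have H : \forall q \near p, `[a, b] `<=` (fun t => `|k q t - k p t| <= eps).
  apply: cv => t; rewrite /= in_itv /= => ht.
  have e2 : 0 < eps / 2 by rewrite divr_gt0.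
  have /cvgrPdist_le/(_ _ e2) /= N := ck t ht.
  have [[A B] /= [pA tB] AB] := N.
  exists (B, A) => //= -[t' q] /= [Bt' Aq].
  have h1 := AB (q, t') (conj Aq Bt').
  have h2 := AB (p, t') (conj (nbhs_singleton pA) Bt').
  rewrite /= in h1 h2; rewrite distrC in h1; rewrite distrC in h2.
  exact: ler_dist_half h1 h2.
by apply: filterS H => q H t ht; apply: H; rewrite /= in_itv.
Qed.

Lemma itg_param_continuous p : a <= b -> (\forall q \near p, seg_cont a b (k q)) ->
  jointly_cont k p -> {for p, continuous (fun q => itg a b (k q))}.
Proof.
move=> ab sk ck; apply/cvgrPdist_le => eps e0.
have skp := param_cont_seg ck.
(* The added 1 keeps the denominator positive when [a = b]. *)
have e1 : 0 < eps / (b - a + 1).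
  by rewrite divr_gt0 // ltr_pwDr // subr_ge0.
have U := param_unif ck e1.
near=> q.
have sq : seg_cont a b (k q) by near: q.
rewrite distrC -itgB //.
have sB : seg_cont a b (fun t => k q t - k p t).
  by move=> t ht; apply: (@continuousB _ _ _ (k q) (k p)); [exact: sq|exact: skp].
rewrite (le_trans (@itg_norm_le a b _ (eps / (b - a + 1)) ab sB _)) //.
  by near: q.
by rewrite mulrAC ler_pdivrMr ?ler_pM2l //; lra.
Unshelve. all: by end_near. Qed.
End ParamIntegral.

Section Leibniz.
Variables (W : normedModType R) (a b : R) (k dk : W -> R -> R) (p v : W).
Hypothesis ab : a <= b.
Hypothesis sk : \forall q \near p, seg_cont a b (k q).
Hypothesis dkE : \forall q \near p, forall t, a <= t <= b ->
  is_derive q v (k^~ t) (dk q t).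
Hypothesis cdk : jointly_cont a b dk p.

(** By the mean value theorem the difference quotient of the integrand is a value of [dk] at an
    intermediate point. This point varies with [t], but by [param_unif] the values of [dk] near [p]
    are close to [dk p] uniformly in [t]. *)
Lemma itg_Leibniz : is_derive p v (fun q => itg a b (k q)) (itg a b (dk p)).
Proof.
have abR := ab; have sdk := param_cont_seg cdk.
have skp := nbhs_singleton sk.
suff H : (fun z => z^-1 *: (((fun q => itg a b (k q)) \o shift p) (z *: v) - itg a b (k p))) @ 0^' --> itg a b (dk p).
  by apply: DeriveDef; [apply/cvg_ex; eexists; exact: H|exact/cvg_lim].
apply/cvgrPdist_le => eps e0.
have e1 : 0 < eps / (b - a + 1).
  by rewrite divr_gt0 // ltr_pwDr // subr_ge0.
have U := param_unif cdk e1.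
have line (P : W -> Prop) : (\forall q \near p, P q) -> \forall z \near (0 : R), P (p + z *: v).
  move=> Pp; have C : {for 0, continuous (fun z : R => p + z *: v)}.
    apply: (@continuousD _ _ _ (fun=> p) (fun z : R => z *: v)); first exact: cst_continuous.
    exact: scalel_continuous.
  by apply: C; rewrite scale0r addr0.
have N : \forall z \near (0 : R), [/\ seg_cont a b (k (p + z *: v)),
   forall t, a <= t <= b -> is_derive (p + z *: v) v (k^~ t) (dk (p + z *: v) t) &
   forall t, a <= t <= b -> `|dk (p + z *: v) t - dk p t| <= eps / (b - a + 1)].
  by apply: filterS3 (line _ sk) (line _ dkE) (line _ U) => z h1 h2 h3; split.
have [r /= r0 B] := (iffLR (nbhs_ballP _ _) N).
near=> z.
have h0 : z != 0 by near: z; exact: nbhs_dnbhs_neq.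
have Bh (s : R) : `|s| <= `|z| -> ball (0 : R) r s.
  move=> sh; rewrite -ball_normE /= sub0r normrN (le_lt_trans sh) //.
  near: z; apply: nbhs_dnbhs; apply/nbhs_ballP; exists r => //= s'.
  by rewrite -ball_normE /= sub0r normrN.
have [sh _ _] := B z (Bh z (lexx _)).
rewrite /= (addrC _ p) distrC -itgB //.
have sB : seg_cont a b (fun t => k (p + z *: v) t - k p t).
  by move=> t ht; apply: (@continuousB _ _ _ (k _) (k p)); [exact: sh|exact: skp].
rewrite -[z^-1 *: _]/(z^-1 * _) -itgZ //.
have sZ : seg_cont a b (fun t => z^-1 * (k (p + z *: v) t - k p t)).
  move=> t ht; apply: (@continuousM _ _ (fun=> z^-1) (fun t => k (p + z *: v) t - k p t)).
    exact: cst_continuous.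
  exact: sB.
rewrite -itgB //.
have sBB : seg_cont a b (fun t => z^-1 * (k (p + z *: v) t - k p t) - dk p t).
  move=> t ht; apply: (@continuousB _ _ _ (fun t => z^-1 * (k (p + z *: v) t - k p t)) (dk p)).
    exact: sZ.
  exact: sdk.
rewrite (le_trans (@itg_norm_le a b _ (eps / (b - a + 1)) ab sBB _)) //; last first.
  by rewrite mulrAC ler_pdivrMr ?ler_pM2l //; lra.
move=> t ht.
have [s|s hs ->] := @line_MVT _ W (k^~ t) p v z.
  by move=> /Bh /B[_ d _]; have [] := d t ht.
have [_ d u] := B s (Bh s hs).
have -> : 'D_v (k^~ t) (p + s *: v) = dk (p + s *: v) t by have [] := d t ht.
by rewrite mulKf //; exact: u.
Unshelve. all: by end_near. Qed.

End Leibniz.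

End SegmentIntegral.

(** * Iterated integrals over rectangles *)

Section PlaneIntegral.
Context {R : realType}.
Local Notation V := 'rV[R]_2.
Implicit Types (x y z v : V) (U : set V) (i j : 'I_2) (a b c d s t : R).
Local Notation e_ i := (delta_mx 0 i : V).

Definition mk2 s t : V := \row_j (if j == 0 then s else t).

Lemma mk20 s t : mk2 s t 0 0 = s. Proof. by rewrite mxE. Qed.
Lemma mk21 s t : mk2 s t 0 1 = t. Proof. by rewrite mxE. Qed.

Lemma mk2E x : mk2 (x 0 0) (x 0 1) = x.
Proof. by apply: row2_eq; rewrite ?mk20 ?mk21. Qed.

Lemma mk2_line0 s t : mk2 s t = mk2 0 t + s *: e_ 0.
Proof. by apply: row2_eq; rewrite !mxE /= ?mulr1 ?mulr0 ?add0r ?addr0. Qed.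

Lemma mk2_line1 s t : mk2 s t = mk2 s 0 + t *: e_ 1.
Proof. by apply: row2_eq; rewrite !mxE /= ?mulr1 ?mulr0 ?add0r ?addr0. Qed.

Lemma continuous_mk2 : continuous (fun p : R * R => mk2 p.1 p.2).
Proof.
move=> [s t]; apply: row2_cvg => i; under eq_fun do rewrite mxE; rewrite mxE.
by case: (i == 0); [exact: cvg_fst|exact: cvg_snd].
Qed.

Lemma tube (T : topologicalType) (phi : T -> R -> V) (p : T) a b U : open U ->
  (forall t, a <= t <= b -> {for (p, t), continuous (fun q : T * R => phi q.1 q.2)}) ->
  (forall t, a <= t <= b -> U (phi p t)) ->
  \forall q \near p, forall t, a <= t <= b -> U (phi q t).
Proof.
move=> oU cphi Up.
have /compact_near_coveringP cv : compact `[a, b] by exact: segment_compact.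
have H : \forall q \near p, `[a, b] `<=` (fun t => U (phi q t)).
  apply: cv => t; rewrite /= in_itv /= => ht.
  have N : nbhs (phi p t) U by apply: open_nbhs_nbhs; split=> //; exact: Up.
  have [[A B] /= [pA tB] AB] := cphi t ht U N.
  exists (B, A) => //= -[t' q] /= [Bt' Aq].
  exact: (AB (q, t') (conj Aq Bt')).
by apply: filterS H => q H t ht; apply: H; rewrite /= in_itv.
Qed.

Definition rect a b c d : set V := [set x | a <= x 0 0 <= b /\ c <= x 0 1 <= d].

Lemma rect_mk2 a b c d s t : a <= s <= b -> c <= t <= d -> rect a b c d (mk2 s t).
Proof. by move=> h1 h2; rewrite /rect /= mk20 mk21. Qed.

Lemma cont_mk2_param U (f : V -> R) s c d : Ck 0 U f ->
  (forall t, c <= t <= d -> U (mk2 s t)) ->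
  jointly_cont c d (fun s t => f (mk2 s t)) s.
Proof.
move=> cf Us t ht; apply: (@continuous_comp _ _ _ (fun p : R * R => mk2 p.1 p.2) f).
  exact: continuous_mk2.
by apply: cf; exact: Us.
Qed.

Lemma seg_cont_mk2 U (f : V -> R) s c d : Ck 0 U f ->
  (forall t, c <= t <= d -> U (mk2 s t)) -> seg_cont c d (fun t => f (mk2 s t)).
Proof. by move=> cf Us; exact: param_cont_seg (cont_mk2_param cf Us). Qed.

Lemma seg_cont_mk2' U (f : V -> R) t a b : Ck 0 U f ->
  (forall s, a <= s <= b -> U (mk2 s t)) -> seg_cont a b (fun s => f (mk2 s t)).
Proof.
move=> cf Us s hs.
have -> : (fun s => f (mk2 s t)) = f \o (fun s => mk2 s t) by [].
apply: continuous_comp; last by apply: cf; exact: Us.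
apply: row2_cvg => i; under eq_fun do rewrite mxE; rewrite mxE.
by case: (i == 0); [exact: cvg_id|exact: cvg_cst].
Qed.

Lemma near_seg_cont_mk2 U (f : V -> R) s c d : open U -> Ck 0 U f ->
  (forall t, c <= t <= d -> U (mk2 s t)) ->
  \forall s' \near s, seg_cont c d (fun t => f (mk2 s' t)).
Proof.
move=> oU cf Us; apply: filterS (tube oU _ Us) => [s' Us'|t ht].
  exact: seg_cont_mk2 cf Us'.
exact: continuous_mk2.
Qed.

Lemma inner_continuous U (f : V -> R) s c d : c <= d -> open U -> Ck 0 U f ->
  (forall t, c <= t <= d -> U (mk2 s t)) ->
  {for s, continuous (fun s => itg c d (fun t => f (mk2 s t)))}.
Proof.
move=> cd oU cf Us; apply: itg_param_continuous => //.
  exact: near_seg_cont_mk2 cf Us.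
exact: cont_mk2_param cf Us.
Qed.

Lemma is_derive_mk2_0 (f : V -> R) s t : differentiable f (mk2 s t) ->
  is_derive s (1 : R) (fun s => f (mk2 s t)) (partial 0 f (mk2 s t)).
Proof.
move=> df; have -> : (fun s => f (mk2 s t)) = (fun s => f (mk2 0 t + s *: e_ 0)).
  by apply/funext => s'; rewrite -mk2_line0.
rewrite (mk2_line0 s t); apply: is_derive_line; apply: diff_derivable.
by rewrite -mk2_line0.
Qed.

Lemma is_derive_mk2_1 (f : V -> R) s t : differentiable f (mk2 s t) ->
  is_derive t (1 : R) (fun t => f (mk2 s t)) (partial 1 f (mk2 s t)).
Proof.
move=> df; have -> : (fun t => f (mk2 s t)) = (fun t => f (mk2 s 0 + t *: e_ 1)).
  by apply/funext => s'; rewrite -mk2_line1.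
rewrite (mk2_line1 s t); apply: is_derive_line; apply: diff_derivable.
by rewrite -mk2_line1.
Qed.

Definition itg2 a b c d (f : V -> R) : R :=
  itg a b (fun s => itg c d (fun t => f (mk2 s t))).

Section OnRect.
Variables (a b c d : R) (U : set V).
Hypotheses (ab : a <= b) (cd : c <= d) (oU : open U) (QU : rect a b c d `<=` U).

Let Us s : a <= s <= b -> forall t, c <= t <= d -> U (mk2 s t).
Proof. by move=> hs t ht; apply: QU; exact: rect_mk2. Qed.

Let inner_seg (f : V -> R) : Ck 0 U f -> seg_cont a b (fun s => itg c d (fun t => f (mk2 s t))).
Proof. by move=> cf s hs; apply: inner_continuous cf (Us hs). Qed.

Lemma itg2D (f h : V -> R) : Ck 0 U f -> Ck 0 U h ->
  itg2 a b c d (fun x => f x + h x) = itg2 a b c d f + itg2 a b c d h.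
Proof.
move=> cf ch; rewrite /itg2 -itgD; try exact: inner_seg.
apply: eq_itg => s hs; rewrite -itgD //; exact: seg_cont_mk2 (Us hs).
Qed.

Lemma itg2B (f h : V -> R) : Ck 0 U f -> Ck 0 U h ->
  itg2 a b c d (fun x => f x - h x) = itg2 a b c d f - itg2 a b c d h.
Proof.
move=> cf ch; rewrite /itg2 -itgB; try exact: inner_seg.
apply: eq_itg => s hs; rewrite -itgB //; exact: seg_cont_mk2 (Us hs).
Qed.

Lemma itg2Z (f : V -> R) (k : R) : Ck 0 U f ->
  itg2 a b c d (fun x => k * f x) = k * itg2 a b c d f.
Proof.
move=> cf; rewrite /itg2 -itgZ; last exact: inner_seg.
apply: eq_itg => s hs; rewrite -itgZ //; exact: seg_cont_mk2 (Us hs).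
Qed.

Lemma eq_itg2 (f h : V -> R) : (forall x, rect a b c d x -> f x = h x) ->
  itg2 a b c d f = itg2 a b c d h.
Proof.
by move=> E; apply: eq_itg => s hs; apply: eq_itg => t ht; apply: E; exact: rect_mk2.
Qed.

Lemma itg2_ge0 (f : V -> R) : (forall x, rect a b c d x -> 0 <= f x) -> 0 <= itg2 a b c d f.
Proof.
by move=> f0; apply: itg_ge0 => s hs; apply: itg_ge0 => t ht; apply: f0; exact: rect_mk2.
Qed.

Lemma itg2_eq0 (f : V -> R) x : Ck 0 U f -> (forall x, rect a b c d x -> 0 <= f x) ->
  itg2 a b c d f = 0 -> a < x 0 0 < b -> c < x 0 1 < d -> f x = 0.
Proof.
move=> cf f0 I0 h0 h1.
have hs : a <= x 0 0 <= b by case/andP: h0 => *; rewrite !ltW.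
rewrite -(mk2E x); apply: (itg_eq0 (f := fun t => f (mk2 (x 0 0) t))) h1.
- exact: seg_cont_mk2 (Us hs).
- by move=> t ht; apply: f0; exact: rect_mk2.
apply: (itg_eq0 (f := fun s => itg c d (fun t => f (mk2 s t)))) I0 h0.
- exact: inner_seg.
- by move=> s hs'; apply: itg_ge0 => t ht; apply: f0; exact: rect_mk2.
Qed.

(** The inner integration removes [partial 1 A] directly. For [partial 0 B], whose variable is the
    outer one, the inner integral of [B] is differentiated under the integral sign, which exhibits a
    primitive for the outer integration. *)
Lemma green_rect (A B : V -> R) : Ck 1 U A -> Ck 1 U B ->
  itg2 a b c d (fun x => partial 1 A x - partial 0 B x) =
  itg a b (fun s => A (mk2 s d) - A (mk2 s c))
  - itg c d (fun t => B (mk2 b t) - B (mk2 a t)).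
Proof.
move=> CA CB.
have cB : Ck 0 U B by exact: CkS.
rewrite itg2B; try exact: CkS_partial.
congr (_ - _).
  apply: eq_itg => s hs; apply: (@itg_FTC _ c d (fun t => A (mk2 s t))) => //.
    exact: seg_cont_mk2 (CkS_partial 1 CA) (Us hs).
  by move=> t ht; apply: is_derive_mk2_1; apply: CkS_diff CA _; exact: (Us hs).
have hb : a <= b <= b by rewrite ab lexx.
have ha : a <= a <= b by rewrite ab lexx.
rewrite itgB; [|exact: seg_cont_mk2 (Us hb)|exact: seg_cont_mk2 (Us ha)].
rewrite /itg2; apply: (@itg_FTC _ a b (fun s => itg c d (fun t => B (mk2 s t)))) => //.
  by apply: inner_seg; exact: CkS_partial.
move=> s hs; apply: (@itg_Leibniz _ _ c d (fun s t => B (mk2 s t)) (fun s t => partial 0 B (mk2 s t)) s 1) => //.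
- exact: near_seg_cont_mk2 cB (Us hs).
- apply: filterS (tube oU _ (Us hs)) => [s' Us' t ht|t ht].
    by apply: is_derive_mk2_0; apply: CkS_diff CB _; exact: Us'.
  exact: continuous_mk2.
- exact: cont_mk2_param (CkS_partial 0 CB) (Us hs).
Qed.

End OnRect.

(** A primitive of [f] in direction [e_ j] over a window of fixed length [L] behind [z]. The domain
    of integration does not move with [z], so all partial derivatives are taken under the integral
    sign; where the far end of the window has left the support of [f], this is a true
    antiderivative. *)
Definition prim j (L : R) (f : V -> R) z : R := itg 0 L (fun s => f (z - s *: e_ j)).

Lemma continuous_shift j : continuous (fun p : V * R => p.1 - p.2 *: e_ j).
Proof.
move=> [z s]; apply: (@continuousB _ _ _ fst (fun p : V * R => p.2 *: e_ j)).
  exact: cvg_fst.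
have -> : (fun p : V * R => p.2 *: e_ j) = (fun s => s *: e_ j) \o snd by [].
by apply: continuous_comp; [exact: cvg_snd|exact: scalel_continuous].
Qed.

Section Primitive.
Variables (j : 'I_2) (L : R) (L0 : 0 <= L).

Lemma param_cont_shift (f : V -> R) z : Ck 0 setT f ->
  jointly_cont 0 L (fun z s => f (z - s *: e_ j)) z.
Proof.
move=> cf t ht; apply: (@continuous_comp _ _ _ (fun p : V * R => p.1 - p.2 *: e_ j) f).
  exact: continuous_shift.
exact: cf.
Qed.

Lemma seg_cont_shift (f : V -> R) z : Ck 0 setT f -> seg_cont 0 L (fun s => f (z - s *: e_ j)).
Proof. by move=> cf; exact: (param_cont_seg (@param_cont_shift f z cf)). Qed.

Lemma prim_continuous (f : V -> R) : Ck 0 setT f -> Ck 0 setT (prim j L f).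
Proof.
move=> cf z _; apply: (@itg_param_continuous _ _ 0 L (fun z s => f (z - s *: e_ j))) => //.
  by near=> q; exact: seg_cont_shift.
exact: param_cont_shift.
Unshelve. all: by end_near. Qed.

Lemma is_derive_prim (f : V -> R) i z : Ck 1 setT f ->
  is_derive z (e_ i) (prim j L f) (prim j L (partial i f) z).
Proof.
move=> Cf; have cf := CkS Cf.
apply: (@itg_Leibniz _ _ 0 L (fun z s => f (z - s *: e_ j)) (fun z s => partial i f (z - s *: e_ j)) z (e_ i)) => //.
- by near=> q; exact: seg_cont_shift.
- near=> q; move=> t ht.
  have df : derivable f (q - t *: e_ j) (e_ i).
    by apply: diff_derivable; exact: CkS_diff Cf _.
  have := derivableP df.
  have -> : 'D_(e_ i) f (q - t *: e_ j) = partial i f (q - t *: e_ j) by [].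
  move=> D.
  apply: DeriveDef.
    have [d _] := D; move: d; rewrite /derivable /=.
    by under eq_fun do rewrite addrA.
  have [_ <-] := D; rewrite /derive /=.
  by under [X in _ = lim (X @ _)]eq_fun do rewrite addrA.
- by apply: param_cont_shift; exact: CkS_partial.
Unshelve. all: by end_near. Qed.

Lemma partial_prim (f : V -> R) i : Ck 1 setT f ->
  partial i (prim j L f) = prim j L (partial i f).
Proof. by move=> Cf; apply/funext => z; have [_ E] := is_derive_prim i z Cf; exact: E. Qed.

Lemma prim_C1 (f : V -> R) : Ck 1 setT f -> Ck 1 setT (prim j L f).
Proof.
move=> Cf; split=> [z _|i].
  apply: C1_differentiable => i.
    by near=> q; have [] := is_derive_prim i q Cf.
  rewrite partial_prim //.
  by apply: (prim_continuous (CkS_partial i Cf)).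
by rewrite partial_prim //; exact: prim_continuous (CkS_partial i Cf).
Unshelve. all: by end_near. Qed.

Lemma partial_prim_same (f : V -> R) z : Ck 1 setT f ->
  partial j (prim j L f) z = f z - f (z - L *: e_ j).
Proof.
move=> Cf; rewrite partial_prim // /prim.
pose F s := - f (z - s *: e_ j).
have -> : f z - f (z - L *: e_ j) = F L - F 0 by rewrite /F scale0r subr0; ring.
apply: itg_FTC => //.
  by apply: seg_cont_shift; exact: CkS_partial.
move=> s _; rewrite /F.
have df : differentiable f (z + s *: - e_ j) by exact: CkS_diff Cf _.
have E : (fun s => - f (z - s *: e_ j)) = - (fun s => f (z + s *: - e_ j)).
  by apply/funext => t; rewrite -[RHS]/(- f (z + t *: - e_ j)) scalerN.
have D := is_derive_line (diff_derivable (v := - e_ j) df).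
rewrite E.
have -> : partial j f (z - s *: e_ j) = - 'D_(- e_ j) f (z + s *: - e_ j).
  by rewrite deriveE // linearN opprK scalerN partialE // -scalerN.
exact: is_deriveN D.
Qed.

End Primitive.

End PlaneIntegral.

(** * Change of variables in the plane *)

Lemma deriveEpartial (R : realType) (f : 'rV[R]_2 -> R) x i :
  'D_(delta_mx 0 i : 'rV[R]_2) f x = partial i f x.
Proof. by []. Qed.

#[local] Opaque partial itg mk2.

Section ChangeOfVariables.
Context {R : realType}.
Local Notation V := 'rV[R]_2.
Implicit Types (x y z v : V) (U : set V) (i j : 'I_2) (a b c d s t : R).
Local Notation e_ i := (delta_mx 0 i : V).

Definition jdet (tau : V -> V) x : R :=
  partial 0 (fun y => tau y 0 0) x * partial 1 (fun y => tau y 0 1) x -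
  partial 1 (fun y => tau y 0 0) x * partial 0 (fun y => tau y 0 1) x.

(** The left-hand side is the divergence of the field multiplied by the cofactor matrix of the
    Jacobian. The columns of cofactors are divergence-free by the symmetry of second derivatives, so
    only first derivatives of [A] and [B] survive. *)
Lemma piola U (tau : V -> V) (A B : V -> R) x : open U -> U x ->
  (forall i, Ck 2 U (fun y => tau y 0 i)) ->
  differentiable A (tau x) -> differentiable B (tau x) ->
  partial 0 (fun y => A (tau y) * partial 1 (fun y => tau y 0 1) y
                      - B (tau y) * partial 1 (fun y => tau y 0 0) y) x +
  partial 1 (fun y => - (A (tau y) * partial 0 (fun y => tau y 0 1) y)
                      + B (tau y) * partial 0 (fun y => tau y 0 0) y) x =
  jdet tau x * (partial 0 A (tau x) + partial 1 B (tau x)).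
Proof.
move=> oU Ux Ct dA dB.
have dt i : differentiable (fun y => tau y 0 i) x by exact: CkS_diff (Ct i) Ux.
have dpt j i : differentiable (partial j (fun y => tau y 0 i)) x.
  by apply: (CkS_diff _ Ux); exact: CkS_partial (Ct i).
have dAt : differentiable (fun y => A (tau y)) x by exact: (@differentiable_comp_plane _ A tau).
have dBt : differentiable (fun y => B (tau y)) x by exact: (@differentiable_comp_plane _ B tau).
have pA i : partial i (fun y => A (tau y)) x = partial 0 A (tau x) * partial i (fun y => tau y 0 0) x + partial 1 A (tau x) * partial i (fun y => tau y 0 1) x
  by exact: (@partial_comp _ A tau x i dt dA).
have pB i : partial i (fun y => B (tau y)) x = partial 0 B (tau x) * partial i (fun y => tau y 0 0) x + partial 1 B (tau x) * partial i (fun y => tau y 0 1) x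
  by exact: (@partial_comp _ B tau x i dt dB).
have S0 := schwarz01 oU (Ct 0) Ux.
have S1 := schwarz01 oU (Ct 1) Ux.
rewrite partialB; [|exact: differentiable_mul..].
rewrite partialD; [|exact: differentiable_opp (differentiable_mul dAt (dpt 0 1))|exact: differentiable_mul].
rewrite partialN; last exact: differentiable_mul.
rewrite (partialM 0 dAt (dpt 1 1)) (partialM 0 dBt (dpt 1 0)).
rewrite (partialM 1 dAt (dpt 0 1)) (partialM 1 dBt (dpt 0 0)).
rewrite !pA !pB S0 S1 /jdet.
(* All derivatives become variables, which leaves a polynomial identity to [ring]. *)
move: (partial 0 A (tau x)) (partial 1 A (tau x)) (partial 0 B (tau x)) (partial 1 B (tau x)) => A0 A1 B0 B1.
move: (partial 0 (fun y => tau y 0 0) x) (partial 1 (fun y => tau y 0 0) x) => t00 t01.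
move: (partial 0 (fun y => tau y 0 1) x) (partial 1 (fun y => tau y 0 1) x) => t10 t11.
move: (partial 1 (partial 0 (fun y => tau y 0 0)) x) (partial 1 (partial 0 (fun y => tau y 0 1)) x) => q0 q1.
by move: (A (tau x)) (B (tau x)) => u v; ring.
Qed.

Lemma antiderivative j (f : V -> R) (de T : R) : Ck 1 setT f -> 0 < de < T ->
  (forall z, f z != 0 -> - de <= z 0 j <= de) ->
  exists P : V -> R, [/\ Ck 1 setT P,
    forall z, z 0 j <= T -> partial j P z = f z,
    forall z, z 0 j < - de -> P z = 0,
    forall z, (forall s, f (z - s *: e_ j) = 0) -> P z = 0 &
    forall i, (forall z, partial i f z = 0) -> forall z, partial i P z = 0].
Proof.
(* For [z 0 j <= T] the window of this length ends at a coordinate below [- T], hence behind the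
   support of [f]. *)
move=> Cf /andP[d0 dT] sf; pose L := 2 * T + 1.
have L0 : 0 <= L by rewrite /L; lra.
have f0 z : z 0 j < - de -> f z = 0.
  by move=> h; apply/eqP; apply/negPn/negP => /sf /andP[h1 h2]; lra.
have zero g z : (forall s, 0 <= s -> g (z - s *: e_ j) = 0) -> prim j L g z = 0.
  by move=> g0; rewrite /prim -[RHS](itg0 0 L); apply: eq_itg => s /andP[hs _]; exact: g0.
have sj z s : (z - s *: e_ j) 0 j = z 0 j - s by rewrite !mxE !eqxx /= mulr1.
exists (prim j L f); split.
- exact: prim_C1.
- move=> z zT; rewrite (partial_prim_same j L0 z Cf) (f0 (z - _)) ?subr0 // sj /L; lra.
- move=> z hz; apply: zero => s hs; apply: f0; rewrite sj; lra.
- by move=> z hz; apply: zero => s _; exact: hz.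
- move=> i hi z; rewrite (partial_prim j L0 i Cf); apply: zero => s _; exact: hi.
Qed.

Lemma antiderivative_const j (P : V -> R) z (de T : R) : Ck 1 setT P ->
  (forall z, de < z 0 j <= T -> partial j P z = 0) -> de < z 0 j <= T ->
  P z = P (z + (T - z 0 j) *: e_ j).
Proof.
move=> CP dP /andP[h1 h2].
have D s : is_derive s (1 : R) (fun s => P (z + s *: e_ j)) (partial j P (z + s *: e_ j)).
  by apply: is_derive_line; apply: diff_derivable; exact: (CkS_diff CP I).
have h3 : 0 <= T - z 0 j by lra.
have : itg 0 (T - z 0 j) (fun=> 0) = P (z + (T - z 0 j) *: e_ j) - P (z + 0 *: e_ j).
  apply: (@itg_FTC _ _ _ (fun s => P (z + s *: e_ j))) => // [|s /andP[s0 sT]]; first exact: seg_cst.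
  have := D s; rewrite dP // !mxE !eqxx /= mulr1; apply/andP; split; lra.
by rewrite itg0 scale0r addr0 => /eqP; rewrite eq_sym subr_eq0 => /eqP.
Qed.

(** [P] integrates [F] upwards, so above the support it depends on the first coordinate alone; [M]
    integrates that function of one variable from left to right and ends at the total integral [K].
    Above the support the form [P dx_0] is therefore the differential of [M]. *)
Lemma two_antiderivatives (F : V -> R) (de T : R) : Ck 1 setT F -> 0 < de < T ->
  (forall z, F z != 0 -> - de <= z 0 0 <= de /\ - de <= z 0 1 <= de) ->
  exists P M : V -> R, let K := itg2 (- T) T (- T) T F in
  [/\ Ck 1 setT P /\ Ck 1 setT M,
    forall z, z 0 1 <= T -> partial 1 P z = F z,
    forall z, z 0 0 < - de \/ de < z 0 0 \/ z 0 1 < - de -> P z = 0,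
    (forall z, z 0 0 <= T -> de < z 0 1 <= T -> partial 0 M z = P z) /\
    (forall z, partial 1 M z = 0) &
    (forall z, z 0 0 < - de -> M z = 0) /\
    forall z, de < z 0 0 <= T -> M z = K].
Proof.
move=> CF deT sF; have [d0 dT] := andP deT.
have [P [CP dP P1 P0 _]] := @antiderivative 1 F de T CF deT (fun z h => proj2 (sF z h)).
have TT : T <= T by [].
have F0 z : z 0 0 < - de \/ de < z 0 0 -> F z = 0.
  by move=> h; apply/eqP; apply/negPn/negP => /sF[/andP[h1 h2] _]; case: h; lra.
have F1 z : de < z 0 1 -> F z = 0.
  by move=> h; apply/eqP; apply/negPn/negP => /sF[_ /andP[h1 h2]]; lra.
have P0' z : z 0 0 < - de \/ de < z 0 0 -> P z = 0.
  by move=> h; apply: P0 => s; apply: F0; rewrite !mxE /= mulr0 subr0.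
have [N [CN N1 PN N0]] : exists N : V -> R, [/\ Ck 1 setT N, forall z, partial 1 N z = 0,
    forall z, de < z 0 1 <= T -> P z = N z & forall z, N z != 0 -> - de <= z 0 0 <= de].
  (* [N] is the value of [P] on the line at height [T], above the support, continued constantly in
     the vertical direction. *)
  exists (P \o (fun z => mk2 (z 0 0) T)).
  have c0 : (fun z => mk2 (z 0 0) T 0 0) = (fun z => z 0 0) by apply/funext => z; rewrite mk20.
  have c1 : (fun z => mk2 (z 0 0) T 0 1) = cst T by apply/funext => z; rewrite mk21.
  split.
  - apply: (@Ck_comp _ 1 setT setT P) => [|i|x _|]; [exact: openT| |by []|exact: CP].
    by have [->|->] := ord2P i; [rewrite c0; exact: Ck_coord|rewrite c1; exact: Ck_cst].
  - move=> z; rewrite partial_comp; last exact: (CkS_diff CP I).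
      by rewrite c0 c1 partial_cst partial_coord /= !mulr0 addr0.
    move=> i; have [->|->] := ord2P i; [rewrite c0; exact: differentiable_coord|rewrite c1; exact: differentiable_cst].
  - move=> z hz; rewrite (@antiderivative_const 1 P z de T CP _ hz) /=; last first.
      by move=> w /andP[w1 w2]; rewrite dP // F1.
    by congr P; apply: row2_eq; rewrite !mxE /= ?mulr0 ?addr0 ?mulr1 ?mk20 ?mk21 // addrC subrK.
  - move=> z /=; apply: contraNT => hz; apply/eqP; apply: P0'; rewrite mk20.
    by move: hz; rewrite negb_and -!ltNge => /orP.
have [M [CM dM M0 _ dM1]] := @antiderivative 0 N de T CN deT N0.
have N0' z : de < z 0 0 -> N z = 0.
  by move=> h; apply/eqP; apply/negPn/negP => /N0 /andP[h1 h2]; lra.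
have MK z : de < z 0 0 <= T -> M z = M (mk2 T 0).
  move=> hz; rewrite (@antiderivative_const 0 M z de T CM _ hz); last first.
    by move=> w /andP[w1 w2]; rewrite dM // N0'.
  have E0 : (z + (T - z 0 0) *: e_ 0) 0 0 = T by rewrite !mxE /= mulr1 addrC subrK.
  move: (z + _) E0 => w E0.
  (* Since [partial 1 M] is 0, moving along the vertical line through [mk2 T 0] does not change
     [M]. *)
  have [|s _] := @line_MVT _ _ M (mk2 T 0) (e_ 1) (w 0 1).
    by move=> s _; apply: diff_derivable; exact: (CkS_diff CM I).
  rewrite deriveEpartial (dM1 1 N1) mulr0 -mk2_line1 -E0 mk2E => /eqP.
  by rewrite subr_eq0 => /eqP.
exists P, M => K.
have NT : - T <= T by lra.
have inner s : itg (- T) T (fun t => F (mk2 s t)) = N (mk2 s T).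
  have -> : N (mk2 s T) = P (mk2 s T) - P (mk2 s (- T)).
    by rewrite (P1 (mk2 s (- T))) ?subr0 ?mk21 ?PN ?mk21 ?dT ?TT //; lra.
  apply: (@itg_FTC _ _ _ (fun t => P (mk2 s t))) => //.
  - by apply: (@seg_cont_mk2 _ setT) => //; exact: CkS.
  - move=> t /andP[_ ht]; have := is_derive_mk2_1 (CkS_diff CP (I : setT (mk2 s t))).
    by rewrite dP // mk21.
have KE : K = M (mk2 T 0).
  have -> : K = itg (- T) T (fun s => N (mk2 s T)) by apply: eq_itg => s _; exact: inner.
  have -> : M (mk2 T 0) = M (mk2 T T) - M (mk2 (- T) T).
    by rewrite (M0 (mk2 (- T) T)) ?subr0 ?mk20 ?(MK (mk2 T T)) ?mk20 ?dT ?TT //; lra.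
  apply: (@itg_FTC _ _ _ (fun s => M (mk2 s T))) => //.
  - by apply: (@seg_cont_mk2' _ setT) => //; exact: CkS.
  - move=> s /andP[_ hs]; have := is_derive_mk2_0 (CkS_diff CM (I : setT (mk2 s T))).
    by rewrite dM // mk20.
split=> //.
- by move=> z [h|[h|h]]; [apply: P0'; left|apply: P0'; right|exact: P1].
- split; last exact: (dM1 1 N1).
  by move=> z z0 z1; rewrite dM // PN.
- by split=> // z hz; rewrite KE; exact: MK.
Qed.

(* All four sides of the rectangle are mapped away from the support of F, so in
   Green's theorem only the horizontal side mapped above it contributes; along
   that side [M] of [two_antiderivatives] is a primitive. *)
Section Pullback.
Variables (F : V -> R) (de T : R).
Hypotheses (CF : Ck 1 setT F) (deT : 0 < de < T).
Hypothesis suppF : forall z, F z != 0 -> - de <= z 0 0 <= de /\ - de <= z 0 1 <= de.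

Variables (sigma : V -> V) (U : set V) (a b c d s1 s2 : R).
Hypotheses (oU : open U) (ab : a <= b) (cd : c <= d) (QU : rect a b c d `<=` U).
Hypothesis Cs : forall i, Ck 2 U (fun x => sigma x 0 i).
Hypothesis sT : forall x i, rect a b c d x -> sigma x 0 i <= T.
Hypotheses (s1E : s1 = 1 \/ s1 = - 1) (s2E : s2 = 1 \/ s2 = - 1).
Hypothesis left_side : forall t, c <= t <= d -> s1 * sigma (mk2 a t) 0 0 < - de.
Hypothesis right_side : forall t, c <= t <= d -> de < s1 * sigma (mk2 b t) 0 0.
Hypothesis bottom_side : forall s, a <= s <= b -> s2 * sigma (mk2 s c) 0 1 < - de.
Hypothesis top_side : forall s, a <= s <= b -> de < s2 * sigma (mk2 s d) 0 1.

Lemma itg2_pullback :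
  itg2 a b c d (fun x => F (sigma x) * jdet sigma x) = s1 * s2 * itg2 (- T) T (- T) T F.
Proof.
have [P [M [[CP CM] dP P0 [dM0 dM1] [M0 MK]]]] := two_antiderivatives CF deT suppF.
move: (itg2 (- T) T (- T) T F) MK => K MK.
(* [A] and [B] are the coefficients of the pullback of the form [P dx_0] by [sigma]. *)
pose A x := P (sigma x) * partial 0 (fun y => sigma y 0 0) x.
pose B x := P (sigma x) * partial 1 (fun y => sigma y 0 0) x.
have ds x i : U x -> differentiable (fun y => sigma y 0 i) x.
  by move=> Ux; exact: CkS_diff (Cs i) Ux.
have CPs : Ck 1 U (fun x => P (sigma x)).
  apply: (@Ck_comp _ 1 U setT P sigma) => [//|i|//|//]; exact: CkS (Cs i).
have CA : Ck 1 U A by apply: CkM => //; exact: CkS_partial (Cs 0).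
have CB : Ck 1 U B by apply: CkM => //; exact: CkS_partial (Cs 0).
(* Along a side mapped above the support, [A] is the derivative of [M \o sigma]. The end points are
   mapped to the two sides of the support, in the order given by [s1]. *)
have edge t : c <= t <= d -> (forall s, a <= s <= b -> de < sigma (mk2 s t) 0 1) ->
    itg a b (fun s => A (mk2 s t)) = s1 * K.
  move=> ht ds1.
  have Q s : a <= s <= b -> rect a b c d (mk2 s t) by move=> hs; exact: rect_mk2.
  have -> : s1 * K = M (sigma (mk2 b t)) - M (sigma (mk2 a t)).
    have ha : a <= a <= b by rewrite ab lexx.
    have hb : a <= b <= b by rewrite ab lexx.
    have := left_side ht; have := right_side ht.
    have := sT 0 (Q _ ha); have := sT 0 (Q _ hb).
    case: s1E => ->; rewrite ?mul1r ?mulN1r => h1 h2 h3 h4.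
      by rewrite MK ?h3 // M0 // subr0.
    by rewrite M0 ?MK; lra.
  apply: (@itg_FTC _ _ _ (fun s => M (sigma (mk2 s t)))) => //.
    apply: (@seg_cont_mk2' _ U) => [|s hs]; first exact: CkS.
    by apply: QU; exact: Q.
  move=> s hs; have Us := QU (Q s hs).
  have E : A (mk2 s t) = partial 0 (M \o sigma) (mk2 s t).
    rewrite partial_comp; [|by move=> i; exact: ds|exact: (CkS_diff CM I)].
    rewrite dM1 mul0r addr0 dM0 //; first by apply: sT; exact: Q.
    by rewrite ds1 //=; apply: sT; exact: Q.
  rewrite E; apply: (@is_derive_mk2_0 _ (M \o sigma)).
  apply: differentiable_comp_plane; first by move=> i; exact: ds.
  exact: (CkS_diff CM I).
(* The exterior derivative commutes with the pullback: second derivatives of [sigma] cancel by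
   symmetry, and [partial 1 P = F] leaves [F] times the Jacobian determinant. *)
rewrite (@eq_itg2 _ _ _ _ _ _ (fun x => partial 1 A x - partial 0 B x)); last first.
  move=> x Qx; have Ux := QU Qx.
  have dPs : differentiable (fun x => P (sigma x)) x by exact: CkS_diff CPs Ux.
  have dps i : differentiable (partial i (fun y => sigma y 0 0)) x.
    by apply: (CkS_diff _ Ux); exact: CkS_partial (Cs 0).
  have pP i : partial i (fun x => P (sigma x)) x = partial 0 P (sigma x) * partial i (fun y => sigma y 0 0) x + partial 1 P (sigma x) * partial i (fun y => sigma y 0 1) x.
    exact: (@partial_comp _ P sigma x i (fun k => ds x k Ux) (CkS_diff CP I)).
  have S0 := schwarz01 oU (Cs 0) Ux.
  rewrite /A /B (partialM 1 dPs (dps 0)) (partialM 0 dPs (dps 1)).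
  rewrite !pP S0 dP; last exact: sT.
  rewrite /jdet.
  move: (partial 0 P (sigma x)) (partial 1 P (sigma x)) (P (sigma x)) => A0 A1 p.
  move: (partial 0 (fun y => sigma y 0 0) x) (partial 1 (fun y => sigma y 0 0) x) => t00 t01.
  move: (partial 0 (fun y => sigma y 0 1) x) (partial 1 (fun y => sigma y 0 1) x) => t10 t11.
  by move: (partial 1 (partial 0 (fun y => sigma y 0 0)) x) => q; ring.
rewrite (green_rect ab cd oU QU CA CB).
have B0 t : c <= t <= d -> B (mk2 b t) - B (mk2 a t) = 0.
  move=> ht; rewrite /B !P0 ?mul0r ?subrr //.
    by have := left_side ht; case: s1E => ->; rewrite ?mul1r ?mulN1r => h; [left|right; left]; lra.
  by have := right_side ht; case: s1E => ->; rewrite ?mul1r ?mulN1r => h; [right; left|left]; lra.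
rewrite (eq_itg B0) itg0 subr0.
have hc : c <= c <= d by rewrite cd lexx.
have hd : c <= d <= d by rewrite cd lexx.
(* The sign [s2] tells which horizontal side is mapped above the support; the other one is mapped
   below it, where [P] vanishes. *)
case: s2E bottom_side top_side => -> bs ts.
  rewrite mulr1 -(edge _ hd); last by move=> s /ts; rewrite mul1r.
  apply: eq_itg => s /bs; rewrite mul1r => h.
  have hz : P (sigma (mk2 s c)) = 0 by apply: P0; right; right.
  by rewrite /A hz mul0r subr0.
have E : forall s, a <= s <= b -> A (mk2 s d) - A (mk2 s c) = -1 * A (mk2 s c).
  move=> s /ts h.
  have hz : P (sigma (mk2 s d)) = 0 by apply: P0; right; right; lra.
  by rewrite /A hz mul0r sub0r mulN1r.
rewrite (eq_itg E) itgZ; last first.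
  apply: (@seg_cont_mk2' _ U) => [|s hs]; first exact: CkS.
  by apply: QU; exact: rect_mk2.
rewrite (edge _ hc); first by rewrite mulrN1 mulN1r mulNr.
by move=> s /bs; rewrite mulN1r => h; lra.
Qed.

End Pullback.

End ChangeOfVariables.

(** * The integral over the plane and its invariance under shears *)

Section PlaneInt.
Context {R : realType}.
Local Notation V := 'rV[R]_2.
Local Notation mu := (@lebesgue_measure R).
Implicit Types (x y z v w : V) (U : set V) (i j : 'I_2) (a b c d s t : R).

(** Integrating over whole lines makes the value independent of the rectangle chosen around the
    support; [plane_int_rect] returns to any such rectangle. *)
Definition plane_int (F : V -> R) : R :=
  (\int[mu]_s (\int[mu]_t F (mk2 s t)))%R.

Lemma line_int_itg a b (f : R -> R) : (forall t, f t != 0 -> a <= t <= b) ->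
  (\int[mu]_t f t)%R = itg a b f.
Proof.
move=> sf; transitivity ((\int[mu]_(t in `[a, b]) f t)%R); last by [].
rewrite [RHS]Rintegral_mkcond; congr (Rintegral _ _ _).
apply/funext => t; rewrite /patch /= !mem_setE /= !in_itv /=.
have [->|f0] := eqVneq (f t) 0; first by rewrite !if_same.
by rewrite (sf _ f0).
Qed.

Lemma plane_int_rect a b c d (F : V -> R) :
  (forall z, F z != 0 -> rect a b c d z) -> plane_int F = itg2 a b c d F.
Proof.
move=> sF; have I s : (\int[mu]_t F (mk2 s t))%R = itg c d (fun t => F (mk2 s t)).
  by apply: line_int_itg => t /sF[_]; rewrite mk21.
rewrite /plane_int; under eq_Rintegral do rewrite I.
apply: line_int_itg => s; apply: contraNT => hs; apply/eqP.
rewrite -[RHS](itg0 c d); apply: eq_itg => t _; apply/eqP.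
by apply: contraNT hs => /sF[]; rewrite mk20.
Qed.

Lemma plane_int0 : plane_int (fun=> 0) = 0.
Proof.
rewrite (@plane_int_rect 0 0 0 0) => [|z]; last by rewrite eqxx.
by rewrite /itg2; under eq_itg do rewrite itg0; rewrite itg0.
Qed.

(** The case of [itg2_pullback] in which both signs and the Jacobian determinant are 1, with a
    rectangle that contains the support of the pullback. *)
Lemma plane_int_comp (F : V -> R) (E : V -> V) a b c d (de T : R) :
  Ck 1 setT F -> 0 < de < T ->
  (forall z, F z != 0 -> - de <= z 0 0 <= de /\ - de <= z 0 1 <= de) ->
  (forall i, Ck 2 setT (fun x => E x 0 i)) -> (forall x, jdet E x = 1) ->
  a <= b -> c <= d ->
  (forall x i, rect a b c d x -> E x 0 i <= T) ->
  (forall z, F (E z) != 0 -> rect a b c d z) ->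
  (forall t, c <= t <= d -> E (mk2 a t) 0 0 < - de /\ de < E (mk2 b t) 0 0) ->
  (forall s, a <= s <= b -> E (mk2 s c) 0 1 < - de /\ de < E (mk2 s d) 0 1) ->
  plane_int (F \o E) = plane_int F.
Proof.
move=> CF deT sF CE jE ab cd ET sE lr bt.
have [d0 dT] := andP deT.
rewrite (plane_int_rect sE) (@plane_int_rect (- T) T (- T) T F); last first.
  by move=> z /sF[/andP[h1 h2] /andP[h3 h4]]; split; apply/andP; split; lra.
have := @itg2_pullback _ F de T CF deT sF E setT a b c d 1 1 openT ab cd (fun _ _ => I) CE ET (or_introl erefl) (or_introl erefl).
rewrite !mul1r => <-.
- by apply: eq_itg2 => x _; rewrite jE mulr1.
- by move=> t /lr[]; rewrite mul1r.
- by move=> t /lr[_]; rewrite mul1r.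
- by move=> t /bt[]; rewrite mul1r.
- by move=> t /bt[_]; rewrite mul1r.
Qed.

Lemma jdet_affine (E : V -> V) (k0 k1 l0 l1 p q : R) x :
  (forall y, E y 0 0 = k0 * y 0 0 + k1 * y 0 1 + p) ->
  (forall y, E y 0 1 = l0 * y 0 0 + l1 * y 0 1 + q) ->
  jdet E x = k0 * l1 - k1 * l0 /\ forall i, Ck 2 setT (fun x => E x 0 i).
Proof.
move=> E0 E1.
have C (k l m : R) n : Ck n setT (fun y : V => k * y 0 0 + l * y 0 1 + m).
  by apply: CkD openT _ (Ck_cst _ _ m); apply: CkD openT _ _; apply: CkM openT _ _;
    try exact: (Ck_cst n setT); exact: Ck_coord.
have D (k l m : R) i : partial i (fun y : V => k * y 0 0 + l * y 0 1 + m) x = if i == 0 then k else l.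
  have dc j : differentiable (fun y : V => y 0 j) x by exact: differentiable_coord.
  have dk (r : R) : differentiable (fun y : V => r) x by exact: differentiable_cst.
  rewrite (partialD _ (differentiable_add (differentiable_mul (dk k) (dc 0)) (differentiable_mul (dk l) (dc 1))) (dk m)).
  rewrite (partialD _ (differentiable_mul (dk k) (dc 0)) (differentiable_mul (dk l) (dc 1))).
  rewrite (partialM _ (dk k) (dc 0)) (partialM _ (dk l) (dc 1)) !partial_coord !partial_cst.
  by have [->|->] := ord2P i; rewrite /= ?mulr1 ?mulr0 ?addr0 ?add0r.
have F0 : (fun y => E y 0 0) = _ := funext E0.
have F1 : (fun y => E y 0 1) = _ := funext E1.
split; first by rewrite /jdet F0 F1 !D.
by move=> i; have [->|->] := ord2P i; rewrite ?F0 ?F1; exact: C.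
Qed.

Definition bsupp (F : V -> R) x (r : R) :=
  forall z, F z != 0 -> x 0 0 - r <= z 0 0 <= x 0 0 + r /\ x 0 1 - r <= z 0 1 <= x 0 1 + r.

Lemma bsupp_centered (F : V -> R) x (r : R) : 0 <= r -> bsupp F x r ->
  exists2 de : R, 0 < de &
    forall z, F z != 0 -> - de <= z 0 0 <= de /\ - de <= z 0 1 <= de.
Proof.
move=> r0 sF; exists (`|x 0 0| + `|x 0 1| + r + 1).
  by have := normr_ge0 (x 0 0); have := normr_ge0 (x 0 1); lra.
move=> z /sF[/andP[h1 h2] /andP[h3 h4]].
have := lerNnormlW (lexx `|x 0 0|); have := ler_normlW (lexx `|x 0 0|).
have := lerNnormlW (lexx `|x 0 1|); have := ler_normlW (lexx `|x 0 1|).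
have := normr_ge0 (x 0 0); have := normr_ge0 (x 0 1).
by move=> *; split; apply/andP; split; lra.
Qed.

Lemma ler_norm_mul (k t r : R) : `|t| <= r -> - (`|k| * r) <= k * t <= `|k| * r.
Proof. by move=> tr; rewrite -ler_norml normrM ler_wpM2l. Qed.

Lemma plane_int_shear0 (F : V -> R) x (r k p q : R) : 0 <= r -> Ck 1 setT F -> bsupp F x r ->
  plane_int (F \o (fun z => mk2 (z 0 0 + k * z 0 1 + p) (z 0 1 + q))) = plane_int F.
Proof.
move=> r0 CF /(bsupp_centered r0)[de d0 sF].
set E := fun z => _.
have E0 z : E z 0 0 = 1 * z 0 0 + k * z 0 1 + p by rewrite mk20 mul1r.
have E1 z : E z 0 1 = 0 * z 0 0 + 1 * z 0 1 + q by rewrite mk21 mul1r mul0r add0r.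
(* [Y] pushes the horizontal sides past the support despite the translation by [q]; [X] does so for
   the vertical sides, where the shear moves points by up to [|k| Y]. *)
pose Y := `|q| + de + 1; pose X := `|k| * Y + `|p| + de + 1.
pose T := X + `|k| * Y + Y + `|p| + `|q| + de + 1.
have nk := normr_ge0 k; have np := normr_ge0 p; have nq := normr_ge0 q.
have p1 := lerNnormlW (lexx `|p|); have p2 := ler_normlW (lexx `|p|).
have q1 := lerNnormlW (lexx `|q|); have q2 := ler_normlW (lexx `|q|).
have Y0 : 0 < Y by rewrite /Y; lra.
have kY0 : 0 <= `|k| * Y by rewrite mulr_ge0 // ltW.
have X0 : 0 < X by rewrite /X; lra.
have kz t : - Y <= t <= Y -> - (`|k| * Y) <= k * t <= `|k| * Y.
  by move=> h; apply: ler_norm_mul; rewrite ler_norml.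
have J z := jdet_affine z E0 E1.
have deT : 0 < de < T by rewrite d0 /T; lra.
have XX : - X <= X by lra.
have YY : - Y <= Y by lra.
apply: (@plane_int_comp F E (- X) X (- Y) Y de T) => //.
- by move=> i; exact: (proj2 (J 0)).
- by move=> z; rewrite (proj1 (J z)); ring.
- move=> z i [/andP[h1 h2] hz]; have /andP[h5 h6] := kz _ hz; have /andP[h3 h4] := hz.
  by have [->|->] := ord2P i; rewrite ?E0 ?E1 ?mul1r ?mul0r /T; lra.
- move=> z /sF[]; rewrite E0 E1 ?mul1r ?mul0r => /andP[h1 h2] /andP[h3 h4].
  have hz : - Y <= z 0 1 <= Y by rewrite /Y; apply/andP; split; lra.
  have /andP[h5 h6] := kz _ hz.
  by split=> //; rewrite /X; apply/andP; split; lra.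
- move=> t ht; rewrite !E0 !mk20 !mk21; have /andP[h5 h6] := kz _ ht.
  by rewrite /X; split; lra.
- by move=> s hs; rewrite !E1 !mk20 !mk21 /Y; split; lra.
Qed.

Lemma plane_int_shear1 (F : V -> R) x (r k : R) : 0 <= r -> Ck 1 setT F -> bsupp F x r ->
  plane_int (F \o (fun z => mk2 (z 0 0) (k * z 0 0 + z 0 1))) = plane_int F.
Proof.
move=> r0 CF /(bsupp_centered r0)[de d0 sF].
set E := fun z => _.
have E0 z : E z 0 0 = 1 * z 0 0 + 0 * z 0 1 + 0 by rewrite mk20 mul1r mul0r !addr0.
have E1 z : E z 0 1 = k * z 0 0 + 1 * z 0 1 + 0 by rewrite mk21 mul1r addr0.
pose X := de + 1; pose Y := `|k| * X + de + 1.
pose T := X + `|k| * X + Y + de + 1.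
have nk := normr_ge0 k.
have X0 : 0 < X by rewrite /X; lra.
have kX0 : 0 <= `|k| * X by rewrite mulr_ge0 // ltW.
have Y0 : 0 < Y by rewrite /Y; lra.
have kz t : - X <= t <= X -> - (`|k| * X) <= k * t <= `|k| * X.
  by move=> h; apply: ler_norm_mul; rewrite ler_norml.
have J z := jdet_affine z E0 E1.
have deT : 0 < de < T by rewrite d0 /T; lra.
have XX : - X <= X by lra.
have YY : - Y <= Y by lra.
apply: (@plane_int_comp F E (- X) X (- Y) Y de T) => //.
- by move=> i; exact: (proj2 (J 0)).
- by move=> z; rewrite (proj1 (J z)); ring.
- move=> z i [hz /andP[h1 h2]]; have /andP[h5 h6] := kz _ hz; have /andP[h3 h4] := hz.
  by have [->|->] := ord2P i; rewrite ?E0 ?E1 ?mul1r ?mul0r /T; lra.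
- move=> z /sF[]; rewrite E0 E1 ?mul1r ?mul0r => /andP[h1 h2] /andP[h3 h4].
  have hz : - X <= z 0 0 <= X by rewrite /X; apply/andP; split; lra.
  have /andP[h5 h6] := kz _ hz.
  by split=> //; rewrite /Y; apply/andP; split; lra.
- by move=> t ht; rewrite !E0 !mk20 !mk21 /X; split; lra.
- move=> s hs; rewrite !E1 !mk20 !mk21; have /andP[h5 h6] := kz _ hs.
  by rewrite /Y; split; lra.
Qed.

End PlaneInt.

(** * The local change of variables formula *)

Section LocalCoV.
Context {R : realType}.
Local Notation V := 'rV[R]_2.
Implicit Types (x y z v w : V) (U : set V) (i j : 'I_2).

Lemma lincomb (k l m : R) (f h : V -> R) x i : differentiable f x -> differentiable h x ->
  partial i (fun y => k * f y + l * h y + m) x = k * partial i f x + l * partial i h x.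
Proof.
move=> df dh; have dk (r : R) : differentiable (fun y : V => r) x by exact: differentiable_cst.
have d1 := differentiable_mul (dk k) df; have d2 := differentiable_mul (dk l) dh.
rewrite (partialD _ (differentiable_add d1 d2) (dk m)) (partialD _ d1 d2).
by rewrite (partialM _ (dk k) df) (partialM _ (dk l) dh) !partial_cst !mulr0 !addr0.
Qed.

Lemma Ck_lincomb n U (k l m : R) (f h : V -> R) : open U -> Ck n U f -> Ck n U h ->
  Ck n U (fun y => k * f y + l * h y + m).
Proof.
move=> oU cf ch; apply: (CkD oU _ (Ck_cst _ _ m)).
apply: (CkD oU); first exact: (CkM oU (Ck_cst _ _ k) cf).
exact: (CkM oU (Ck_cst _ _ l) ch).
Qed.

Lemma Ck_jdet n U (tau : V -> V) : open U -> (forall i, Ck n.+1 U (fun x => tau x 0 i)) ->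
  Ck n U (jdet tau).
Proof.
move=> oU Ct; have P i j : Ck n U (partial i (fun y => tau y 0 j)) := CkS_partial i (Ct j).
exact: (CkB oU (CkM oU (P 0 0) (P 1 1)) (CkM oU (P 1 0) (P 0 1))).
Qed.

Lemma sg_cases (a : R) : a != 0 -> exists s : R, (s = 1 \/ s = -1) /\ s * a = `|a|.
Proof.
have [a0|a0|->] := ltgtP a 0; last by [].
  by move=> _; exists (-1); split; [right|rewrite ltr0_norm // mulN1r].
by move=> _; exists 1; split; [left|rewrite gtr0_norm // mul1r].
Qed.

Lemma sg_mul_dist (s A B r : R) : (s = 1 \/ s = -1) -> `|A - B| <= r ->
  s * B - r <= s * A <= s * B + r.
Proof.
by move=> sc; rewrite ler_norml => /andP[h1 h2]; case: sc => ->; apply/andP; split; lra.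
Qed.

Lemma sg_mul_norm (s A r : R) : (s = 1 \/ s = -1) -> `|A| <= r -> - r <= s * A <= r.
Proof.
by move=> sc; rewrite ler_norml => /andP[h1 h2]; case: sc => ->; apply/andP; split; lra.
Qed.

(** [A], [B], [C] are the absolute values of the entries of a triangular differential, [B] being off
    the diagonal. The ratio [th] of the sides of the rectangle makes the off-diagonal term small
    against the diagonal one, and [ep] is an admissible linearization error. *)
Lemma triangular_constants (A B C : R) : 0 < A -> 0 <= B -> 0 < C ->
  exists th ep : R, [/\ 0 < th <= 1, B * th <= A / 4, 0 < ep, ep <= A / 4 & ep <= C * th / 2].
Proof.
move=> A0 B0 C0; have B1 : 0 < B + 1 by lra.
(* [B + 1] replaces [B], which may be 0. *)
pose th := Num.min 1 (A / (4 * (B + 1))).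
have th0 : 0 < th by rewrite lt_min ltr01 divr_gt0 // mulr_gt0.
have th1 : th <= 1 by rewrite ge_min lexx.
have thb : B * th <= A / 4.
  have h : th * (B + 1) <= A / 4.
    rewrite -ler_pdivlMr // (le_trans (y := A / (4 * (B + 1)))) ?ge_min ?lexx ?orbT //.
    by rewrite invfM mulrA.
  by lra.
exists th, (Num.min (A / 4) (C * th / 2)); split=> //.
- by rewrite th0.
- by rewrite lt_min !divr_gt0 // mulr_gt0.
- by rewrite ge_min lexx.
- by rewrite ge_min lexx orbT.
Qed.

(** The error [ep] is prescribed before [r]: it depends only on the proportions of the rectangle,
    whose size is then taken small. [s0] records the sign of the Jacobian, which persists on the
    whole square. *)
Lemma triangular_estimates U (S0 S1 J : V -> R) x0 (al be ga s0 : R) : open U -> U x0 ->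
  differentiable S0 x0 -> differentiable S1 x0 -> {for x0, continuous J} ->
  S0 x0 = 0 -> S1 x0 = 0 -> partial 0 S0 x0 = al -> partial 1 S0 x0 = be ->
  partial 0 S1 x0 = 0 -> partial 1 S1 x0 = ga -> 0 < s0 * J x0 ->
  forall ep : R, 0 < ep -> exists2 r : R, 0 < r &
    forall x, `|x 0 0 - x0 0 0| <= r -> `|x 0 1 - x0 0 1| <= r ->
    [/\ U x, 0 < s0 * J x,
     `|S0 x - ((x 0 0 - x0 0 0) * al + (x 0 1 - x0 0 1) * be)| <= ep * r &
     `|S1 x - (x 0 1 - x0 0 1) * ga| <= ep * r].
Proof.
move=> oU Ux0 dS0 dS1 cJ S00 S10 p00 p01 p10 p11 J0 ep ep0.
have D0 u : 'd S0 x0 u = u 0 0 * al + u 0 1 * be by rewrite diff_partial // p00 p01.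
have D1 u : 'd S1 x0 u = u 0 1 * ga by rewrite diff_partial // p10 p11 mulr0 add0r.
have N0 := differentiable_nearP dS0 ep0.
have N1 := differentiable_nearP dS1 ep0.
have NU : \forall y \near x0, U y /\ 0 < s0 * J y.
  have cJ' : {for x0, continuous (fun y => s0 * J y)}.
    by apply: (@continuousM _ _ (fun=> s0) J) => //; exact: cst_continuous.
  near=> y; split; near: y; first exact: open_nbhs_nbhs.
  exact: (cvgr_gt _ cJ').
have {}NU : \forall u \near (0 : V), U (u + x0) /\ 0 < s0 * J (u + x0).
  by move: NU; rewrite (near_shift 0 x0) /=; apply: filterS => u; rewrite /= subr0.
have : \forall u \near (0 : V), [/\ (U (u + x0) /\ 0 < s0 * J (u + x0)),
   `|S0 (u + x0) - (u 0 0 * al + u 0 1 * be)| <= ep * `|u| &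
   `|S1 (u + x0) - u 0 1 * ga| <= ep * `|u|].
  apply: filterS3 NU N0 N1 => u h1 h2 h3; split; first exact: h1.
    by rewrite S00 add0r D0 in h2.
  by rewrite S10 add0r D1 in h3.
move=> /nbhs_ballP[rho /= rho0 B].
have r0 : 0 < rho / 2 by rewrite divr_gt0.
exists (rho / 2) => // x h0 h1.
have c0 : (x - x0) 0 0 = x 0 0 - x0 0 0 by rewrite !mxE.
have c1 : (x - x0) 0 1 = x 0 1 - x0 0 1 by rewrite !mxE.
have ur : `|x - x0| <= rho / 2.
  apply/ler_addgt0Pr => ee ee0; apply: ltW; apply: row2_norm_lt; rewrite ?c0 ?c1.
  - exact: addr_gt0.
  - by rewrite (le_lt_trans h0) // ltrDl.
  - by rewrite (le_lt_trans h1) // ltrDl.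
have bu : ball (0 : V) rho (x - x0).
  by rewrite -ball_normE /= sub0r normrN (le_lt_trans ur) // ltr_pdivrMr // ltr_pMr // ltr1n.
have [[hU hJ] hS0 hS1] := B _ bu.
rewrite subrK in hU hJ hS0 hS1; rewrite c0 c1 in hS0; rewrite c1 in hS1.
have eur : ep * `|x - x0| <= ep * (rho / 2) by rewrite ler_wpM2l // ltW.
by split=> //; [exact: le_trans hS0 eur|exact: le_trans hS1 eur].
Unshelve. all: by end_near. Qed.

(** On a vertical side the leading term [|al| r] loses at most a quarter to the off-diagonal entry
    and a quarter to the error. On a horizontal side [|ga| th r] loses at most half to the error,
    its row of the differential having a single non-zero entry. *)
Lemma triangular_signs (s1 s2 al be ga th ep r X Y u0 u1 : R) :
  (s1 = 1 \/ s1 = -1) -> (s2 = 1 \/ s2 = -1) -> s1 * al = `|al| -> s2 * ga = `|ga| ->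
  0 < `|al| -> 0 < `|ga| -> 0 < r -> 0 < th <= 1 -> `|be| * th <= `|al| / 4 ->
  ep <= `|al| / 4 -> ep <= `|ga| * th / 2 ->
  `|X - (u0 * al + u1 * be)| <= ep * r -> `|Y - u1 * ga| <= ep * r ->
  `|u0| <= r -> `|u1| <= th * r ->
  [/\ X <= 2 * (`|al| * r) /\ Y <= 2 * (`|ga| * th * r),
   u0 = - r -> s1 * X <= - (`|al| * r / 2), u0 = r -> `|al| * r / 2 <= s1 * X,
   u1 = - (th * r) -> s2 * Y <= - (`|ga| * th * r / 2) &
   u1 = th * r -> `|ga| * th * r / 2 <= s2 * Y].
Proof.
move=> s1c s2c s1a s2g al0 ga0 r0 /andP[th0 th1] thb epa epg hX hY hu0 hu1.
have epar : ep * r <= `|al| * r / 4 by rewrite mulrAC ler_pM2r.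
have epgr : ep * r <= `|ga| * th * r / 2 by rewrite [leRHS]mulrAC ler_pM2r.
have ar0 : 0 < `|al| * r by rewrite mulr_gt0.
have gr0 : 0 < `|ga| * th * r by rewrite !mulr_gt0.
have bes : `|u1 * be| <= `|al| * r / 4.
  rewrite normrM mulrC (le_trans (ler_wpM2l (normr_ge0 be) hu1)) //.
  by rewrite mulrA [leRHS]mulrAC ler_pM2r.
have ala : `|u0 * al| <= `|al| * r by rewrite normrM mulrC ler_pM2l.
have gaa : `|u1 * ga| <= `|ga| * th * r by rewrite normrM mulrC -mulrA ler_pM2l.
have /andP[h1 h2] := sg_mul_dist s1c hX; have /andP[h3 h4] := sg_mul_norm s1c bes.
have /andP[h5 h6] := sg_mul_dist s2c hY.
have E0 : s1 * (u0 * al + u1 * be) = u0 * `|al| + s1 * (u1 * be) by rewrite -s1a; ring.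
have E1 : s2 * (u1 * ga) = u1 * `|ga| by rewrite -s2g; ring.
rewrite E0 in h1 h2; rewrite E1 in h5 h6.
move: hX hY bes ala gaa; rewrite !ler_norml => /andP[_ a2] /andP[_ b2] /andP[_ c2] /andP[_ d2] /andP[_ e2].
move: (`|al|) (`|ga|) (s1 * X) (s2 * Y) (s1 * (u1 * be)) (u0 * al) (u1 * be) (u1 * ga)
  h1 h2 h3 h4 h5 h6 a2 b2 c2 d2 e2 al0 ga0 epar epgr ar0 gr0 {E0 E1 s1a s2g s1c s2c epa epg thb hu0 hu1 th1}.
move=> A C p1 p2 p3 p4 p5 p6 h1 h2 h3 h4 h5 h6 a2 b2 c2 d2 e2 al0 ga0 epar epgr ar0 gr0.
split; first by split; lra.
- by move=> E; rewrite E in h2; lra.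
- by move=> E; rewrite E in h1; lra.
- by move=> E; rewrite E in h6; lra.
- by move=> E; rewrite E in h5; lra.
Qed.

(** With a triangular differential, a flat enough rectangle around [x0] has its four sides mapped
    left, right, below and above a neighbourhood of the image point, up to signs. This is the
    situation of [itg2_pullback]. *)
Lemma cov_triangular U (sigma : V -> V) x0 : open U -> U x0 ->
  (forall i, Ck 2 U (fun x => sigma x 0 i)) ->
  sigma x0 0 0 = 0 -> sigma x0 0 1 = 0 ->
  partial 0 (fun y => sigma y 0 1) x0 = 0 -> jdet sigma x0 != 0 ->
  exists r s de : R, [/\ 0 < r, 0 < s, 0 < de,
    rect (x0 0 0 - r) (x0 0 0 + r) (x0 0 1 - s) (x0 0 1 + s) `<=` U &
    forall F, Ck 1 setT F ->
      (forall w, F w != 0 -> - de <= w 0 0 <= de /\ - de <= w 0 1 <= de) ->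
      itg2 (x0 0 0 - r) (x0 0 0 + r) (x0 0 1 - s) (x0 0 1 + s)
        (fun x => F (sigma x) * `|jdet sigma x|) = plane_int F].
Proof.
move=> oU Ux0 Cs S00 S10 p10 J0.
pose al := partial 0 (fun y => sigma y 0 0) x0.
pose be := partial 1 (fun y => sigma y 0 0) x0.
pose ga := partial 1 (fun y => sigma y 0 1) x0.
have JE : jdet sigma x0 = al * ga by rewrite /jdet p10 mulr0 subr0.
have /andP[a0 g0] : (al != 0) && (ga != 0) by rewrite -negb_or -mulf_eq0 -JE.
have [s1 [s1c s1a]] := sg_cases a0; have [s2 [s2c s2g]] := sg_cases g0.
have al0 : 0 < `|al| by rewrite normr_gt0.
have ga0 : 0 < `|ga| by rewrite normr_gt0.
have [th [ep [th01 thb ep0 epa epg]]] := triangular_constants al0 (normr_ge0 be) ga0.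
have Js : 0 < s1 * s2 * jdet sigma x0.
  by rewrite JE mulrACA s1a s2g mulr_gt0.
have cJ : {for x0, continuous (jdet sigma)} by exact: (Ck_jdet oU (fun i => CkS (Cs i))).
have [r r0 B] := triangular_estimates oU Ux0 (CkS_diff (Cs 0) Ux0) (CkS_diff (Cs 1) Ux0) cJ
  S00 S10 (erefl al) (erefl be) p10 (erefl ga) Js ep0.
have [th0 th1] := andP th01.
pose s := th * r.
have s0 : 0 < s by rewrite mulr_gt0.
have sr : s <= r by rewrite /s ler_piMl // ltW.
(* At most half of the distance that [triangular_signs] guarantees between the images of the sides
   and the axes, so that the required inequalities are strict. *)
pose de := Num.min (`|al| * r / 4) (`|ga| * th * r / 4).
have ar0 : 0 < `|al| * r by rewrite mulr_gt0.
have gr0 : 0 < `|ga| * th * r by rewrite !mulr_gt0.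
have de0 : 0 < de by rewrite lt_min !divr_gt0.
have dea : de < `|al| * r / 2.
  by rewrite (le_lt_trans (y := `|al| * r / 4)) ?ge_min ?lexx // ltr_pM2l // ltf_pV2 ?posrE // ltr_nat.
have deg : de < `|ga| * th * r / 2.
  by rewrite (le_lt_trans (y := `|ga| * th * r / 4)) ?ge_min ?lexx ?orbT // ltr_pM2l // ltf_pV2 ?posrE // ltr_nat.
(* An upper bound for both components of [sigma] on the rectangle. *)
pose T := 2 * (`|al| * r) + 2 * (`|ga| * th * r).
have T1 : 2 * (`|al| * r) <= T by rewrite lerDl mulr_ge0 // ltW.
have T2 : 2 * (`|ga| * th * r) <= T by rewrite lerDr mulr_ge0 // ltW.
have deT : 0 < de < T.
  rewrite de0 /= (lt_le_trans dea) // (le_trans _ T1) // mulrC ler_pM2r //.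
  by rewrite (le_trans (y := 1)) ?ler1n // invf_le1 // ler1n.
pose Q := rect (x0 0 0 - r) (x0 0 0 + r) (x0 0 1 - s) (x0 0 1 + s).
have Qd x : Q x -> `|x 0 0 - x0 0 0| <= r /\ `|x 0 1 - x0 0 1| <= s.
  move=> [/andP[h1 h2] /andP[h3 h4]]; rewrite !ler_norml.
  by rewrite lerBrDr lerBlDr lerBrDr lerBlDr ![- _ + _]addrC h1 h3 ![_ + x0 _ _]addrC h2 h4.
have BQ x : Q x -> [/\ U x, 0 < s1 * s2 * jdet sigma x & _] := fun Qx =>
  let: conj h0 h1 := Qd x Qx in
  let: And4 hU hJ hX hY := B x h0 (le_trans h1 sr) in
  And3 hU hJ (triangular_signs s1c s2c s1a s2g al0 ga0 r0 th01 thb epa epg hX hY h0 h1).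
have ab : x0 0 0 - r <= x0 0 0 + r by rewrite lerD2l (le_trans (y := 0)) ?oppr_le0 ?ltW.
have cd : x0 0 1 - s <= x0 0 1 + s by rewrite lerD2l (le_trans (y := 0)) ?oppr_le0 ?ltW.
have QU : Q `<=` U by move=> x /BQ[].
exists r, s, de; split=> // F CF sF.
have NF : itg2 (x0 0 0 - r) (x0 0 0 + r) (x0 0 1 - s) (x0 0 1 + s)
   (fun x => F (sigma x) * jdet sigma x) = s1 * s2 * itg2 (- T) T (- T) T F.
  apply: (@itg2_pullback _ F de T CF deT sF sigma U) => //.
  - move=> x i Qx; have [_ _ [[h0 h1] _ _ _ _]] := BQ x Qx.
    by have [->|->] := ord2P i; [exact: le_trans h0 T1|exact: le_trans h1 T2].
  - move=> t ht; have Qx : Q (mk2 (x0 0 0 - r) t) by apply: rect_mk2 => //; rewrite lexx ab.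
    have [_ _ [_ h _ _ _]] := BQ _ Qx; rewrite mk20 in h.
    by rewrite (le_lt_trans (h _)) ?ltrN2 // addrAC subrr add0r.
  - move=> t ht; have Qx : Q (mk2 (x0 0 0 + r) t) by apply: rect_mk2 => //; rewrite lexx ab.
    have [_ _ [_ _ h _ _]] := BQ _ Qx; rewrite mk20 in h.
    by rewrite (lt_le_trans _ (h _)) // addrAC subrr add0r.
  - move=> t ht; have Qx : Q (mk2 t (x0 0 1 - s)) by apply: rect_mk2 => //; rewrite lexx cd.
    have [_ _ [_ _ _ h _]] := BQ _ Qx; rewrite mk21 in h.
    by rewrite (le_lt_trans (h _)) ?ltrN2 // addrAC subrr add0r.
  - move=> t ht; have Qx : Q (mk2 t (x0 0 1 + s)) by apply: rect_mk2 => //; rewrite lexx cd.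
    have [_ _ [_ _ _ _ h]] := BQ _ Qx; rewrite mk21 in h.
    by rewrite (lt_le_trans _ (h _)) // addrAC subrr add0r.
have TT : forall z, F z != 0 -> rect (- T) T (- T) T z.
  have dT : de <= T by case/andP: deT => _ /ltW.
  move=> z /sF[/andP[h1 h2] /andP[h3 h4]]; split; apply/andP; split.
  - by rewrite (le_trans _ h1) // lerN2.
  - exact: le_trans h2 dT.
  - by rewrite (le_trans _ h3) // lerN2.
  - exact: le_trans h4 dT.
rewrite (plane_int_rect TT).
(* [s1 * s2] is the sign of the Jacobian; multiplying by it once more turns the signed formula into
   the one with the absolute value. *)
have S12 : s1 * s2 * (s1 * s2) = 1.
  by case: s1c => ->; case: s2c => ->; rewrite ?mulrNN ?mulr1 ?mulrN1 ?opprK.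
rewrite -[RHS]mul1r -S12 -[RHS]mulrA -NF -(@itg2Z _ _ _ _ _ U) //; last first.
  apply: (CkM oU); last by apply: Ck_jdet => // i; exact: CkS (Cs i).
  by apply: (@Ck_comp _ 0 U setT _ sigma oU (fun i => CkS (CkS (Cs i))) (fun _ _ => I)); exact: CkS CF.
apply: eq_itg2 => x Qx; have [Ux Jx _] := BQ x Qx.
rewrite [RHS]mulrCA; congr (_ * _).
rewrite -[RHS]ger0_norm ?(ltW Jx) // normrM.
have -> : `|s1 * s2| = 1.
  by case: s1c => ->; case: s2c => ->; rewrite ?mulrNN ?mulr1 ?mul1r ?normrN normr1.
by rewrite mul1r.
Qed.

(** Composing [tau] with two shears and a translation of the target makes its differential at [x0]
    triangular; these maps preserve both the Jacobian determinant and [plane_int]. *)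
Lemma local_cov U (tau : V -> V) x0 : open U -> U x0 ->
  (forall i, Ck 2 U (fun x => tau x 0 i)) -> jdet tau x0 != 0 ->
  exists r s eta : R, [/\ 0 < r, 0 < s, 0 < eta,
    rect (x0 0 0 - r) (x0 0 0 + r) (x0 0 1 - s) (x0 0 1 + s) `<=` U &
    forall F, Ck 1 setT F -> bsupp F (tau x0) eta ->
      itg2 (x0 0 0 - r) (x0 0 0 + r) (x0 0 1 - s) (x0 0 1 + s)
        (fun x => F (tau x) * `|jdet tau x|) = plane_int F].
Proof.
move=> oU Ux0 Ct J0.
have dt i x : U x -> differentiable (fun y => tau y 0 i) x by exact: CkS_diff (Ct i).
pose p := tau x0 0 0; pose q := tau x0 0 1.
pose t0 := fun y => tau y 0 0; pose t1 := fun y => tau y 0 1.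
(* The Jacobian is non-zero, so the two [partial 0] derivatives do not both vanish; adding the
   second component to the first, if necessary, makes the pivot non-zero. *)
have [e [e01 a0]] : exists e : R, (e = 0 \/ e = 1) /\ partial 0 t0 x0 + e * partial 0 t1 x0 != 0.
  have [h|h] := eqVneq (partial 0 t0 x0) 0; last by exists 0; rewrite mul0r addr0; split; [left|].
  exists 1; split; first by right.
  rewrite h add0r mul1r; apply: contra_neq J0 => h'.
  by rewrite /jdet -/t0 -/t1 h h' mul0r mulr0 subrr.
pose al := partial 0 t0 x0 + e * partial 0 t1 x0.
(* Subtracting this multiple of the new first component removes the [partial 0] derivative of the
   second one at [x0]. *)
pose ka := partial 0 t1 x0 / al.
pose sigma y := mk2 (t0 y + e * t1 y - (p + e * q)) (- ka * (t0 y + e * t1 y - (p + e * q)) + t1 y - q).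
pose S0 := fun y => 1 * t0 y + e * t1 y + - (p + e * q).
pose S1 := fun y => - ka * t0 y + (1 - ka * e) * t1 y + (ka * (p + e * q) - q).
have s0E : (fun y => sigma y 0 0) = S0 by apply/funext => y; rewrite mk20 /S0 mul1r.
have s1E : (fun y => sigma y 0 1) = S1 by apply/funext => y; rewrite mk21 /S1; ring.
have Cs i : Ck 2 U (fun x => sigma x 0 i).
  by have [->|->] := ord2P i; rewrite ?s0E ?s1E; exact: (Ck_lincomb _ _ _ oU (Ct 0) (Ct 1)).
have pS0 i x : U x -> partial i S0 x = partial i t0 x + e * partial i t1 x.
  by move=> Ux; rewrite /S0 (lincomb _ _ _ _ (dt 0 x Ux) (dt 1 x Ux)) mul1r.
have pS1 i x : U x -> partial i S1 x = - ka * partial i t0 x + (1 - ka * e) * partial i t1 x.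
  by move=> Ux; rewrite /S1 (lincomb _ _ _ _ (dt 0 x Ux) (dt 1 x Ux)).
have jS x : U x -> jdet sigma x = jdet tau x.
  move=> Ux; rewrite /jdet s0E s1E !pS0 // !pS1 // -/t0 -/t1.
  by move: (partial 0 t0 x) (partial 1 t0 x) (partial 0 t1 x) (partial 1 t1 x) => A B C D; ring.
have p10 : partial 0 (fun y => sigma y 0 1) x0 = 0.
  rewrite s1E pS1 //.
  have -> : - ka * partial 0 t0 x0 + (1 - ka * e) * partial 0 t1 x0 = partial 0 t1 x0 - ka * al.
    by rewrite /al; move: (partial 0 t0 x0) (partial 0 t1 x0) => A B; ring.
  by rewrite [ka * al]mulfVK // subrr.
have sx0 : sigma x0 0 0 = 0 by rewrite mk20 /t0 /t1 -/p -/q subrr.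
have sx1 : sigma x0 0 1 = 0 by rewrite mk21 /t0 /t1 -/p -/q; ring.
have J0' : jdet sigma x0 != 0 by rewrite jS.
have [r [s [de [r0 s0 de0 QU NF]]]] := cov_triangular oU Ux0 Cs sx0 sx1 p10 J0'.
have k2 : 0 < 2 + 2 * `|ka| by rewrite ltr_pwDl // mulr_ge0.
(* The inverse shears enlarge a support of radius [eta] to at most [2 eta] in the first coordinate
   and [eta + 2 |ka| eta] in the second, both within [de]. *)
pose eta := de / (2 + 2 * `|ka|).
have eta0 : 0 < eta by rewrite divr_gt0.
have etaE : 2 * eta + 2 * (`|ka| * eta) = de.
  have <- : eta * (2 + 2 * `|ka|) = de by rewrite /eta divfK // gt_eqF.
  by ring.
exists r, s, eta; split=> // F CF sF.
(* [E0 \o E1] undoes the normalization: it sends [sigma x] back to [tau x]. *)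
pose E0 (u : V) : V := mk2 (u 0 0 + - e * u 0 1 + p) (u 0 1 + q).
pose E1 (u : V) : V := mk2 (u 0 0) (ka * u 0 0 + u 0 1).
have CE0 i : Ck 1 setT (fun x => E0 x 0 i).
  apply: CkS; apply: (proj2 (@jdet_affine _ E0 1 (- e) 0 1 p q 0 _ _)) => y.
    by rewrite mk20 mul1r.
  by rewrite mk21 mul0r mul1r add0r.
have CE1 i : Ck 1 setT (fun x => E1 x 0 i).
  apply: CkS; apply: (proj2 (@jdet_affine _ E1 1 0 ka 1 0 0 0 _ _)) => y.
    by rewrite mk20 mul1r mul0r !addr0.
  by rewrite mk21 mul1r addr0.
have CF0 : Ck 1 setT (F \o E0) by exact: (@Ck_comp _ 1 setT setT F E0 openT CE0 (fun _ _ => I) CF).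
have CF1 : Ck 1 setT ((F \o E0) \o E1).
  exact: (@Ck_comp _ 1 setT setT (F \o E0) E1 openT CE1 (fun _ _ => I) CF0).
have eta2 : 0 <= 2 * eta by rewrite mulr_ge0 // ltW.
have sF0 u : F (E0 u) != 0 -> - (2 * eta) <= u 0 0 <= 2 * eta /\ - eta <= u 0 1 <= eta.
  move=> /sF[]; rewrite mk20 mk21 -/p -/q => /andP[h1 h2] /andP[h3 h4].
  clear - e01 eta0 h1 h2 h3 h4.
  by case: e01 h1 h2 => -> h1 h2; split; apply/andP; split; lra.
have bF0 : bsupp (F \o E0) 0 (2 * eta).
  move=> u /sF0[h /andP[h1 h2]]; rewrite !mxE !sub0r !add0r; split=> //.
  by clear - eta0 h1 h2; apply/andP; split; lra.
have PF : plane_int ((F \o E0) \o E1) = plane_int F.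
  by rewrite (plane_int_shear1 ka eta2 CF0 bF0) (plane_int_shear0 (- e) p q (ltW eta0) CF sF).
have sF1 w : ((F \o E0) \o E1) w != 0 -> - de <= w 0 0 <= de /\ - de <= w 0 1 <= de.
  move=> /sF0; rewrite mk20 mk21 => -[h /andP[h3 h4]]; have /andP[h1 h2] := h.
  have /andP[h5 h6] : - (`|ka| * (2 * eta)) <= ka * w 0 0 <= `|ka| * (2 * eta).
    by apply: ler_norm_mul; rewrite ler_norml.
  have kk : 0 <= `|ka| * eta by rewrite mulr_ge0 // ltW.
  rewrite -etaE; clear - eta0 h1 h2 h3 h4 h5 h6 kk.
  by split; apply/andP; split; lra.
have FE x : ((F \o E0) \o E1) (sigma x) = F (tau x).
  rewrite /=; congr F; apply: row2_eq.
    by rewrite /E0 /E1 /sigma !(mk20, mk21) /t0 /t1; ring.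
  by rewrite /E0 /E1 /sigma !(mk20, mk21) /t0 /t1; ring.
rewrite -PF -(NF _ CF1 sF1); apply: eq_itg2 => x Qx.
by rewrite FE jS //; exact: QU.
Qed.

End LocalCoV.

(** * The Bochner identity in a chart *)

(* Unlike [bigop], it unfolds to a form that [ring] understands. *)
Definition sum2 (T : nmodType) (F : 'I_2 -> T) : T := F 0 + F 1.
Reserved Notation "\dsum_ i F" (at level 34, F at level 41, i at level 0).
Notation "\dsum_ i F" := (sum2 (fun i => F)) : ring_scope.

Section Bochner.
Context {R : realType}.
Local Notation V := 'rV[R]_2.
Implicit Types (x y : V) (i j k a b c : 'I_2).

(** Bundling differentiability with the value lets the derivative of a long expression be assembled
    along its structure, without separate side conditions. *)
Definition is_pd k (f : V -> R) x (d : R) := differentiable f x /\ partial k f x = d.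

Lemma is_pd_partial k f x : differentiable f x -> is_pd k f x (partial k f x).
Proof. by move=> df; split. Qed.

Lemma is_pdM k f h x df dh : is_pd k f x df -> is_pd k h x dh ->
  is_pd k (fun y => f y * h y) x (df * h x + f x * dh).
Proof.
move=> [f1 <-] [h1 <-]; split; first exact: differentiable_mul.
by rewrite partialM // addrC [h x * _]mulrC.
Qed.

Lemma is_pdD k f h x df dh : is_pd k f x df -> is_pd k h x dh ->
  is_pd k (fun y => f y + h y) x (df + dh).
Proof. by move=> [f1 <-] [h1 <-]; split; [exact: differentiable_add|rewrite partialD]. Qed.

Lemma is_pdN k f x df : is_pd k f x df -> is_pd k (fun y => - f y) x (- df).
Proof. by move=> [f1 <-]; split; [exact: differentiable_opp|rewrite partialN]. Qed.

Lemma is_pdB k f h x df dh : is_pd k f x df -> is_pd k h x dh ->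
  is_pd k (fun y => f y - h y) x (df - dh).
Proof. by move=> pf ph; apply: is_pdD => //; exact: is_pdN. Qed.

Lemma is_pd_cst k (r : R) x : is_pd k (fun=> r) x 0.
Proof. by split; [exact: differentiable_cst|rewrite partial_cst]. Qed.

Lemma is_pd_sum k (F : 'I_2 -> V -> R) x (d : 'I_2 -> R) :
  (forall a, is_pd k (F a) x (d a)) -> is_pd k (fun y => \dsum_a F a y) x (\dsum_a d a).
Proof. by move=> H; exact: is_pdD. Qed.

Lemma eq_sum2 (T : nmodType) (F F' : 'I_2 -> T) : (forall a, F a = F' a) -> sum2 F = sum2 F'.
Proof. by move=> E; rewrite /sum2 !E. Qed.

Variables (U : set V) (A : 'I_2 -> 'I_2 -> V -> R) (C : 'I_2 -> 'I_2 -> 'I_2 -> V -> R).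
Variables (s w : V -> R).
Hypotheses (oU : open U) (CA : forall a b, Ck 1 U (A a b)).
Hypotheses (CC : forall c a b, Ck 1 U (C c a b)) (Cs : Ck 1 U s) (Cw : Ck 3 U w).
Hypothesis A_sym : forall a b x, U x -> A a b x = A b a x.
Hypothesis C_sym : forall c a b x, U x -> C c a b x = C c b a x.
Hypothesis dA : forall k a b x, U x -> partial k (A a b) x =
  - \dsum_c (C a k c x * A c b x + C b k c x * A a c x).
Hypothesis ds : forall k x, U x -> partial k s x = s x * \dsum_c C c k c x.
Hypothesis s0 : forall x, U x -> s x != 0.

(** The divergence of [Z] for the density [s]. In this section [A] stands for the inverse metric,
    [C] for the Christoffel symbols and [s] for the volume density, known only through the
    differential relations assumed above. *)
Definition divs (s : V -> R) (Z : 'I_2 -> V -> R) x :=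
  (\dsum_a partial a (fun y => s y * Z a y) x) / s x.

Definition gradf (A : 'I_2 -> 'I_2 -> V -> R) (f : V -> R) a x := \dsum_b A a b x * partial b f x.

Definition ipf (A : 'I_2 -> 'I_2 -> V -> R) (f h : V -> R) x :=
  \dsum_a \dsum_b A a b x * partial a f x * partial b h x.

Definition hess (C : 'I_2 -> 'I_2 -> 'I_2 -> V -> R) (f : V -> R) a b x :=
  partial a (partial b f) x - \dsum_c C c a b x * partial c f x.

Lemma eq_divs Z Z' x : U x -> (forall a y, U y -> Z a y = Z' a y) -> divs s Z x = divs s Z' x.
Proof.
move=> Ux E; rewrite /divs; congr (_ / _); apply: eq_sum2 => a.
by apply: (eq_on_partial _ oU _ Ux) => y Uy; rewrite E.
Qed.

Lemma divsE Z dZ x : U x -> (forall a, is_pd a (Z a) x (dZ a)) ->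
  divs s Z x = \dsum_a (dZ a + (\dsum_c C c a c x) * Z a x).
Proof.
move=> Ux pZ.
have key a : partial a (fun y => s y * Z a y) x / s x = dZ a + (\dsum_c C c a c x) * Z a x.
  have ps : is_pd a s x (s x * \dsum_c C c a c x).
    by rewrite -ds //; apply: is_pd_partial; exact: (CkS_diff Cs Ux).
  have [_ ->] := is_pdM ps (pZ a).
  move: (s0 Ux) (\dsum_c C c a c x) (Z a x) (dZ a) => sx p q r; field.
  exact: sx.
by rewrite /divs /sum2 mulrDl !key.
Qed.

Let pw k a x : U x -> is_pd k (partial a w) x (partial k (partial a w) x).
Proof. by move=> Ux; apply: is_pd_partial; exact: CkS_diff (CkS_partial a Cw) Ux. Qed.

Let pww k a b x : U x -> is_pd k (partial a (partial b w)) x (partial k (partial a (partial b w)) x).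
Proof.
by move=> Ux; apply: is_pd_partial; exact: CkS_diff (CkS_partial a (CkS_partial b Cw)) Ux.
Qed.

Let pA k a b x : U x -> is_pd k (A a b) x (- \dsum_c (C a k c x * A c b x + C b k c x * A a c x)).
Proof. by move=> Ux; rewrite -dA //; apply: is_pd_partial; exact: CkS_diff (CA a b) Ux. Qed.

Let pC k c a b x : U x -> is_pd k (C c a b) x (partial k (C c a b) x).
Proof. by move=> Ux; apply: is_pd_partial; exact: CkS_diff (CC c a b) Ux. Qed.

Let pH k a b x : U x -> is_pd k (hess C w a b) x (partial k (partial a (partial b w)) x -
  \dsum_c (partial k (C c a b) x * partial c w x + C c a b x * partial k (partial c w) x)).
Proof.
move=> Ux; apply: is_pdB; first exact: pww.
by apply: is_pd_sum => c; apply: is_pdM; [exact: pC|exact: pw].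
Qed.

Let ww01 x : U x -> partial 1 (partial 0 w) x = partial 0 (partial 1 w) x.
Proof. by move=> Ux; exact: esym (schwarz01 oU (CkS Cw) Ux). Qed.

Lemma divs_gradf x : U x -> divs s (gradf A w) x = \dsum_a \dsum_b A a b x * hess C w a b x.
Proof.
move=> Ux; rewrite (divsE (dZ := fun a => \dsum_b
    ((- \dsum_c (C a a c x * A c b x + C b a c x * A a c x)) * partial b w x +
     A a b x * partial a (partial b w) x)) Ux); last first.
  by move=> a; apply: is_pd_sum => b; apply: is_pdM; [exact: pA|exact: pw].
rewrite /gradf /hess /sum2; move: (ww01 Ux) (A_sym 1 0 Ux) (fun c => C_sym c 1 0 Ux).
move: (@partial R) (0 : 'I_2) (1 : 'I_2) => P o l W10 A10 C10; rewrite W10 !A10 !C10.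
move: (A o o x) (A o l x) (A l l x) (P o w x) (P l w x) => a00 a01 a11 w0 w1.
move: (P o (P o w) x) (P o (P l w) x) (P l (P l w) x) => w00 w01 w11.
move: (C o o o x) (C o o l x) (C o l l x) (C l o o x) (C l o l x) (C l l l x) => c000 c001 c011 c100 c101 c111.
ring.
Qed.

(** The Hessian of [w] applied to the k-th coordinate field and to the gradient of [w]. *)
Definition half_dip k x := \dsum_a \dsum_b A a b x * partial a w x * hess C w k b x.

Lemma partial_ipf k x : U x -> partial k (ipf A w w) x = 2 * half_dip k x.
Proof.
move=> Ux; have [_ ->] : is_pd k (ipf A w w) x (\dsum_a \dsum_b
   (((- \dsum_c (C a k c x * A c b x + C b k c x * A a c x)) * partial a w x +
     A a b x * partial k (partial a w) x) * partial b w x +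
    A a b x * partial a w x * partial k (partial b w) x)).
  apply: is_pd_sum => a; apply: is_pd_sum => b.
  by apply: is_pdM; [apply: is_pdM; [exact: pA|exact: pw]|exact: pw].
rewrite /half_dip /hess /sum2; move: (A_sym 1 0 Ux).
move: (@partial R) (0 : 'I_2) (1 : 'I_2) => P o l A10; rewrite !A10.
move: (A o o x) (A o l x) (A l l x) (P o w x) (P l w x) => a00 a01 a11 w0 w1.
move: (P k (P o w) x) (P k (P l w) x) => wk0 wk1.
move: (C o k o x) (C o k l x) (C l k o x) (C l k l x) => c0k0 c0k1 c1k0 c1k1.
ring.
Qed.

(** With H the Hessian as an endomorphism and D the gradient of [w], the left-hand side is 2 tr(H)
    <H D, D> - 2 |H D|^2. The theorem of Cayley and Hamilton in dimension two, H^2 - tr(H) H +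
    det(H) = 0, turns it into 2 det(H) |D|^2. *)
Lemma weight_identity x : U x ->
  divs s (gradf A w) x * ipf A (ipf A w w) w x - 2^-1 * ipf A (ipf A w w) (ipf A w w) x =
  2 * ipf A w w x * ((A 0 0 x * A 1 1 x - A 0 1 x ^+ 2) *
    (hess C w 0 0 x * hess C w 1 1 x - hess C w 0 1 x * hess C w 1 0 x)).
Proof.
move=> Ux; have H10 : hess C w 1 0 x = hess C w 0 1 x.
  rewrite /hess (ww01 Ux); congr (_ - _); apply: eq_sum2 => c.
  by rewrite (C_sym c 1 0 Ux).
rewrite (divs_gradf Ux); have dI k := partial_ipf k Ux.
have -> : ipf A (ipf A w w) w x = \dsum_a \dsum_b A a b x * (2 * half_dip a x) * partial b w x.
  by apply: eq_sum2 => a; apply: eq_sum2 => b; rewrite dI.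
have -> : ipf A (ipf A w w) (ipf A w w) x = \dsum_a \dsum_b A a b x * (2 * half_dip a x) * (2 * half_dip b x).
  by apply: eq_sum2 => a; apply: eq_sum2 => b; rewrite !dI.
rewrite /ipf /half_dip /sum2; move: H10 (A_sym 1 0 Ux).
move: (@partial R) (0 : 'I_2) (1 : 'I_2) => P o l H10 A10; rewrite H10 !A10.
move: (A o o x) (A o l x) (A l l x) (P o w x) (P l w x) => a00 a01 a11 w0 w1.
by move: (hess C w o o x) (hess C w o l x) (hess C w l l x) => h00 h01 h11; field.
Qed.

Definition riem m i j k x : R :=
  partial i (C m j k) x - partial j (C m i k) x
  + \dsum_l (C l j k x * C m i l x - C l i k x * C m j l x).

Let w3 k a b x : U x -> partial k (partial a (partial b w)) x = partial k (partial b (partial a w)) x.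
Proof. by move=> Ux; apply: (eq_on_partial _ oU _ Ux) => y Uy; exact: schwarz oU (CkS Cw) Uy. Qed.

Let w3' k a b x : U x -> partial k (partial a (partial b w)) x = partial a (partial k (partial b w)) x.
Proof. by move=> Ux; exact: schwarz oU (CkS_partial b Cw) Ux. Qed.

Let dC_sym k c x : U x -> partial k (C c 1 0) x = partial k (C c 0 1) x.
Proof. by move=> Ux; apply: (eq_on_partial _ oU _ Ux) => y Uy; exact: C_sym. Qed.

(** Bochner's formula combined with (tr H)^2 - |H|^2 = 2 det H in dimension two. The third
    derivatives of [w] cancel once commuted; the derivatives of [C] that remain form the curvature
    term, which is Ric(Dw, Dw) for a metric connection. *)
Lemma bochner x : U x ->
  let u a := gradf A w a x in
  let q := \dsum_m riem m 0 1 0 x * partial m w x in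
  let r := \dsum_m riem m 0 1 1 x * partial m w x in
  divs s (gradf A w) x ^+ 2 + ipf A (divs s (gradf A w)) w x
    - 2^-1 * divs s (gradf A (ipf A w w)) x =
  2 * ((A 0 0 x * A 1 1 x - A 0 1 x ^+ 2) *
    (hess C w 0 0 x * hess C w 1 1 x - hess C w 0 1 x * hess C w 1 0 x))
  - (u 0 * (A 0 1 x * q + A 1 1 x * r) - u 1 * (A 0 0 x * q + A 0 1 x * r)).
Proof.
move=> Ux u q r.
have dL k : partial k (divs s (gradf A w)) x = \dsum_a \dsum_b
   ((- \dsum_c (C a k c x * A c b x + C b k c x * A a c x)) * hess C w a b x +
    A a b x * (partial k (partial a (partial b w)) x -
      \dsum_c (partial k (C c a b) x * partial c w x + C c a b x * partial k (partial c w) x))).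
  rewrite (eq_on_partial k oU divs_gradf Ux).
  suff [_ ->] : is_pd k (fun y => \dsum_a \dsum_b A a b y * hess C w a b y) x (\dsum_a \dsum_b
   ((- \dsum_c (C a k c x * A c b x + C b k c x * A a c x)) * hess C w a b x +
    A a b x * (partial k (partial a (partial b w)) x -
      \dsum_c (partial k (C c a b) x * partial c w x + C c a b x * partial k (partial c w) x)))) by [].
  by apply: is_pd_sum => a; apply: is_pd_sum => b; apply: is_pdM; [exact: pA|exact: pH].
have -> : divs s (gradf A (ipf A w w)) x =
    divs s (fun a y => \dsum_b A a b y * (2 * half_dip b y)) x.
  by apply: eq_divs => // a y Uy; apply: eq_sum2 => b; rewrite partial_ipf.
pose dV k b := \dsum_a \dsum_c
  (((- \dsum_c' (C a k c' x * A c' c x + C c k c' x * A a c' x)) * partial a w x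
    + A a c x * partial k (partial a w) x) * hess C w b c x
   + A a c x * partial a w x * (partial k (partial b (partial c w)) x -
      \dsum_c' (partial k (C c' b c) x * partial c' w x + C c' b c x * partial k (partial c' w) x))).
have pV k b : is_pd k (half_dip b) x (dV k b).
  apply: is_pd_sum => a; apply: is_pd_sum => c; apply: is_pdM; last exact: pH.
  by apply: is_pdM; [exact: pA|exact: pw].
have pZ a : is_pd a (fun y => \dsum_b A a b y * (2 * half_dip b y)) x (\dsum_b
    ((- \dsum_c (C a a c x * A c b x + C b a c x * A a c x)) * (2 * half_dip b x) +
     A a b x * (0 * half_dip b x + 2 * dV a b))).
  apply: is_pd_sum => b; have p2 : is_pd a (fun y => 2 * half_dip b y) x (0 * half_dip b x + 2 * dV a b).
    exact: (is_pdM (is_pd_cst a 2 x) (pV a b)).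
  exact: (is_pdM (pA a a b Ux) p2).
rewrite (divsE Ux pZ).
rewrite (divs_gradf Ux).
have -> : ipf A (divs s (gradf A w)) w x = _ :=
  eq_sum2 (fun a => eq_sum2 (fun b => congr1 (fun t => A a b x * t * partial b w x) (dL a))).
rewrite /ipf /u /q /r /dV /half_dip /gradf /riem /hess /sum2 {dL pZ pV dV u q r}.
(* Every iterated derivative of [w] is brought to the order with the index 0 outermost, and
   symmetric coefficients to one representative; after generalization a rational identity in
   independent variables is left. *)
move: (w3' 1 0 1 Ux) (w3' 1 0 0 Ux) (w3 1 1 0 Ux) (w3 0 1 0 Ux) (ww01 Ux) (A_sym 1 0 Ux)
  (fun c => C_sym c 1 0 Ux) (fun k c => dC_sym k c Ux).
move: (@partial R) (0 : 'I_2) (1 : 'I_2) => P o l E101 E100 E110 E010 E10 A10 C10 D10.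
rewrite E110 E101 E100 E010 E10 !A10 !C10 !D10.
move: (A o o x) (A o l x) (A l l x) (P o w x) (P l w x) => a00 a01 a11 w0 w1.
move: (C o o o x) (C o o l x) (C o l l x) (C l o o x) (C l o l x) (C l l l x) => c000 c001 c011 c100 c101 c111.
move: (P o (P o (P o w)) x) (P o (P o (P l w)) x)
  (P o (P l (P l w)) x) (P l (P l (P l w)) x) => w000 w001 w011 w111.
move: (P o (P o w) x) (P o (P l w) x) (P l (P l w) x) => w00 w01 w11.
move: (P o (C o o o) x) (P o (C o o l) x) (P o (C o l l) x)
  (P o (C l o o) x) (P o (C l o l) x) (P o (C l l l) x) => d0 d1 d2 d3 d4 d5.
move: (P l (C o o o) x) (P l (C o o l) x) (P l (C o l l) x)
  (P l (C l o o) x) (P l (C l o l) x) (P l (C l l l) x) => f0 f1 f2 f3 f4 f5.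
by field.
Qed.

End Bochner.

(** * The Levi-Civita connection and the curvature of a metric in coordinates *)

Section Metric.
Context {R : realType}.
Local Notation V := 'rV[R]_2.
Implicit Types (x y : V) (i j k a b c : 'I_2).

Lemma det_mx2 (F : comRingType) (B : 'M[F]_2) : \det B = B 0 0 * B 1 1 - B 0 1 * B 1 0.
Proof.
rewrite (expand_det_row _ 0) sum_ord2 /cofactor !det_mx11 !mxE /=.
have -> : lift 0 0 = 1 :> 'I_2 by apply: val_inj.
have -> : lift 1 0 = 0 :> 'I_2 by apply: val_inj.
by rewrite /= expr0 expr1 mul1r mulN1r mulrN.
Qed.

Lemma posdef_det (B : 'M[R]_2) : posdef_mx B -> 0 < \det B.
Proof.
move=> pB; have [E /(congr1 determinant)] := orthonormal_frame_ex pB.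
rewrite !det_mulmx det_tr det1 mulrAC -expr2 => E1.
have E0 : \det E != 0.
  by apply: contra_eq_neq E1 => ->; rewrite expr0n mul0r eq_sym oner_eq0.
have E2 : 0 < \det E ^+ 2 by rewrite exprn_even_gt0.
by rewrite -(pmulr_rgt0 _ E2) E1.
Qed.

Lemma frame_det_quot (B H : 'M[R]_2) : posdef_mx B -> frame_det B H = \det H / \det B.
Proof.
move=> pB; have [E oE] := orthonormal_frame_ex pB; rewrite (frame_detE H pB oE).
have /(congr1 determinant) := oE; rewrite !det_mulmx !det_tr det1 => E1.
have B0 : \det B != 0 by rewrite gt_eqF // posdef_det.
by apply: (mulIf B0); rewrite divfK // -[RHS]mulr1 -E1; ring.
Qed.

Variables (G : V -> 'M[R]_2) (U : set V).
Hypotheses (oU : open U) (CG : forall a b (n : nat), Ck n U (fun x => G x a b)).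
Hypothesis pG : forall x, U x -> posdef_mx (G x).

Definition ginv a b x := invmx (G x) a b.
Definition vol x := Num.sqrt (\det (G x)).

Lemma G_sym a b x : U x -> G x a b = G x b a.
Proof. by move=> /pG[sG _]; rewrite -[in LHS]sG mxE. Qed.

Let detG x : U x -> \det (G x) = G x 0 0 * G x 1 1 - G x 0 1 ^+ 2.
Proof. by move=> Ux; rewrite det_mx2 (G_sym 1 0 Ux) expr2. Qed.

Lemma det_gt0 x : U x -> 0 < \det (G x).
Proof. by move=> /pG; exact: posdef_det. Qed.

Lemma ginv_sym a b x : U x -> ginv a b x = ginv b a x.
Proof. by move=> /pG[sG _]; rewrite /ginv -[in LHS]sG -trmx_inv mxE. Qed.

Lemma ginv_mul a b x : U x -> \dsum_c ginv a c x * G x c b = (a == b)%:R.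
Proof.
move=> Ux; have u : G x \in unitmx by rewrite unitmxE unitfE gt_eqF // det_gt0.
have := congr1 (fun B : 'M_2 => B a b) (mulVmx u).
by rewrite !mxE sum_ord2.
Qed.

Lemma ginvE x : U x ->
  [/\ ginv 0 0 x = G x 1 1 / \det (G x), ginv 0 1 x = - G x 0 1 / \det (G x),
      ginv 1 0 x = - G x 0 1 / \det (G x) & ginv 1 1 x = G x 0 0 / \det (G x)].
Proof.
move=> Ux; have d0 : \det (G x) != 0 by rewrite gt_eqF // det_gt0.
pose k a b := (if a == b then (if a == 0 then G x 1 1 else G x 0 0) else - G x 0 1) / \det (G x).
have GK : G x *m (\matrix_(a, b) k a b) = 1%:M.
  apply/matrixP => a b; rewrite !(mxE, sum_ord2) /k; move: (detG Ux) d0.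
  move: (\det (G x)) => d E d0.
  have [->|->] := ord2P a; have [->|->] := ord2P b; rewrite ?(G_sym 1 0 Ux) /=;
    apply: (mulIf d0); rewrite mulrDl -!mulrA !mulVf // ?mulr1 ?mul1r ?mul0r ?E; ring.
have [uG _] := mulmx1_unit GK.
have E : invmx (G x) = \matrix_(a, b) k a b by rewrite -[RHS](mulKmx uG) GK mulmx1.
by split; rewrite /ginv E mxE.
Qed.

Lemma Ck_det n : Ck n U (fun x => \det (G x)).
Proof.
apply: (@eq_on_Ck _ n U (fun x => G x 0 0 * G x 1 1 - G x 0 1 * G x 1 0)) => //.
  by move=> x Ux; rewrite det_mx2.
exact: (CkB oU (CkM oU (CG 0 0 n) (CG 1 1 n)) (CkM oU (CG 0 1 n) (CG 1 0 n))).
Qed.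

Lemma Ck_ginv n a b : Ck n U (ginv a b).
Proof.
have Ci : Ck n U (fun x => (\det (G x))^-1).
  by apply: (CkV oU _ (Ck_det n)) => x Ux; rewrite gt_eqF // det_gt0.
have [->|->] := ord2P a; have [->|->] := ord2P b.
- apply: (eq_on_Ck oU _ (CkM oU (CG 1 1 n) Ci)) => x Ux; by have [-> _ _ _] := ginvE Ux.
- apply: (eq_on_Ck oU _ (CkM oU (CkN oU (CG 0 1 n)) Ci)) => x Ux; by have [_ -> _ _] := ginvE Ux.
- apply: (eq_on_Ck oU _ (CkM oU (CkN oU (CG 0 1 n)) Ci)) => x Ux; by have [_ _ -> _] := ginvE Ux.
- apply: (eq_on_Ck oU _ (CkM oU (CG 0 0 n) Ci)) => x Ux; by have [_ _ _ ->] := ginvE Ux.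
Qed.

Lemma Ck_vol n : Ck n U vol.
Proof. exact: (Ck_sqrt oU det_gt0 (Ck_det n)). Qed.

Lemma vol_gt0 x : U x -> 0 < vol x.
Proof. by move=> Ux; rewrite sqrtr_gt0 det_gt0. Qed.

Let dG k a b x := partial k (fun y => G y a b) x.

Lemma christoffelE c a b x : christoffel G c a b x =
  2^-1 * \dsum_l ginv c l x * (dG a b l x + dG b a l x - dG l a b x).
Proof. by rewrite /christoffel sum_ord2. Qed.

Lemma Ck_christoffel n c a b : Ck n U (christoffel G c a b).
Proof.
have E : christoffel G c a b = (fun x => 2^-1 * (ginv c 0 x * (dG a b 0 x + dG b a 0 x - dG 0 a b x) +
    ginv c 1 x * (dG a b 1 x + dG b a 1 x - dG 1 a b x))).
  by apply/funext => x; rewrite christoffelE.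
rewrite E; have D k d d' : Ck n U (dG k d d') by exact: CkS_partial k (CG d d' n.+1).
have T l : Ck n U (fun x => ginv c l x * (dG a b l x + dG b a l x - dG l a b x)).
  exact: (CkM oU (Ck_ginv n c l) (CkB oU (CkD oU (D _ _ _) (D _ _ _)) (D _ _ _))).
exact: (CkM oU (Ck_cst _ _ _) (CkD oU (T 0) (T 1))).
Qed.

Lemma christoffel_sym c a b x : U x -> christoffel G c a b x = christoffel G c b a x.
Proof.
move=> Ux; rewrite !christoffelE; congr (_ * _); apply: eq_sum2 => l; congr (_ * _).
have -> : dG l a b x = dG l b a x.
  by apply: (eq_on_partial _ oU _ Ux) => y Uy; exact: G_sym.
by rewrite [dG a b l x + _]addrC.
Qed.

(** The Christoffel symbols make the metric parallel: in the sum of the two symbols with lowered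
    index the derivatives other than [dG k a b] cancel in pairs. *)
Lemma partial_metric k a b x : U x -> dG k a b x =
  \dsum_c (christoffel G c k a x * G x c b + christoffel G c k b x * G x a c).
Proof.
move=> Ux.
(* Christoffel symbols of the first kind: lowering the index cancels the inverse metric. *)
have low a' b' : \dsum_c christoffel G c k a' x * G x c b' =
    2^-1 * (dG k a' b' x + dG a' k b' x - dG b' k a' x).
  pose t l := dG k a' l x + dG a' k l x - dG l k a' x.
  transitivity (2^-1 * \dsum_l (\dsum_c ginv l c x * G x c b') * t l).
    under eq_sum2 do rewrite christoffelE.
    rewrite /sum2 (ginv_sym 1 0 Ux) -/(t 0) -/(t 1).
    move: (ginv 0 0 x) (ginv 0 1 x) (ginv 1 1 x) (t 0) (t 1) (G x 0 b') (G x 1 b') => *; ring.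
  congr (_ * _); transitivity (\dsum_l (l == b')%:R * t l).
    by apply: eq_sum2 => l; rewrite ginv_mul.
  rewrite /sum2; have [->|->] := ord2P b'.
    by rewrite /= mul1r mul0r addr0.
  by rewrite /= mul1r mul0r add0r.
transitivity (\dsum_c christoffel G c k a x * G x c b + \dsum_c christoffel G c k b x * G x c a).
  rewrite !low.
  have -> : dG k b a x = dG k a b x by apply: (eq_on_partial _ oU _ Ux) => y Uy; exact: G_sym.
  by move: (dG k a b x) (dG a k b x) (dG b k a x) => p q r; field.
by rewrite /sum2 (G_sym a 0 Ux) (G_sym a 1 Ux); ring.
Qed.

(** Obtained by differentiating the identity that the inverse matrix times [G] is 1, and inserting
    [partial_metric]. *)
Lemma partial_ginv k a b x : U x -> partial k (ginv a b) x =
  - \dsum_c (christoffel G a k c x * ginv c b x + christoffel G b k c x * ginv a c x).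
Proof.
move=> Ux.
have pg a' b' : is_pd k (ginv a' b') x (partial k (ginv a' b') x).
  by apply: is_pd_partial; exact: CkS_diff (Ck_ginv 1 a' b') Ux.
have pG' a' b' : is_pd k (fun y => G y a' b') x (dG k a' b' x).
  by apply: is_pd_partial; exact: CkS_diff (CG a' b' 1) Ux.
have dprod a' b' : \dsum_c (partial k (ginv a' c) x * G x c b' + ginv a' c x * dG k c b' x) = 0.
  have [_ <-] : is_pd k (fun y => \dsum_c ginv a' c y * G y c b') x
    (\dsum_c (partial k (ginv a' c) x * G x c b' + ginv a' c x * dG k c b' x)).
    by apply: is_pd_sum => c; exact: is_pdM (pg a' c) (pG' c b').
  rewrite (@eq_on_partial _ U _ (fun=> (a' == b')%:R) _ _ oU) ?partial_cst //.
  by move=> y Uy; exact: ginv_mul.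
have inv b' c' : \dsum_c G x b' c * ginv c c' x = (b' == c')%:R.
  have u : G x \in unitmx by rewrite unitmxE unitfE gt_eqF // det_gt0.
  have := congr1 (fun B : 'M_2 => B b' c') (mulmxV u).
  by rewrite !mxE sum_ord2.
have key : partial k (ginv a b) x = - \dsum_d (\dsum_c ginv a c x * dG k c d x) * ginv d b x.
  have e d : \dsum_c partial k (ginv a c) x * G x c d = - \dsum_c ginv a c x * dG k c d x.
    by apply/eqP; rewrite -subr_eq0 opprK -(dprod a d) /sum2; apply/eqP; ring.
  transitivity (\dsum_d (\dsum_c partial k (ginv a c) x * G x c d) * ginv d b x).
    transitivity (\dsum_c partial k (ginv a c) x * (\dsum_d G x c d * ginv d b x)).
      transitivity (\dsum_c partial k (ginv a c) x * (c == b)%:R).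
        by rewrite /sum2; have [->|->] := ord2P b; rewrite /= ?mulr0 ?mulr1 ?addr0 ?add0r.
      by apply: eq_sum2 => c; rewrite inv.
    by rewrite /sum2; ring.
  transitivity (\dsum_d (- \dsum_c ginv a c x * dG k c d x) * ginv d b x).
    by apply: eq_sum2 => d; rewrite e.
  by rewrite /sum2; ring.
rewrite key; congr (- _).
transitivity (\dsum_d (\dsum_c ginv a c x * \dsum_e (christoffel G e k c x * G x e d + christoffel G e k d x * G x c e)) * ginv d b x).
  by apply: eq_sum2 => d; congr (_ * _); apply: eq_sum2 => c; rewrite partial_metric.
transitivity (\dsum_c \dsum_e ginv a c x * christoffel G e k c x * (\dsum_d G x e d * ginv d b x)
   + \dsum_d \dsum_e (\dsum_c ginv a c x * G x c e) * christoffel G e k d x * ginv d b x).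
  by rewrite /sum2; ring.
transitivity (\dsum_c \dsum_e ginv a c x * christoffel G e k c x * (e == b)%:R
   + \dsum_d \dsum_e (a == e)%:R * christoffel G e k d x * ginv d b x).
  congr (_ + _); apply: eq_sum2 => c; apply: eq_sum2 => d; first by rewrite inv.
  by rewrite ginv_mul.
move: (christoffel G) ginv => C A; rewrite /sum2.
by have [->|->] := ord2P a; have [->|->] := ord2P b => /=; move: (0 : 'I_2) (1 : 'I_2) => o l; ring.
Qed.

(** Jacobi's formula: the logarithmic derivative of the determinant is twice the trace of the
    Christoffel symbols, and the square root halves it. *)
Lemma partial_vol k x : U x -> partial k vol x = vol x * \dsum_c christoffel G c k c x.
Proof.
move=> Ux.
have pG' a' b' : is_pd k (fun y => G y a' b') x (dG k a' b' x).
  by apply: is_pd_partial; exact: CkS_diff (CG a' b' 1) Ux.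
have pdet : partial k (fun y => \det (G y)) x = 2 * \det (G x) * \dsum_c christoffel G c k c x.
  rewrite (@eq_on_partial _ U _ (fun y => G y 0 0 * G y 1 1 - G y 0 1 * G y 0 1) _ _ oU detG Ux).
  have [_ E] := is_pdB (is_pdM (pG' 0 0) (pG' 1 1)) (is_pdM (pG' 0 1) (pG' 0 1)).
  apply: (etrans E).
  rewrite !partial_metric // detG // /sum2 (G_sym 1 0 Ux); ring.
have d0 := det_gt0 Ux.
have [_ ->] : is_pd k vol x ((2 * vol x)^-1 * partial k (fun y => \det (G y)) x).
  split; first exact: CkS_diff (Ck_vol 1) Ux.
  apply: (@partial_comp1 _ (fun y => \det (G y)) (@Num.sqrt R)).
    exact: CkS_diff (Ck_det 1) Ux.
  exact: is_derive1_sqrt.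
have v0 : vol x != 0 by rewrite gt_eqF // vol_gt0.
have vv : \det (G x) = vol x ^+ 2 by rewrite sqr_sqrtr // ltW.
rewrite pdet vv; move: (vol x) (\dsum_c christoffel G c k c x) v0 => v q h.
have -> : 2 * v ^+ 2 * q = (2 * v) * (v * q) by ring.
by rewrite mulKf // mulf_eq0 negb_or h pnatr_eq0.
Qed.

Lemma riemannE m i j k x : riemann G m i j k x = riem (christoffel G) m i j k x.
Proof. by rewrite /riemann sum_ord2. Qed.

Let R01 a := fun m x => riem (christoffel G) m 0 1 a x.

(** The sum is what [partial_metric] gives for the commutator of [partial 0] and [partial 1] applied
    to the entry [a b] of the metric, which vanishes by the symmetry of second derivatives. *)
Lemma riemann_antisym a b x : U x ->
  \dsum_m (R01 a m x * G x m b + R01 b m x * G x a m) = 0.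
Proof.
move=> Ux.
have pG' k a' b' : is_pd k (fun y => G y a' b') x (dG k a' b' x).
  by apply: is_pd_partial; exact: CkS_diff (CG a' b' 1) Ux.
have pC k c a' b' : is_pd k (christoffel G c a' b') x (partial k (christoffel G c a' b') x).
  by apply: is_pd_partial; exact: CkS_diff (Ck_christoffel 1 c a' b') Ux.
have dd k l : partial k (dG l a b) x = \dsum_c
   ((partial k (christoffel G c l a) x * G x c b + christoffel G c l a x * dG k c b x) +
    (partial k (christoffel G c l b) x * G x a c + christoffel G c l b x * dG k a c x)).
  rewrite (eq_on_partial k oU (partial_metric l a b) Ux).
  have [_ ->] // : is_pd k (fun y => \dsum_c (christoffel G c l a y * G y c b + christoffel G c l b y * G y a c)) x
    (\dsum_c
   ((partial k (christoffel G c l a) x * G x c b + christoffel G c l a x * dG k c b x) +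
    (partial k (christoffel G c l b) x * G x a c + christoffel G c l b x * dG k a c x))).
  apply: is_pd_sum => c; exact: is_pdD (is_pdM (pC _ _ _ _) (pG' _ _ _)) (is_pdM (pC _ _ _ _) (pG' _ _ _)).
have : partial 0 (dG 1 a b) x = partial 1 (dG 0 a b) x := schwarz01 oU (CG a b 2) Ux.
rewrite !dd => /eqP; rewrite -subr_eq0 => /eqP H; rewrite -[RHS]H {H dd pC pG'}.
have pm k' a' b' := partial_metric k' a' b' Ux.
rewrite /R01 /riem /sum2 !pm {pm} /sum2.
move: (G_sym 1 0 Ux) (G_sym a 0 Ux) (G_sym a 1 Ux).
move: (@partial R) (christoffel G) (0 : 'I_2) (1 : 'I_2) => P C o l E0 E1 E2.
rewrite E0 E1 E2; ring.
Qed.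

Variable w : V -> R.
Hypothesis Cw : forall n, Ck n U w.

Lemma hess_coordE x : U x -> hess_coord G w x = \matrix_(a, b) hess (christoffel G) w a b x.
Proof. by move=> Ux; apply/matrixP => a b; rewrite !mxE /hess sum_ord2. Qed.

Lemma frame_det_hess x : U x -> frame_det (G x) (hess_coord G w x) =
  (ginv 0 0 x * ginv 1 1 x - ginv 0 1 x ^+ 2) *
    (hess (christoffel G) w 0 0 x * hess (christoffel G) w 1 1 x -
     hess (christoffel G) w 0 1 x * hess (christoffel G) w 1 0 x).
Proof.
move=> Ux; rewrite frame_det_quot; last exact: pG.
rewrite hess_coordE // det_mx2 !mxE mulrC; congr (_ * _).
have [-> -> _ ->] := ginvE Ux; have d0 : \det (G x) != 0 by rewrite gt_eqF // det_gt0.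
move: (detG Ux) d0; move: (\det (G x)) (G x 0 0) (G x 0 1) (G x 1 1) => d p q r E d0.
have -> : r / d * (p / d) - (- q / d) ^+ 2 = (p * r - q ^+ 2) / d ^+ 2 by field.
by rewrite -E expr2 invfM mulrA divff // mul1r.
Qed.

Lemma norm2_gradE x : U x -> norm2_coord G x (grad_coord G w x) = ipf ginv w w x.
Proof.
move=> Ux; rewrite /norm2_coord /grad_coord.
have u : G x \in unitmx by rewrite unitmxE unitfE gt_eqF // det_gt0.
rewrite -!mulmxA (mulmxA (invmx (G x)) (G x)) mulVmx // mul1mx trmx_mul.
rewrite !(mxE, sum_ord2) /ipf /ginv /sum2.
move: (@partial R) => P; ring.
Qed.

(** The left-hand side is Ric(Dw, Dw). In dimension two, antisymmetry leaves one independent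
    curvature component, here [kd], so the Ricci tensor is the Gaussian curvature times the
    metric. *)
Lemma gauss_curvature_riem x : U x ->
  let u a := gradf ginv w a x in
  let q := \dsum_m R01 0 m x * partial m w x in
  let r := \dsum_m R01 1 m x * partial m w x in
  u 0 * (ginv 0 1 x * q + ginv 1 1 x * r) - u 1 * (ginv 0 0 x * q + ginv 0 1 x * r) =
  gauss_coord G x * ipf ginv w w x.
Proof.
move=> Ux u q r; pose kd := \dsum_m R01 1 m x * G x m 0.
have -> : gauss_coord G x = kd / \det (G x).
  by rewrite /gauss_coord sum_ord2 !riemannE.
have := riemann_antisym 0 0 Ux; have := riemann_antisym 0 1 Ux; have := riemann_antisym 1 1 Ux.
have d0 : \det (G x) != 0 by rewrite gt_eqF // det_gt0.
have [a00 a01 a10 a11] := ginvE Ux.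
rewrite /u /q /r /gradf /ipf /sum2 a00 a01 a10 a11.
have kdE : kd = R01 1 0 x * G x 0 0 + R01 1 1 x * G x 0 1 by rewrite /kd /sum2 (G_sym 1 0 Ux).
move: kd kdE (detG Ux) d0 => kd; rewrite /sum2 (G_sym 1 0 Ux).
move: (partial 0 w x) (partial 1 w x) => w0 w1.
move: (R01 0 0 x) (R01 0 1 x) (R01 1 0 x) (R01 1 1 x) => q0 q1 r0 r1.
move: (\det (G x)) (G x 0 0) (G x 0 1) (G x 1 1) => d g00 g01 g11 kdE dE d0 e11 e01 e00.
(* The antisymmetry relations form linear systems with determinant [d] for the components of the
   curvature; [E1] to [E4] solve them by Cramer's rule. *)
have E1 : r0 * d = g11 * kd.
  rewrite dE kdE.
  have -> : r0 * (g00 * g11 - g01 ^+ 2) = g11 * (r0 * g00 + r1 * g01) - g01 * (r0 * g01 + r1 * g11) by ring.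
  have -> : r0 * g01 + r1 * g11 = 0.
    by apply: (mulfI (_ : (2 : R) != 0)); rewrite ?pnatr_eq0 // mulr0 -e11; ring.
  by rewrite mulr0 subr0.
have E2 : r1 * d = - g01 * kd.
  rewrite dE kdE.
  have -> : r1 * (g00 * g11 - g01 ^+ 2) = g00 * (r0 * g01 + r1 * g11) - g01 * (r0 * g00 + r1 * g01) by ring.
  have -> : r0 * g01 + r1 * g11 = 0.
    by apply: (mulfI (_ : (2 : R) != 0)); rewrite ?pnatr_eq0 // mulr0 -e11; ring.
  by rewrite mulr0 sub0r mulNr.
have e00' : q0 * g00 + q1 * g01 = 0.
  by apply: (mulfI (_ : (2 : R) != 0)); rewrite ?pnatr_eq0 // mulr0 -e00; ring.
have e01' : q0 * g01 + q1 * g11 = - kd.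
  by apply/eqP; rewrite -subr_eq0 opprK kdE -e01; apply/eqP; ring.
have E3 : q0 * d = g01 * kd.
  rewrite dE; have -> : q0 * (g00 * g11 - g01 ^+ 2) = g11 * (q0 * g00 + q1 * g01) - g01 * (q0 * g01 + q1 * g11) by ring.
  by rewrite e00' e01'; ring.
have E4 : q1 * d = - g00 * kd.
  rewrite dE; have -> : q1 * (g00 * g11 - g01 ^+ 2) = g00 * (q0 * g01 + q1 * g11) - g01 * (q0 * g00 + q1 * g01) by ring.
  by rewrite e00' e01'; ring.
have -> : r0 = g11 * kd / d by rewrite -E1 mulfK.
have -> : r1 = - g01 * kd / d by rewrite -E2 mulfK.
have -> : q0 = g01 * kd / d by rewrite -E3 mulfK.
have -> : q1 = - g00 * kd / d by rewrite -E4 mulfK.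
move: d0; rewrite dE => d0.
by field.
Qed.

Definition lapf (f : V -> R) x := divs vol (gradf ginv f) x.

Lemma local_bochner x : U x ->
  lapf w x ^+ 2 + ipf ginv (lapf w) w x - 2^-1 * lapf (ipf ginv w w) x =
  2 * frame_det (G x) (hess_coord G w x) - gauss_coord G x * ipf ginv w w x.
Proof.
move=> Ux; rewrite frame_det_hess // -gauss_curvature_riem //.
have v0 y : U y -> vol y != 0 by move=> Uy; rewrite gt_eqF // vol_gt0.
exact: (bochner oU (Ck_ginv 1) (Ck_christoffel 1) (Ck_vol 1) (Cw 3) ginv_sym
  christoffel_sym partial_ginv partial_vol v0 Ux).
Qed.

Lemma local_weight x : U x ->
  lapf w x * ipf ginv (ipf ginv w w) w x - 2^-1 * ipf ginv (ipf ginv w w) (ipf ginv w w) x =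
  2 * ipf ginv w w x * frame_det (G x) (hess_coord G w x).
Proof.
move=> Ux; rewrite frame_det_hess //.
have v0 y : U y -> vol y != 0 by move=> Uy; rewrite gt_eqF // vol_gt0.
exact: (weight_identity oU (Ck_ginv 1) (Ck_vol 1) (Cw 3) ginv_sym
  christoffel_sym partial_ginv partial_vol v0 Ux).
Qed.

End Metric.

(** * Densities supported in a box *)

Section Boxes.
Context {R : realType}.
Local Notation V := 'rV[R]_2.
Implicit Types (x y z : V) (U : set V) (i j : 'I_2) (r : R).

Definition box x r := rect (x 0 0 - r) (x 0 0 + r) (x 0 1 - r) (x 0 1 + r).

Lemma boxP x r z : box x r z <-> `|z 0 0 - x 0 0| <= r /\ `|z 0 1 - x 0 1| <= r.
Proof.
rewrite /box /rect /= !ler_norml; move: (z 0 0) (z 0 1) (x 0 0) (x 0 1) => a b c d.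
by split=> -[/andP[h1 h2] /andP[h3 h4]]; split; apply/andP; split; lra.
Qed.

Lemma sub_box x r r' : r <= r' -> box x r `<=` box x r'.
Proof. by move=> rr z /boxP[h1 h2]; apply/boxP; split; exact: le_trans rr. Qed.

Lemma open_box U x : open U -> U x -> exists2 r, 0 < r & box x r `<=` U.
Proof.
move=> oU Ux; have /nbhs_ballP[rho /= rho0 B] : nbhs x U by exact: open_nbhs_nbhs.
have r0 : 0 < rho / 2 by rewrite divr_gt0.
have rr : rho / 2 < rho by rewrite ltr_pdivrMr // ltr_pMr // ltr1n.
exists (rho / 2) => // z /boxP[h0 h1]; apply: B; rewrite -ball_normE /= distrC.
by apply: row2_norm_lt => //; rewrite !mxE; [apply: le_lt_trans h0 rr|apply: le_lt_trans h1 rr].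
Qed.

Lemma coord_continuous_sub x i : continuous (fun z : V => `|z 0 i - x 0 i|).
Proof.
move=> z; apply: (@continuous_comp _ _ _ (fun z : V => z 0 i - x 0 i) (fun t : R => `|t|)).
  by apply: (@continuousB _ _ _ (fun z : V => z 0 i) (fun=> x 0 i)); [exact: continuous_coord|exact: cst_continuous].
exact: norm_continuous.
Qed.

Lemma closed_box x r : closed (box x r).
Proof.
have -> : box x r = [set z : V | `|z 0 0 - x 0 0| <= r] `&` [set z : V | `|z 0 1 - x 0 1| <= r].
  by apply/seteqP; split => z; rewrite /= => /boxP.
have cl i : closed [set z : V | `|z 0 i - x 0 i| <= r].
  apply: (@preimage_closed _ _ (fun z : V => `|z 0 i - x 0 i|) [set t : R | t <= r]); last exact: closed_le.
  by move=> z _; exact: coord_continuous_sub.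
exact: closedI.
Qed.

Lemma compact_box x r : compact (box x r).
Proof.
have -> : box x r = (fun p : R * R => mk2 p.1 p.2) @`
   (`[x 0 0 - r, x 0 0 + r] `*` `[x 0 1 - r, x 0 1 + r]).
  apply/seteqP; split => [z [h0 h1]|_ [[s t] [/= hs ht] <-]].
    exists (z 0 0, z 0 1); last exact: mk2E.
    by split; rewrite /= in_itv.
  by rewrite !in_itv /= in hs ht; exact: rect_mk2.
apply: continuous_compact; last by apply: compact_setX; exact: segment_compact.
by apply: continuous_subspaceT; exact: continuous_mk2.
Qed.

Definition ext U (f : V -> R) z : R := if pselect (U z) then f z else 0.

Lemma ext_in U (f : V -> R) z : U z -> ext U f z = f z.
Proof. by rewrite /ext; case: pselect. Qed.

Lemma ext_out U (f : V -> R) z : ~ U z -> ext U f z = 0.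
Proof. by rewrite /ext; case: pselect. Qed.

Lemma bsupp_ext U (f : V -> R) x r :
  (forall z, U z -> f z != 0 -> box x r z) -> bsupp (ext U f) x r.
Proof.
move=> sf z; have [Uz|nUz] := pselect (U z); last by rewrite ext_out ?eqxx.
by rewrite ext_in //; exact: sf.
Qed.

(** The box is closed, so every point has a neighbourhood on which the extension is either [f] or
    0. *)
Lemma Ck_ext n U (f : V -> R) x r : open U -> box x r `<=` U ->
  (forall z, U z -> f z != 0 -> box x r z) -> Ck n U f -> Ck n setT (ext U f).
Proof.
move=> oU BU /bsupp_ext sf Cf; apply: Ck_local => z _.
have [Bz|nBz] := pselect (box x r z).
  by exists U; [exact: BU|apply: (eq_on_Ck oU _ Cf) => y Uy; rewrite ext_in].
exists (~` box x r) => //; apply: (eq_on_Ck _ _ (Ck_cst n _ 0)) => [|y /= nBy].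
  by rewrite openC; exact: closed_box.
by apply/eqP; rewrite eq_sym; apply/negPn/negP => /sf.
Qed.

Lemma plane_int_box (F : V -> R) x r r' : r <= r' -> bsupp F x r ->
  plane_int F = itg2 (x 0 0 - r') (x 0 0 + r') (x 0 1 - r') (x 0 1 + r') F.
Proof. by move=> rr sF; apply: plane_int_rect => z /sF; exact: (sub_box rr). Qed.

Lemma boxle x r : 0 <= r -> x 0 0 - r <= x 0 0 + r /\ x 0 1 - r <= x 0 1 + r.
Proof. by move=> r0; split; rewrite lerD2l (le_trans (y := 0)) ?oppr_le0. Qed.

Lemma plane_int_ge0 (F : V -> R) x r : bsupp F x r -> (forall z, 0 <= F z) -> 0 <= plane_int F.
Proof. by move=> sF F0; rewrite (plane_int_box (lexx r) sF); exact: itg2_ge0. Qed.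

Lemma plane_int_eq0 (F : V -> R) x r : 0 <= r -> bsupp F x r -> Ck 0 setT F ->
  (forall z, 0 <= F z) -> plane_int F = 0 -> forall z, F z = 0.
Proof.
(* [itg2_eq0] speaks of interior points of the rectangle; the larger box has the whole support in
   its interior. *)
move=> r0 sF CF F0; have r1 : r < r + 1 by rewrite ltrDl.
rewrite (plane_int_box (ltW r1) sF) => I0 z; apply/eqP; apply/negPn/negP => /[dup] /sF[h0 h1] /eqP; apply.
have [_ cd] := boxle x (le_trans r0 (ltW r1)).
apply: (itg2_eq0 cd (@openT V) (@subsetT _ _) CF (fun z _ => F0 z) I0).
  by case/andP: h0 => a b; apply/andP; split; lra.
by case/andP: h1 => a b; apply/andP; split; lra.
Qed.

Lemma plane_intD (F H : V -> R) x r : 0 <= r -> bsupp F x r -> bsupp H x r ->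
  Ck 0 setT F -> Ck 0 setT H -> plane_int (fun z => F z + H z) = plane_int F + plane_int H.
Proof.
move=> r0 sF sH CF CH; have [_ cd] := boxle x r0.
rewrite (plane_int_box (lexx r) sF) (plane_int_box (lexx r) sH) -(itg2D cd (@openT V) (@subsetT _ _) CF CH).
apply: (plane_int_box (lexx r)) => z; have [Fz|/sF //] := eqVneq (F z) 0.
by rewrite Fz add0r; exact: sH.
Qed.

Lemma plane_int_sum (I : Type) (s : seq I) (F : I -> V -> R) x r : 0 <= r ->
  (forall a, bsupp (F a) x r) -> (forall a, Ck 0 setT (F a)) ->
  plane_int (fun z => \sum_(a <- s) F a z) = \sum_(a <- s) plane_int (F a).
Proof.
move=> r0 sF CF; elim: s => [|a s IH].
  by rewrite big_nil -[RHS]plane_int0; congr plane_int; apply/funext => z; rewrite big_nil.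
rewrite big_cons -IH -(plane_intD r0 (sF a) _ (CF a)).
- by congr plane_int; apply/funext => z; rewrite big_cons.
- move=> z nz; apply: contrapT => nB; move/eqP: nz; apply; rewrite big1 // => b _.
  by apply/eqP; apply/negPn/negP => /sF.
- exact: (Ck_sum s (@openT _) CF).
Qed.

End Boxes.

(** * Green's formula for the Laplacian in one chart *)

Section Green.
Context {R : realType}.
Local Notation V := 'rV[R]_2.
Implicit Types (x y z : V) (i j : 'I_2) (r : R).
Variables (G : V -> 'M[R]_2) (U : set V).
Hypotheses (oU : open U) (CG : forall (i j : 'I_2) (n : nat), Ck n U (fun x => G x i j)).
Hypothesis pG : forall x, U x -> posdef_mx (G x).

Lemma Ck_gradf n w i : Ck n.+1 U w -> Ck n U (gradf (ginv G) w i).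
Proof.
move=> Cw; have T j : Ck n U (fun x => ginv G i j x * partial j w x).
  exact: (CkM oU (Ck_ginv oU CG pG n i j) (CkS_partial j Cw)).
exact: (CkD oU (T 0) (T 1)).
Qed.

Lemma ipfE (f h : V -> R) x : ipf (ginv G) f h x = \dsum_i partial i f x * gradf (ginv G) h i x.
Proof.
rewrite /ipf /gradf /sum2; move: (@partial R) (ginv G) (0 : 'I_2) (1 : 'I_2) => P A o l; ring.
Qed.

Lemma Ck_ipf n (f h : V -> R) : Ck n.+1 U f -> Ck n.+1 U h -> Ck n U (ipf (ginv G) f h).
Proof.
move=> Cf Ch; have T i : Ck n U (fun x => partial i f x * gradf (ginv G) h i x).
  exact: (CkM oU (CkS_partial i Cf) (Ck_gradf i Ch)).
by apply: (eq_on_Ck oU _ (CkD oU (T 0) (T 1))) => y _; rewrite ipfE.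
Qed.

Lemma Ck_lapf n w : Ck n.+2 U w -> Ck n U (lapf G w).
Proof.
move=> Cw; have T i : Ck n U (partial i (fun y => vol G y * gradf (ginv G) w i y)).
  exact: CkS_partial i (CkM oU (Ck_vol oU CG pG n.+1) (Ck_gradf i Cw)).
apply: (CkM oU (CkD oU (T 0) (T 1))); apply: (CkV oU _ (Ck_vol oU CG pG n)) => x Ux.
by rewrite gt_eqF // (vol_gt0 pG Ux).
Qed.

Lemma green_integrand v w x : Ck 1 U v -> Ck 2 U w -> U x ->
  (v x * lapf G w x + ipf (ginv G) v w x) * vol G x =
  partial 1 (fun y => v y * (vol G y * gradf (ginv G) w 1 y)) x -
  partial 0 (fun y => - (v y * (vol G y * gradf (ginv G) w 0 y))) x.
Proof.
move=> Cv Cw Ux; have dv := CkS_diff Cv Ux.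
have dZ i : differentiable (fun y => vol G y * gradf (ginv G) w i y) x.
  exact: CkS_diff (CkM oU (Ck_vol oU CG pG 1) (Ck_gradf i Cw)) Ux.
have v0 : vol G x != 0 by rewrite gt_eqF // (vol_gt0 pG Ux).
rewrite (partialN 0 (differentiable_mul dv (dZ 0))) (partialM 0 dv (dZ 0)) (partialM 1 dv (dZ 1)).
rewrite ipfE /lapf /divs /sum2.
move: (@partial R) (gradf (ginv G) w) (vol G) (0 : 'I_2) (1 : 'I_2) v0 => P g m o l m0.
have -> : (v x * ((P o (fun y => m y * g o y) x + P l (fun y => m y * g l y) x) / m x) +
  (P o v x * g o x + P l v x * g l x)) * m x =
  v x * (P o (fun y => m y * g o y) x + P l (fun y => m y * g l y) x) * (m x / m x) +
  (P o v x * g o x + P l v x * g l x) * m x by ring.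
rewrite (divff m0); ring.
Qed.

(** The integrand is the coordinate divergence of [v] times the weighted gradient of [w]. As
    [r < r'], [v] vanishes on the sides of the larger box and there is no boundary term. *)
Lemma green_plane v w x r r' : Ck 1 U v -> Ck 2 U w -> 0 <= r < r' -> box x r' `<=` U ->
  (forall z, U z -> v z != 0 -> box x r z) ->
  itg2 (x 0 0 - r') (x 0 0 + r') (x 0 1 - r') (x 0 1 + r')
    (fun z => (v z * lapf G w z + ipf (ginv G) v w z) * vol G z) = 0.
Proof.
move=> Cv Cw /andP[r0 rr] BU sv.
have [ab cd] := boxle x (le_trans r0 (ltW rr)).
have CZ i : Ck 1 U (fun y => v y * (vol G y * gradf (ginv G) w i y)).
  exact: (CkM oU Cv (CkM oU (Ck_vol oU CG pG 1) (Ck_gradf i Cw))).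
rewrite (eq_itg2 (h := fun x => partial 1 (fun y => v y * (vol G y * gradf (ginv G) w 1 y)) x -
  partial 0 (fun y => - (v y * (vol G y * gradf (ginv G) w 0 y))) x)); last first.
  by move=> z /BU Uz; exact: green_integrand.
rewrite (green_rect ab cd oU BU (CZ 1) (CkN oU (CZ 0))).
have v0 z : box x r' z -> ~ box x r z -> v z = 0.
  by move=> /BU Uz nB; apply/eqP; apply/negPn/negP => /(sv _ Uz).
rewrite (@eq_itg _ _ _ _ (fun=> 0)) => [|t ht]; last first.
  have z1 : v (mk2 t (x 0 1 + r')) = 0.
    apply: v0; first by apply: rect_mk2 => //; rewrite lexx cd.
    by move=> [_]; rewrite mk21 => /andP[_]; rewrite lerD2l leNgt rr.
  have z2 : v (mk2 t (x 0 1 - r')) = 0.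
    apply: v0; first by apply: rect_mk2 => //; rewrite lexx cd.
    by move=> [_]; rewrite mk21 => /andP[+ _]; rewrite lerD2l lerN2 leNgt rr.
  by rewrite z1 z2 !mul0r subrr.
rewrite (@eq_itg _ _ _ (fun t => _ - _) (fun=> 0)) => [|t ht]; last first.
  have z1 : v (mk2 (x 0 0 + r') t) = 0.
    apply: v0; first by apply: rect_mk2 => //; rewrite lexx ab.
    by move=> [+ _]; rewrite mk20 => /andP[_]; rewrite lerD2l leNgt rr.
  have z2 : v (mk2 (x 0 0 - r') t) = 0.
    apply: v0; first by apply: rect_mk2 => //; rewrite lexx ab.
    by move=> [+ _]; rewrite mk20 => /andP[+ _]; rewrite lerD2l lerN2 leNgt rr.
  by rewrite z1 z2 !mul0r subrr.
by rewrite !itg0 subrr.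
Qed.

End Green.

(** * Transformation of gradients and Laplacians between two charts *)

Section TwoCharts.
Context {R : realType}.
Local Notation V := 'rV[R]_2.
Implicit Types (x y z : V) (i j : 'I_2) (f h w : V -> R).
Variables (G H : V -> 'M[R]_2) (U U' : set V) (tau : V -> V).
Hypotheses (oU : open U) (CG : forall (i j : 'I_2) (n : nat), Ck n U (fun x => G x i j)).
Hypothesis pG : forall x, U x -> posdef_mx (G x).
Hypotheses (oU' : open U') (CH : forall (i j : 'I_2) (n : nat), Ck n U' (fun x => H x i j)).
Hypothesis pH : forall x, U' x -> posdef_mx (H x).
Hypotheses (Ct : forall (n : nat) (i : 'I_2), Ck n U (fun x => tau x 0 i)).
Hypothesis tU : forall x, U x -> U' (tau x).
Hypothesis GH : forall x, U x ->
  G x = jacobian_mx tau x *m H (tau x) *m (jacobian_mx tau x)^T.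

Let J i j x := partial i (fun y => tau y 0 j) x.

Lemma det_jacobian x : \det (jacobian_mx tau x) = jdet tau x.
Proof. by rewrite det_mx2 !mxE /jdet; congr (_ - _); rewrite mulrC. Qed.

Lemma det_compat x : U x -> \det (G x) = jdet tau x ^+ 2 * \det (H (tau x)).
Proof.
by move=> Ux; rewrite GH // !det_mulmx det_tr det_jacobian mulrAC expr2.
Qed.

Lemma jdet_neq0 x : U x -> jdet tau x != 0.
Proof.
move=> Ux; apply/eqP => J0; have := det_gt0 pG Ux.
by rewrite (det_compat Ux) J0 expr0n mul0r ltxx.
Qed.

Lemma vol_compat x : U x -> vol G x = `|jdet tau x| * vol H (tau x).
Proof. by move=> Ux; rewrite /vol (det_compat Ux) sqrtrM ?sqr_ge0 // sqrtr_sqr. Qed.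

Lemma partial_tau f i x : U x -> differentiable f (tau x) ->
  partial i (f \o tau) x = \dsum_j partial j f (tau x) * J i j x.
Proof.
move=> Ux df; apply: (@partial_comp _ f tau x i _ df) => c; exact: CkS_diff (Ct 1 c) Ux.
Qed.

Lemma invmx_congr (A B : 'M[R]_2) : A \in unitmx -> B \in unitmx ->
  A^T *m invmx (A *m B *m A^T) *m A = invmx B.
Proof.
move=> uA uB; have uN : A *m B *m A^T \in unitmx by rewrite !unitmx_mul uA uB unitmx_tr.
apply: (can_inj (mulKmx uB)); apply: (can_inj (mulKmx uA)).
by rewrite !mulmxA (mulmxV uN) mul1mx -[RHS]mulmxA (mulmxV uB) mulmx1.
Qed.

Lemma gradf_compat f j x : U x -> differentiable f (tau x) ->
  \dsum_i J i j x * gradf (ginv G) (f \o tau) i x = gradf (ginv H) f j (tau x).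
Proof.
move=> Ux df.
have uJ : jacobian_mx tau x \in unitmx by rewrite unitmxE det_jacobian unitfE (jdet_neq0 Ux).
have uH : H (tau x) \in unitmx by rewrite unitmxE unitfE gt_eqF // (det_gt0 pH (tU Ux)).
have := congr1 (fun A : 'M_2 => (A *m (\col_i partial i f (tau x))) j 0) (invmx_congr uJ uH).
rewrite -GH // /gradf /sum2 !(partial_tau _ Ux df) /ginv.
rewrite !(mxE, sum_ord2) /sum2 -/(J _ _ _) => <-.
rewrite ?mxE /J; move: (@partial R) (0 : 'I_2) (1 : 'I_2) (invmx (G x)) => P o l B; ring.
Qed.

Lemma ipf_compat f h x : U x -> differentiable f (tau x) -> differentiable h (tau x) ->
  ipf (ginv G) (f \o tau) (h \o tau) x = ipf (ginv H) f h (tau x).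
Proof.
move=> Ux df dh; rewrite !ipfE.
transitivity (\dsum_j partial j f (tau x) * (\dsum_i J i j x * gradf (ginv G) (h \o tau) i x)).
  rewrite /sum2 !(partial_tau _ Ux df) /sum2.
  move: (@partial R) (gradf (ginv G)) J (0 : 'I_2) (1 : 'I_2) => P g K o l; ring.
by apply: eq_sum2 => j; rewrite (gradf_compat j Ux dh).
Qed.

(** Cramer's rule applied to [gradf_compat]. The cofactors appear exactly as in [piola]. *)
Lemma gradf_cofactor f x : U x -> differentiable f (tau x) ->
  jdet tau x * gradf (ginv G) (f \o tau) 0 x =
    gradf (ginv H) f 0 (tau x) * J 1 1 x - gradf (ginv H) f 1 (tau x) * J 1 0 x /\
  jdet tau x * gradf (ginv G) (f \o tau) 1 x =
    - (gradf (ginv H) f 0 (tau x) * J 0 1 x) + gradf (ginv H) f 1 (tau x) * J 0 0 x.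
Proof.
move=> Ux df; rewrite -!(gradf_compat _ Ux df) /sum2 /jdet -!/(J _ _ _).
move: (gradf (ginv G)) J (0 : 'I_2) (1 : 'I_2) => g K o l; split; ring.
Qed.

(** By [vol_compat] and [gradf_cofactor] the weighted gradient in one chart is the cofactor
    transform of the one in the other chart, up to the sign of the Jacobian; [piola] then compares
    the divergences. *)
Lemma lapf_compat w x : U x -> Ck 2 U' w -> lapf G (w \o tau) x = lapf H w (tau x).
Proof.
move=> Ux Cw; have J0 := jdet_neq0 Ux.
(* The sign of the Jacobian is constant near [x], so its absolute value is locally the
   differentiable function [s * jdet tau]. *)
have [s [s1 sJ]] := sg_cases J0.
have cJ : Ck 0 U (fun y => s * jdet tau y) by exact: (CkM oU (Ck_cst 0 U s) (Ck_jdet oU (Ct 1))).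
have : \forall y \near x, U y /\ 0 < s * jdet tau y.
  have sJ0 : 0 < s * jdet tau x by rewrite sJ normr_gt0.
  by near=> y; split; near: y; [exact: open_nbhs_nbhs|exact: (cvgr_gt _ (cJ x Ux))].
rewrite /prop_near1 nbhsE => -[W [oW Wx] sW].
pose A j y := s * (vol H y * gradf (ginv H) w j y).
have CA j : Ck 1 U' (A j).
  exact: (CkM oU' (Ck_cst 1 U' s) (CkM oU' (Ck_vol oU' CH pH 1) (Ck_gradf oU' CH pH j Cw))).
have CB j : Ck 1 U' (fun y => vol H y * gradf (ginv H) w j y).
  exact: (CkM oU' (Ck_vol oU' CH pH 1) (Ck_gradf oU' CH pH j Cw)).
have volW y : W y -> vol G y = s * jdet tau y * vol H (tau y).
  move=> /sW[Uy sy]; rewrite (vol_compat Uy); congr (_ * _).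
  by rewrite -(gtr0_norm sy) normrM; case: s1 => ->; rewrite ?normrN normr1 mul1r.
have dw y : W y -> differentiable w (tau y) by move=> /sW[Uy _]; exact: CkS_diff Cw (tU Uy).
have E0 : partial 0 (fun y => vol G y * gradf (ginv G) (w \o tau) 0 y) x =
   partial 0 (fun y => A 0 (tau y) * partial 1 (fun y => tau y 0 1) y - A 1 (tau y) * partial 1 (fun y => tau y 0 0) y) x.
  apply: (eq_on_partial _ oW _ Wx) => y Wy.
  have [e0 _] := gradf_cofactor (proj1 (sW _ Wy)) (dw _ Wy).
  rewrite (volW _ Wy) mulrAC -[s * _ * _]mulrA e0 /A /J.
  move: (@partial R) (gradf (ginv H)) (0 : 'I_2) (1 : 'I_2) => P g o l; ring.
have E1 : partial 1 (fun y => vol G y * gradf (ginv G) (w \o tau) 1 y) x =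
   partial 1 (fun y => - (A 0 (tau y) * partial 0 (fun y => tau y 0 1) y) + A 1 (tau y) * partial 0 (fun y => tau y 0 0) y) x.
  apply: (eq_on_partial _ oW _ Wx) => y Wy.
  have [_ e1] := gradf_cofactor (proj1 (sW _ Wy)) (dw _ Wy).
  rewrite (volW _ Wy) mulrAC -[s * _ * _]mulrA e1 /A /J.
  move: (@partial R) (gradf (ginv H)) (0 : 'I_2) (1 : 'I_2) => P g o l; ring.
rewrite [LHS]/lapf /divs [X in X / _]/sum2 E0 E1 (piola oU Ux (Ct 2) (CkS_diff (CA 0) (tU Ux)) (CkS_diff (CA 1) (tU Ux))).
have dA j : partial j (A j) (tau x) = s * partial j (fun y => vol H y * gradf (ginv H) w j y) (tau x).
  rewrite (partialM j (@differentiable_cst _ _ _ s (tau x)) (CkS_diff (CB j) (tU Ux))).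
  by rewrite (partial_cst s j) /= mulr0 addr0.
rewrite !dA (volW _ Wx) /lapf /divs /sum2 -mulrDr mulrA [jdet _ _ * s]mulrC.
rewrite invfM mulrACA divff ?mul1r // mulf_neq0 //.
by case: s1 => ->; rewrite ?oppr_eq0 oner_eq0.
Unshelve. all: by end_near. Qed.

End TwoCharts.

(** * Functions on the surface *)

Section Locality.
Context {R : realType}.
Local Notation V := 'rV[R]_2.
Implicit Types (x y z : V) (f h w : V -> R).

Lemma eq_on_ipf (A : 'I_2 -> 'I_2 -> V -> R) W f f' h h' x : open W -> W x ->
  (forall y, W y -> f y = f' y) -> (forall y, W y -> h y = h' y) ->
  ipf A f h x = ipf A f' h' x.
Proof.
move=> oW Wx Ef Eh; apply: eq_sum2 => a; apply: eq_sum2 => b.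
by rewrite (eq_on_partial a oW Ef Wx) (eq_on_partial b oW Eh Wx).
Qed.

Lemma eq_on_lapf (G : V -> 'M[R]_2) W w w' x : open W -> W x ->
  (forall y, W y -> w y = w' y) -> lapf G w x = lapf G w' x.
Proof.
move=> oW Wx E.
have EZ a y : W y -> vol G y * gradf (ginv G) w a y = vol G y * gradf (ginv G) w' a y.
  move=> Wy; apply: (congr1 (fun t : R => vol G y * t)); apply: eq_sum2 => b.
  exact: (congr1 (fun t : R => ginv G a b y * t) (eq_on_partial b oW E Wy)).
have EP a : partial a (fun y => vol G y * gradf (ginv G) w a y) x =
  partial a (fun y => vol G y * gradf (ginv G) w' a y) x := eq_on_partial a oW (EZ a) Wx.
exact: (congr1 (fun t : R => t / vol G x) (eq_sum2 EP)).
Qed.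

Lemma nbhs_box x (r : R) : 0 < r -> nbhs x (box x r).
Proof.
move=> r0; apply/nbhs_ballP; exists r => // z; rewrite -ball_normE /= => /ltW xz.
by apply/boxP; split; rewrite distrC; have := le_coord_norm (x - z) 0;
  have := le_coord_norm (x - z) 1; rewrite !mxE => h1 h0; [exact: le_trans h0 xz|exact: le_trans h1 xz].
Qed.

End Locality.

Section Charts.
Context {R : realType} {M : topologicalType} (S : smooth_surface R M).
Variable g : riemannian_metric S.
Local Notation V := 'rV[R]_2.
Implicit Types (x y z : V) (p q : M) (f h v w : M -> R) (i j : atlas S) (n : nat).

Definition cod i : set V := chart i @` dom i.
Definition overlap i j : set V := chart i @` (dom i `&` dom j).

Lemma open_cod i : open (cod i). Proof. exact: codom_open. Qed.

Lemma cod_dom i x : cod i x -> dom i (param i x).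
Proof. by move=> [p ip <-]; rewrite chartK. Qed.

Lemma paramK i x : cod i x -> chart i (param i x) = x.
Proof. by move=> [p ip <-]; rewrite chartK. Qed.

Lemma chart_cod i p : dom i p -> cod i (chart i p).
Proof. by move=> ip; exists p. Qed.

Lemma chart_continuous i p : dom i p -> {for p, continuous (chart i)}.
Proof.
move=> ip; have := @chart_cont _ _ S i; rewrite continuous_open_subspace; last exact: dom_open.
by apply; rewrite inE.
Qed.

Lemma param_continuous i x : cod i x -> {for x, continuous (param i)}.
Proof.
move=> ix; have := @param_cont _ _ S i; rewrite continuous_open_subspace; last exact: codom_open.
by apply; rewrite inE.
Qed.

Lemma open_param_preimage i (N : set M) : open N -> open (cod i `&` param i @^-1` N).
Proof.
move=> oN; rewrite openE => x [ix Nx]; rewrite /interior; apply: filterI.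
  by apply: open_nbhs_nbhs; split=> //; exact: open_cod.
by apply: (param_continuous ix); exact: open_nbhs_nbhs.
Qed.

Lemma overlapE i j : overlap i j = cod i `&` param i @^-1` dom j.
Proof.
apply/seteqP; split => [_ [p [ip jp] <-]|x [ix jx]].
  by split; [exists p|rewrite /= chartK].
by exists (param i x); [split=> //; exact: cod_dom|exact: paramK].
Qed.

Lemma open_overlap i j : open (overlap i j).
Proof. by rewrite overlapE; apply: open_param_preimage; exact: dom_open. Qed.

Arguments open_cod : clear implicits.
Arguments open_overlap : clear implicits.

Lemma overlap_cod i j x : overlap i j x -> cod i x.
Proof. by rewrite overlapE => -[]. Qed.

Lemma overlap_transition i j x : overlap i j x ->
  cod j (transition i j x) /\ param j (transition i j x) = param i x.
Proof.
rewrite overlapE => -[ix jx]; split; first exact: chart_cod.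
by rewrite /transition chartK.
Qed.

Lemma Ck_transition n i j (c : 'I_2) : Ck n (overlap i j) (fun x => transition i j x 0 c).
Proof. exact: (smooth_on_Ck (open_overlap i j) (@transition_smooth _ _ S i j c) n). Qed.

Lemma Ck_gmat i (a b : 'I_2) n : Ck n (cod i) (fun x => gmat g i x a b).
Proof. exact: (smooth_on_Ck (open_cod i) (@gmat_smooth _ _ S g i a b) n). Qed.

Lemma posdef_gmat i x : cod i x -> posdef_mx (gmat g i x).
Proof. exact: gmat_posdef. Qed.

Definition CM n f := forall i, Ck n (cod i) (f \o param i).

Lemma CM_smooth n f : smooth_fun S f -> CM n f.
Proof. by move=> sf i; exact: smooth_on_Ck (open_cod i) (sf i) n. Qed.

Lemma CM_le n m f : (n <= m)%N -> CM m f -> CM n f.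
Proof. by move=> nm Cf i; exact: Ck_le nm (Cf i). Qed.

Lemma CM_cst n (c : R) : CM n (fun=> c).
Proof. by move=> i; exact: Ck_cst. Qed.

Lemma CM_add n f h : CM n f -> CM n h -> CM n (fun p => f p + h p).
Proof. by move=> Cf Ch i; exact: CkD (open_cod i) (Cf i) (Ch i). Qed.

Lemma CM_mul n f h : CM n f -> CM n h -> CM n (fun p => f p * h p).
Proof. by move=> Cf Ch i; exact: CkM (open_cod i) (Cf i) (Ch i). Qed.

Lemma CM_opp n f : CM n f -> CM n (fun p => - f p).
Proof. by move=> Cf i; exact: CkN (open_cod i) (Cf i). Qed.

Lemma CM_inv n f : (forall p, f p != 0) -> CM n f -> CM n (fun p => (f p)^-1).
Proof. by move=> f0 Cf i; apply: (CkV (open_cod i) _ (Cf i)) => x _; exact: f0. Qed.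

Lemma CM_sum n (I : Type) (s : seq I) (F : I -> M -> R) : (forall a, CM n (F a)) ->
  CM n (fun p => \sum_(a <- s) F a p).
Proof. by move=> CF i; exact: (Ck_sum s (open_cod i) (fun a => CF a i)). Qed.

Lemma CM_continuous f : CM 0 f -> continuous f.
Proof.
move=> Cf p; pose i := chart_at S p; have ip : dom i p by exact: chart_at_dom.
have c : {for p, continuous ((f \o param i) \o chart i)}.
  apply: continuous_comp; first exact: chart_continuous.
  by apply: Cf; exact: chart_cod.
have E : \forall p' \near p, ((f \o param i) \o chart i) p' = f p'.
  apply: (@filterS _ _ _ (dom i)) => [p' ip'|]; first by rewrite /= chartK.
  by apply: open_nbhs_nbhs; split=> //; exact: dom_open.
rewrite /continuous_at; apply: cvg_trans (near_eq_cvg E) _.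
by have := c; rewrite /prop_for /continuous_at /= chartK.
Qed.

Lemma param_transition f i j x : overlap i j x ->
  (f \o param i) x = ((f \o param j) \o transition i j) x.
Proof. by move=> /overlap_transition[_ E]; rewrite /= E. Qed.

Definition ipM f h p := let i := chart_at S p in
  ipf (ginv (gmat g i)) (f \o param i) (h \o param i) (chart i p).

Definition lapM w p := let i := chart_at S p in lapf (gmat g i) (w \o param i) (chart i p).

Lemma ipM_param i f h x : CM 1 f -> CM 1 h -> cod i x ->
  ipM f h (param i x) = ipf (ginv (gmat g i)) (f \o param i) (h \o param i) x.
Proof.
move=> Cf Ch ix; set p := param i x; rewrite /ipM; set j := chart_at S p.
have ox : overlap i j x by rewrite overlapE; split=> //; exact: chart_at_dom.
have jt : forall y, overlap i j y -> cod j (transition i j y) by move=> y /overlap_transition[].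
rewrite (eq_on_ipf _ (open_overlap i j) ox (@param_transition f i j) (@param_transition h i j)).
symmetry; apply: (ipf_compat (fun y yo => posdef_gmat (overlap_cod yo)) (@posdef_gmat j) (fun n => @Ck_transition n i j) jt _ ox).
- by move=> y; exact: gmat_compat.
- exact: CkS_diff (Cf j) (jt _ ox).
- exact: CkS_diff (Ch j) (jt _ ox).
Qed.

Lemma lapM_param i w x : CM 2 w -> cod i x ->
  lapM w (param i x) = lapf (gmat g i) (w \o param i) x.
Proof.
move=> Cw ix; set p := param i x; rewrite /lapM; set j := chart_at S p.
have ox : overlap i j x by rewrite overlapE; split=> //; exact: chart_at_dom.
have jt : forall y, overlap i j y -> cod j (transition i j y) by move=> y /overlap_transition[].
rewrite (eq_on_lapf _ (open_overlap i j) ox (@param_transition w i j)).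
symmetry; apply: (lapf_compat (open_overlap i j) (fun y yo => posdef_gmat (overlap_cod yo))
  (open_cod j) (@Ck_gmat j) (@posdef_gmat j) (fun n => @Ck_transition n i j) jt _ ox (Cw j)).
by move=> y; exact: gmat_compat.
Qed.

Lemma CM_ip n f h : CM n.+1 f -> CM n.+1 h -> CM n (ipM f h).
Proof.
move=> Cf Ch i; have C1 k : CM n.+1 k -> CM 1 k by exact: CM_le.
apply: (eq_on_Ck (open_cod i) _ (Ck_ipf (open_cod i) (@Ck_gmat i) (@posdef_gmat i) (Cf i) (Ch i))).
by move=> x ix; rewrite /= (ipM_param (C1 _ Cf) (C1 _ Ch) ix).
Qed.

Lemma CM_lap n w : CM n.+2 w -> CM n (lapM w).
Proof.
move=> Cw i; have C2 : CM 2 w by exact: CM_le Cw.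
apply: (eq_on_Ck (open_cod i) _ (Ck_lapf (open_cod i) (@Ck_gmat i) (@posdef_gmat i) (Cw i))).
by move=> x ix; rewrite /= (lapM_param C2 ix).
Qed.

End Charts.

Arguments open_cod {R M S} i.
Arguments open_overlap {R M S} i j.

(** * Integration on the surface *)

Section Pushforward.
Context {R : realType} {M : topologicalType} (S : smooth_surface R M).
Variable g : riemannian_metric S.
Local Notation V := 'rV[R]_2.
Implicit Types (x y z : V) (p q : M) (f h v w : M -> R) (i j : atlas S) (n : nat) (r : R).

Definition pbox i q r : set M := param i @` box (chart i q) r.

(** The density of [h] in the chart, extended by zero to the whole plane. *)
Definition push i h : V -> R := ext (cod i) (fun x => h (param i x) * vol (gmat g i) x).

(** A coordinate box is compact, and compact sets are closed because the surface is Hausdorff. *)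
Lemma closed_pbox i q r : box (chart i q) r `<=` cod i -> closed (pbox i q r).
Proof.
move=> Bi; apply: compact_closed; first exact: surf_hausdorff S.
apply: continuous_compact; last exact: compact_box.
by apply: continuous_subspaceW Bi _; exact: param_cont.
Qed.

Lemma pbox_dom i q r p : box (chart i q) r `<=` cod i -> pbox i q r p ->
  dom i p /\ box (chart i q) r (chart i p).
Proof.
move=> Bi [x Bx <-]; split; first by apply: cod_dom; exact: Bi.
by rewrite paramK //; exact: Bi.
Qed.

Lemma pbox_param i q r x : box (chart i q) r `<=` cod i -> cod i x ->
  pbox i q r (param i x) -> box (chart i q) r x.
Proof. by move=> Bi ix /(pbox_dom Bi)[_]; rewrite paramK. Qed.

(** The doubled box leaves the margin around the support that [green_plane] asks for. *)
Lemma pbox_nbhd i q (N : set M) : dom i q -> nbhs q N ->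
  exists r, [/\ 0 < r, box (chart i q) (2 * r) `<=` cod i & pbox i q r `<=` N].
Proof.
move=> iq; rewrite nbhsE => -[W [oW Wq] WN].
have [r r0 B] : exists2 r, 0 < r & box (chart i q) r `<=` cod i `&` param i @^-1` W.
  apply: (open_box (open_param_preimage oW)); split; first exact: chart_cod.
  by rewrite /= chartK.
have rr : 2 * (r / 2) = r by rewrite mulrCA divff ?mulr1 // pnatr_eq0.
exists (r / 2); split; first by rewrite divr_gt0.
  by rewrite rr => x /B[].
move=> _ [x Bx <-]; apply: WN.
have r2 : r / 2 <= r by rewrite ler_pdivrMr // ler_pMr // ler1n.
by have [] := B x (sub_box r2 Bx).
Qed.

(** Regularity in one chart suffices: outside the domain of that chart, [f] vanishes near each point
    because [pbox i q r] is closed in the whole surface. *)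
Lemma CM_supported n i q r f : box (chart i q) r `<=` cod i ->
  (forall p, f p != 0 -> pbox i q r p) -> Ck n (cod i) (f \o param i) -> CM S n f.
Proof.
move=> Bi sf Cf j; apply: Ck_local => x jx.
have [ip|nip] := pselect (dom i (param j x)).
  exists (overlap j i); first by rewrite overlapE.
  apply: (@eq_on_Ck _ n _ ((f \o param i) \o transition j i) _ (open_overlap j i)).
    by move=> y yo; exact: esym (param_transition f yo).
  apply: (Ck_comp (open_overlap j i) (Ck_transition n j i) _ Cf) => y.
  by move=> /overlap_transition[].
have oC : open (~` pbox i q r) by rewrite openC; exact: closed_pbox.
exists (cod j `&` param j @^-1` (~` pbox i q r)).
  by split=> // /(pbox_dom Bi)[].
apply: (eq_on_Ck (open_param_preimage oC) _ (Ck_cst n _ 0)) => y [_ nB].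
by apply/eqP; rewrite eq_sym; apply/negPn/negP => /sf.
Qed.

Lemma bsupp_push i q r h : box (chart i q) r `<=` cod i ->
  (forall p, h p != 0 -> pbox i q r p) -> bsupp (push i h) (chart i q) r.
Proof.
move=> Bi sh; apply: bsupp_ext => x ix; rewrite mulf_eq0 negb_or => /andP[/sh + _].
exact: pbox_param.
Qed.

Lemma Ck_push n i q r h : box (chart i q) r `<=` cod i ->
  (forall p, h p != 0 -> pbox i q r p) -> CM S n h -> Ck n setT (push i h).
Proof.
move=> Bi sh Ch; apply: (Ck_ext (open_cod i) Bi).
  move=> x ix; rewrite mulf_eq0 negb_or => /andP[/sh + _]; exact: pbox_param.
exact: (CkM (open_cod i) (Ch i) (Ck_vol (open_cod i) (Ck_gmat g i) (@posdef_gmat _ _ _ g i) n)).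
Qed.

Lemma push_ge0 i h : (forall p, 0 <= h p) -> forall x, 0 <= push i h x.
Proof.
move=> h0 x; have [ix|nix] := pselect (cod i x); last by rewrite /push ext_out.
by rewrite /push ext_in // mulr_ge0 // ltW // (vol_gt0 (@posdef_gmat _ _ _ g i) ix).
Qed.

Lemma push_sum i (I : Type) (s : seq I) (F : I -> M -> R) :
  push i (fun p => \sum_(a <- s) F a p) = (fun x => \sum_(a <- s) push i (F a) x).
Proof.
apply/funext => x; have [ix|nix] := pselect (cod i x).
  by rewrite /push ext_in // mulr_suml; apply: eq_bigr => a _; rewrite ext_in.
by rewrite /push ext_out // big1 // => a _; rewrite ext_out.
Qed.

Lemma push0 i : push i (fun=> 0) = (fun=> 0).
Proof.
apply/funext => x; have [ix|nix] := pselect (cod i x); last by rewrite /push ext_out.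
by rewrite /push ext_in // mul0r.
Qed.

(** Off the closed set [C] the function [v] vanishes on an open set, and its derivatives with it. *)
Lemma supp_green (C : set M) v w p : closed C -> (forall p, v p != 0 -> C p) ->
  v p * lapM g w p + ipM g v w p != 0 -> C p.
Proof.
move=> cC sv; apply: contraNP => nC; apply/eqP.
have v0 p' : ~ C p' -> v p' = 0.
  by move=> nC'; apply/eqP; apply/negPn/negP => /sv.
rewrite (v0 _ nC) mul0r add0r /ipM; set i := chart_at S p.
have ip : dom i p by exact: chart_at_dom.
have oC : open (~` C) by rewrite openC.
rewrite (eq_on_ipf _ (W := cod i `&` param i @^-1` (~` C)) (f' := fun=> 0)
  (h' := w \o param i) (open_param_preimage oC)) => [||y [_ /v0 //]|//]; last first.
  by split; [exact: chart_cod|rewrite /= chartK].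
by rewrite /ipf /sum2 !(partial_cst 0) /= !(mulr0, mul0r, addr0).
Qed.

Lemma green_chart i q r v w : 0 < r -> box (chart i q) (2 * r) `<=` cod i ->
  (forall p, v p != 0 -> pbox i q r p) -> CM S 1 v -> CM S 2 w ->
  plane_int (push i (fun p => v p * lapM g w p + ipM g v w p)) = 0.
Proof.
move=> rp B2 sv Cv Cw.
have r2 : r < 2 * r by rewrite mulr_natl mulr2n ltrDl.
have Bi : box (chart i q) r `<=` cod i by move=> x /(sub_box (ltW r2)) /B2.
have sh p : v p * lapM g w p + ipM g v w p != 0 -> pbox i q r p.
  exact: (supp_green (closed_pbox Bi) sv).
rewrite (plane_int_box (ltW r2) (bsupp_push Bi sh)).
rewrite -[RHS](green_plane (open_cod i) (Ck_gmat g i) (@posdef_gmat _ _ _ g i) (Cv i) (Cw i) (r := r) (r' := 2 * r) (x := chart i q)).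
- apply: eq_itg2 => x /B2 ix; rewrite /push ext_in //.
  by rewrite (lapM_param g Cw ix) (ipM_param g Cv (CM_le _ Cw) ix).
- by rewrite ltW.
- exact: B2.
- by move=> x ix /sv; exact: pbox_param.
Qed.

(** [local_cov] for the transition map, with [N] so small that its image in chart [i] lies in the
    rectangle given by that lemma and its image in chart [j] within the required distance [eta]. By
    [vol_compat] the Jacobian factor is the ratio of the volume densities. *)
Lemma cov_nbhd i j q : dom i q -> dom j q -> exists2 N, nbhs q N &
  forall h, CM S 1 h -> (forall p, h p != 0 -> N p) ->
  plane_int (push i h) = plane_int (push j h).
Proof.
move=> iq jq; set x0 := chart i q; set y0 := chart j q.
have ox0 : overlap i j x0 by exists q.
have jt : forall y, overlap i j y -> cod j (transition i j y) by move=> y /overlap_transition[].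
have pO : forall y, overlap i j y -> posdef_mx (gmat g i y).
  by move=> y yo; exact: posdef_gmat (overlap_cod yo).
have GH : forall y, overlap i j y -> gmat g i y = jacobian_mx (transition i j) y *m gmat g j (transition i j y) *m (jacobian_mx (transition i j) y)^T.
  by move=> y; exact: gmat_compat.
have J0 := jdet_neq0 pO GH ox0.
have [r [s [eta [r0 s0 e0 BU cov]]]] := local_cov (open_overlap i j) ox0 (Ck_transition 2 i j) J0.
have ty : transition i j x0 = y0 by rewrite /transition chartK.
have [rho1 rho10 Bj1] := open_box (open_cod j) (chart_cod jq).
(* [rho1] keeps the box in the image of chart [j], and [eta] makes [local_cov] applicable. *)
pose rho := Num.min rho1 eta.
have rho0 : 0 < rho by rewrite lt_min rho10 e0.
have Bj : box y0 rho `<=` cod j.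
  by move=> z Bz; apply: Bj1; apply: sub_box Bz; rewrite ge_min lexx.
pose m := Num.min r s.
have m0 : 0 < m by rewrite lt_min r0 s0.
exists (dom i `&` dom j `&` (chart i @^-1` box x0 m `&` chart j @^-1` box y0 rho)).
  apply: filterI.
    by apply: filterI; apply: open_nbhs_nbhs; split=> //; exact: dom_open.
  by apply: filterI; [apply: (chart_continuous iq)|apply: (chart_continuous jq)]; exact: nbhs_box.
move=> h Ch sh.
have sj p : h p != 0 -> pbox j q rho p.
  move=> /sh[[ip jp] [_ Bp]]; exists (chart j p) => //; exact: chartK.
have eb : bsupp (push j h) (transition i j x0) eta.
  rewrite ty => z /(bsupp_push Bj sj); apply: sub_box.
  by rewrite ge_min lexx orbT.
rewrite -(cov _ (Ck_push Bj sj Ch) eb).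
rewrite (plane_int_rect (a := x0 0 0 - r) (b := x0 0 0 + r) (c := x0 0 1 - s) (d := x0 0 1 + s)).
  apply: eq_itg2 => x /BU xo; have [jx px] := overlap_transition xo.
  rewrite /push ext_in; last exact: overlap_cod xo.
  rewrite ext_in // px (vol_compat GH xo) -mulrA; congr (_ * _); exact: mulrC.
move=> z; have [iz|niz] := pselect (cod i z); last by rewrite /push ext_out // eqxx.
rewrite /push ext_in // mulf_eq0 negb_or => /andP[/sh[_ [+ _]] _].
rewrite /= paramK // => /boxP[h0 h1].
have mr : m <= r by rewrite ge_min lexx.
have ms : m <= s by rewrite ge_min lexx orbT.
have k0 := le_trans h0 mr; have k1 := le_trans h1 ms.
move: k0 k1; rewrite !ler_norml => /andP[a1 a2] /andP[a3 a4].
by clear - a1 a2 a3 a4; split; apply/andP; split; lra.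
Qed.

End Pushforward.

(** * Partitions of unity and the integral over a compact surface *)

Section Partition.
Context {R : realType} {M : topologicalType} (S : smooth_surface R M).
Variable g : riemannian_metric S.
Hypothesis M_compact : compact [set: M].
Local Notation V := 'rV[R]_2.
Implicit Types (x y z : V) (p q : M) (f h v w : M -> R) (i j : atlas S) (n : nat) (r : R).

Let quad x0 r x : R := r ^+ 2 - (x 0 0 - x0 0 0) ^+ 2 - (x 0 1 - x0 0 1) ^+ 2.

(** The positive part of [quad] lives on a coordinate disc; its fourth power makes the bump of class
    C^3. *)
Definition bump i q r p : R :=
  if pselect (dom i p) then pospow 4 (quad (chart i q) r (chart i p)) else 0.

Lemma bump_ge0 i q r p : 0 <= bump i q r p.
Proof. by rewrite /bump; case: pselect => [ip|//] /=; rewrite exprn_ge0 // le_max lexx. Qed.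

Lemma bump_center i q r : 0 < r -> dom i q -> 0 < bump i q r q.
Proof.
move=> r0 iq; rewrite /bump; case: pselect => [ip|//] /=.
by rewrite /quad !subrr expr0n /= !subr0 exprn_gt0 // lt_max exprn_gt0 ?orbT.
Qed.

Lemma bump_supp i q r p : 0 < r -> bump i q r p != 0 -> pbox i q r p.
Proof.
move=> r0; rewrite /bump; case: pselect => [ip|nip] /=; last by rewrite eqxx.
rewrite /pospow; have [Q0|Q0] := leP (quad (chart i q) r (chart i p)) 0.
  by rewrite expr0n eqxx.
move=> _; exists (chart i p); last exact: chartK.

have sq (t u : R) : 0 < r ^+ 2 - t ^+ 2 - u ^+ 2 -> `|t| <= r /\ `|u| <= r.
  move=> h; have t2 := sqr_ge0 t; have u2 := sqr_ge0 u.
  by split; rewrite -(@ler_pXn2r _ 2) ?nnegrE ?normr_ge0 ?(ltW r0) // real_normK ?num_real //; lra.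
by apply/boxP; exact: sq.
Qed.

Lemma CM_bump i q r : 0 < r -> box (chart i q) r `<=` cod i -> CM S 3 (bump i q r).
Proof.
move=> r0 Bi; apply: (CM_supported Bi) => [p|]; first exact: bump_supp.
apply: (@eq_on_Ck _ 3 _ (fun x => pospow 4 (quad (chart i q) r x)) _ (open_cod i)) => [x ix|].
  by rewrite /bump /=; case: pselect => [ip|/(_ (cod_dom ix)) //] /=; rewrite paramK.
apply: (Ck_pospow (open_cod i)) => //.
have T (c : 'I_2) : Ck 3 (cod i) (fun x => (x 0 c - chart i q 0 c) * (x 0 c - chart i q 0 c)).
  have T1 := CkB (open_cod i) (@Ck_coord R 3 (cod i) c) (Ck_cst 3 (cod i) (chart i q 0 c)).
  exact: (CkM (open_cod i) T1 T1).
exact: (CkB (open_cod i) (CkB (open_cod i) (Ck_cst 3 (cod i) (r ^+ 2)) (T 0)) (T 1)).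
Qed.

(** Bumps are divided by their sum over a finite list [s] whose bumps have no common zero. This is
    done for every [q], so that regularity and support are known without membership in [s]; only the
    sum is taken over [s]. *)
Lemma partition (N : M -> set M) : (forall q, nbhs q (N q)) ->
  exists (s : seq M) (psi : M -> M -> R) (rad : M -> R),
  (forall q, [/\ 0 < rad q, box (chart (chart_at S q) q) (2 * rad q) `<=` cod (chart_at S q),
    pbox (chart_at S q) q (rad q) `<=` N q, CM S 3 (psi q) &
    (forall p, 0 <= psi q p) /\
    forall p, psi q p != 0 -> pbox (chart_at S q) q (rad q) p]) /\
  forall p, \sum_(q <- s) psi q p = 1.
Proof.
move=> nN; have [rad Hr] := choice (fun q => pbox_nbhd (chart_at_dom S q) (nN q)).
have r2 q : rad q <= 2 * rad q by have [r0 _ _] := Hr q; rewrite mulr_natl mulr2n lerDl ltW.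
pose b q := bump (chart_at S q) q (rad q).
have Cb q : CM S 3 (b q).
  have [r0 B _] := Hr q; apply: CM_bump => // x /(sub_box (r2 q)); exact: B.
have ob q : open [set p | 0 < b q p].
  have cb : continuous (b q) by apply: (@CM_continuous _ _ S); exact: CM_le (Cb q).
  apply: (@open_comp _ _ (b q) [set t : R | 0 < t]); last exact: open_gt.
  by move=> p _; exact: cb.
have bq q : 0 < b q q by have [r0 _ _] := Hr q; apply: bump_center => //; exact: chart_at_dom.
(* A property holds near [F] when it holds for all lists containing some fixed list. For this filter
   the near-covering form of compactness yields a finite subcover. *)
pose F : set_system (seq M) := [set A | exists s0 : seq M, forall s : seq M, {subset s0 <= s} -> A s].
have FF : Filter F.
  split=> [|A A' [s1 H1] [s2 H2]|A A' AA' [s1 H1]]; first by exists [::].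
    exists (s1 ++ s2) => s ss; split; [apply: H1|apply: H2] => q qs; apply: ss;
      by rewrite mem_cat qs ?orbT.
  by exists s1 => s /H1 /AA'.
have [s /(_ s (fun q qs => qs)) covD] : F [set s : seq M | [set: M] `<=` [set p | exists2 q, q \in s & 0 < b q p]].
  apply: (iffLR (compact_near_coveringP _) M_compact _ F (fun (s : seq M) (p : M) => exists2 q, q \in s & 0 < b q p)) => q _.
  exists ([set p | 0 < b q p], [set s : seq M | q \in s]).
    by split=> /=; [apply: open_nbhs_nbhs; split=> //; exact: bq|exists [:: q] => s; apply; rewrite mem_head].
  by move=> [p s] [/= bp qs]; exists q.
pose B p := \sum_(q <- s) b q p.
have b0 q p : 0 <= b q p by exact: bump_ge0.
have B0 p : 0 < B p.
  have [q qD bp] := covD p I.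
  by rewrite /B (big_rem q) //= ltr_wpDr // sumr_ge0.
exists s, (fun q p => b q p * (B p)^-1), rad; split=> [q|p]; last first.
  by rewrite -mulr_suml -/(B p) divff // gt_eqF // B0.
have [r0 Bx BN] := Hr q; split=> //.
- apply: (CM_mul (Cb q)); apply: CM_inv => [p|]; first by rewrite gt_eqF.
  exact: CM_sum.
- split=> p; first by rewrite divr_ge0 // ltW.
  by rewrite mulf_eq0 negb_or => /andP[/(bump_supp r0)].
Qed.

Lemma ipM_sum (I : Type) (s : seq I) (F : I -> M -> R) w p : (forall a, CM S 1 (F a)) ->
  ipM g (fun p => \sum_(a <- s) F a p) w p = \sum_(a <- s) ipM g (F a) w p.
Proof.
move=> CF; rewrite /ipM; set i := chart_at S p; set x := chart i p.
have ix : cod i x by apply: chart_cod; exact: chart_at_dom.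
have E k (t : seq I) : partial k ((fun p => \sum_(a <- t) F a p) \o param i) x =
    \sum_(a <- t) partial k (F a \o param i) x.
  elim: t => [|a t IH].
    rewrite big_nil; have -> : (fun p => \sum_(a <- [::]) F a p) \o param i = cst 0.
      by apply/funext => y; rewrite /= big_nil.
    by rewrite partial_cst.
  rewrite big_cons -IH -(partialD k (CkS_diff (CF a i) ix) (CkS_diff (CM_sum t CF i) ix)).
  by congr (partial k _ x); apply/funext => y; rewrite /= big_cons.
transitivity (\sum_(a <- s) \dsum_b partial b (F a \o param i) x *
    gradf (ginv (gmat g i)) (w \o param i) b x); last by apply: eq_bigr => a _; rewrite ipfE.
by rewrite ipfE /sum2 big_split /= !E !mulr_suml.
Qed.

Lemma nbhs_all (s : seq M) q (P : M -> set M -> Prop) :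
  (forall k (N N' : set M), N' `<=` N -> P k N -> P k N') ->
  (forall k, exists2 N, nbhs q N & P k N) ->
  exists2 N, nbhs q N & forall k, k \in s -> P k N.
Proof.
move=> mono ex; elim: s => [|k s [N nN HN]]; first by exists setT => //; exact: filterT.
have [N' nN' HN'] := ex k; exists (N `&` N'); first exact: filterI.
move=> k'; rewrite in_cons => /predU1P[->|/HN]; apply: mono; last exact: subIsetl.
  exact: subIsetr.
exact: HN'.
Qed.

Theorem surface_integral : exists Phi : (M -> R) -> R,
  [/\ forall v w, CM S 2 v -> CM S 3 w -> Phi (fun p => v p * lapM g w p + ipM g v w p) = 0,
      forall f h, CM S 0 f -> CM S 0 h -> Phi (fun p => f p + h p) = Phi f + Phi h &
      forall h, CM S 0 h -> (forall p, 0 <= h p) -> Phi h = 0 -> forall p, h p = 0].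
Proof.
have [s [chi [rad [Hchi chi1]]]] := partition (fun q => filterT : nbhs q setT).
pose c := chart_at S.
have rad0 k : 0 <= rad k by have [/ltW] := Hchi k.
have Bk k : box (chart (c k) k) (rad k) `<=` cod (c k).
  have [r0 B2 _ _ _] := Hchi k; move=> x Bx; apply: B2; apply: sub_box Bx.
  by rewrite mulr_natl mulr2n lerDl ltW.
have Cchi k n : (n <= 3)%N -> CM S n (chi k) by move=> n3; have [_ _ _ C _] := Hchi k; exact: CM_le C.
have chi_ge0 k p : 0 <= chi k p by have [_ _ _ _ []] := Hchi k.
have chi_supp k h p : chi k p * h p != 0 -> pbox (c k) k (rad k) p.
  by rewrite mulf_eq0 negb_or => /andP[ck _]; have [_ _ _ _ [_ H]] := Hchi k; exact: H.
have Cf k h : CM S 0 h -> Ck 0 setT (push g (c k) (fun p => chi k p * h p)).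
  move=> Ch; apply: (Ck_push g (Bk k) (@chi_supp k h)); exact: (CM_mul (Cchi k 0%N isT) Ch).
exists (fun h => \sum_(k <- s) plane_int (push g (c k) (fun p => chi k p * h p))); split.
- move=> v w Cv Cw.
  have Cw2 : CM S 2 w by exact: CM_le Cw.
  have Cg u : CM S 2 u -> CM S 1 (fun p => u p * lapM g w p + ipM g u w p).
    move=> Cu; apply: CM_add; last exact: CM_ip.
    by apply: CM_mul; [exact: CM_le Cu|exact: CM_lap].
  (* If [q] lies in the box of [chi k], both charts contain [q] and [cov_nbhd] applies. Otherwise
     the complement of that closed box is a neighbourhood of [q], and for [h] supported there both
     integrals are 0. *)
  have cov q k : exists2 N, nbhs q N & forall h, CM S 1 h -> (forall p, h p != 0 -> N p) ->
     plane_int (push g (c k) (fun p => chi k p * h p)) = plane_int (push g (c q) (fun p => chi k p * h p)).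
    have [Cq|nCq] := pselect (pbox (c k) k (rad k) q).
      have [N nN HN] := cov_nbhd g (proj1 (pbox_dom (Bk k) Cq)) (chart_at_dom S q).
      exists N; first exact: nN.
      move=> h Ch sh; apply: (HN (fun p => chi k p * h p)); first exact: (CM_mul (Cchi k 1%N isT) Ch).
      by move=> p; rewrite mulf_eq0 negb_or => /andP[_ /sh].
    exists (~` pbox (c k) k (rad k)).
      by apply: open_nbhs_nbhs; split=> //; rewrite openC; exact: closed_pbox (Bk k).
    move=> h Ch sh; have -> : (fun p => chi k p * h p) = (fun=> 0); last by rewrite !push0.
    apply/funext => p; apply/eqP; apply/negPn/negP => nz; have := chi_supp _ _ _ nz.
    by move: nz; rewrite mulf_eq0 negb_or => /andP[_ /sh].
  have cov2 q : exists N : set M, nbhs q N /\ forall k, k \in s -> forall h, CM S 1 h -> (forall p, h p != 0 -> N p) ->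
     plane_int (push g (c k) (fun p => chi k p * h p)) = plane_int (push g (c q) (fun p => chi k p * h p)).
    have [] := @nbhs_all s q (fun k N => forall h, CM S 1 h -> (forall p, h p != 0 -> N p) ->
     plane_int (push g (c k) (fun p => chi k p * h p)) = plane_int (push g (c q) (fun p => chi k p * h p))).
    + by move=> k N N' NN HN h Ch sh; apply: HN => // p /sh /NN.
    + exact: cov.
    by move=> N nN HN; exists N.
  have [N2 HN2] := choice cov2.
  (* The second partition is subordinate to neighbourhoods that work for all the finitely many
     charts of [chi] at once. *)
  have [s2 [psi [rad2 [Hpsi psi1]]]] := partition (fun q => proj1 (HN2 q)).
  pose u q p := psi q p * v p.
  have Cu q : CM S 2 (u q) by apply: CM_mul Cv; have [_ _ _ C _] := Hpsi q; exact: CM_le C.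
  have B2 q : box (chart (c q) q) (rad2 q) `<=` cod (c q).
    have [r0 B2 _ _ _] := Hpsi q; move=> x Bx; apply: B2; apply: sub_box Bx.
    by rewrite mulr_natl mulr2n lerDl ltW.
  pose hq q p := u q p * lapM g w p + ipM g (u q) w p.
  have su q p : u q p != 0 -> pbox (c q) q (rad2 q) p.
    by rewrite mulf_eq0 negb_or => /andP[ck _]; have [_ _ _ _ [_ H]] := Hpsi q; exact: H.
  have sh q p : hq q p != 0 -> pbox (c q) q (rad2 q) p.
    exact: (supp_green (closed_pbox (B2 q)) (@su q)).
  have hE p : v p * lapM g w p + ipM g v w p = \sum_(q <- s2) hq q p.
    have vE : v = (fun p => \sum_(q <- s2) u q p).
      by apply/funext => p'; rewrite -mulr_suml psi1 mul1r.
    rewrite /hq big_split /= -mulr_suml -mulr_suml psi1 mul1r; congr (_ + _).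
    rewrite [in LHS]vE; exact: (ipM_sum s2 w p (fun q => CM_le (isT : (1 <= 2)%N) (Cu q))).
  rewrite (eq_bigr (fun k => \sum_(q <- s2) plane_int (push g (c k) (fun p => chi k p * hq q p)))); last first.
    move=> k _; rewrite -(plane_int_sum s2 (rad0 k) (fun q => bsupp_push (Bk k) (fun p => @chi_supp k (hq q) p))); last first.
      by move=> q; apply: Cf; exact: CM_le (Cg _ (Cu q)).
    rewrite -push_sum; congr (plane_int (push g _ _)); apply/funext => p.
    by rewrite hE mulr_sumr.
  (* For each piece [hq q] all the integrals are moved to the chart at [q], where the sum over [k]
     can be taken inside the integral. *)
  rewrite exchange_big /= big1 // => q _.
  have shk k p : chi k p * hq q p != 0 -> pbox (c q) q (rad2 q) p.
    by rewrite mulf_eq0 negb_or => /andP[_ /sh].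
  have sN p : hq q p != 0 -> N2 q p by move=> /sh; have [_ _ H _ _] := Hpsi q; exact: H.
  have EN k : k \in s -> plane_int (push g (c k) (fun p => chi k p * hq q p)) =
      plane_int (push g (c q) (fun p => chi k p * hq q p)).
    by move=> ks; exact: (proj2 (HN2 q) k ks (hq q) (Cg _ (Cu q)) sN).
  apply: (etrans (eq_big_seq _ EN)).
  have [/ltW r0 _ _ _ _] := Hpsi q.
  rewrite -(plane_int_sum s r0 (fun k => bsupp_push (B2 q) (shk k))); last first.
    move=> k; apply: (Ck_push g (B2 q) (shk k)); apply: (CM_mul (Cchi k 0%N isT)).
    exact: CM_le (Cg _ (Cu q)).
  rewrite -push_sum.
  have -> : (fun p => \sum_(k <- s) chi k p * hq q p) = hq q.
    by apply/funext => p; rewrite -mulr_suml chi1 mul1r.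
  have [rp B2q _ _ _] := Hpsi q.
  exact: (green_chart g rp B2q (@su q) (CM_le (isT : (1 <= 2)%N) (Cu q)) Cw2).
- move=> f h Cfm Chm; rewrite -big_split; apply: eq_bigr => k _ /=.
  rewrite -(plane_intD (rad0 k) (bsupp_push (Bk k) (@chi_supp k f)) (bsupp_push (Bk k) (@chi_supp k h)) (Cf k f Cfm) (Cf k h Chm)).
  congr plane_int; apply/funext => x; rewrite /push.
  have [ix|nix] := pselect (cod (c k) x); last by rewrite !ext_out // addr0.
  by rewrite !ext_in // mulrDr mulrDl.
move=> h Ch h0 H0 p.
have ch0 k p' : 0 <= chi k p' * h p' by rewrite mulr_ge0.
have I0 k : k \in s -> plane_int (push g (c k) (fun p => chi k p * h p)) = 0.
  move: H0 => /eqP; rewrite psumr_eq0 => [/allP H ks|k' _].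
    by have /implyP/(_ isT)/eqP := H k ks.
  by apply: (plane_int_ge0 (bsupp_push (Bk k') (@chi_supp k' h))); exact: push_ge0.
rewrite -[h p]mul1r -(chi1 p) mulr_suml big_seq big1 // => k ks.
apply/eqP; apply/negPn/negP => nz.
have [ip Bp] := pbox_dom (Bk k) (chi_supp k h p nz).
have := plane_int_eq0 (rad0 k) (bsupp_push (Bk k) (@chi_supp k h)) (Cf k h Ch) (push_ge0 g (c k) (ch0 k)) (I0 k ks) (chart (c k) p).
rewrite /push ext_in ?chartK //; last exact: chart_cod.
move=> /eqP; rewrite mulf_eq0 (negbTE nz) /=.
by rewrite gt_eqF // (vol_gt0 (@posdef_gmat _ _ _ g (c k)) (chart_cod ip)).
Qed.

End Partition.

(** * Rigidity *)

Lemma is_derive_inv_subr (R : realType) (t : R) : 1 - t != 0 ->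
  is_derive t (1 : R) (fun t : R => (1 - t)^-1) ((1 - t) ^- 2).
Proof.
move=> n0.
have H : is_derive t (1 : R) (fun t : R => 1 - t) (0 - 1).
  by apply: is_deriveB.
have [d0 d1] := H.
have E := @deriveV _ _ (fun s : R => 1 - s) t 1 n0 d0.
rewrite d1 in E.
apply: DeriveDef; first exact: (@derivableV _ _ (fun s : R => 1 - s) t 1 n0 d0).
apply: (etrans E); rewrite sub0r.
by rewrite [LHS]mulrN1 opprK.
Qed.

Section Rigidity.
Context {R : realType} {M : topologicalType} (S : smooth_surface R M).
Variable g : riemannian_metric S.
Local Notation V := 'rV[R]_2.
Implicit Types (x y z : V) (p q : M) (f h k v w : M -> R) (i j : atlas S) (n : nat) (r : R).

Lemma ipM_mul f h k p : CM S 1 f -> CM S 1 h ->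
  ipM g (fun p => f p * h p) k p = f p * ipM g h k p + h p * ipM g f k p.
Proof.
move=> Cf Ch; rewrite /ipM; set i := chart_at S p; set x := chart i p.
have ip : dom i p by exact: chart_at_dom.
have ix : cod i x by exact: chart_cod.
have E b : partial b ((fun p => f p * h p) \o param i) x =
   f p * partial b (h \o param i) x + h p * partial b (f \o param i) x.
  by have := partialM b (CkS_diff (Cf i) ix) (CkS_diff (Ch i) ix); rewrite /= chartK.
rewrite !ipfE /sum2 !E.
move: (@partial R) (gradf (ginv (gmat g i))) (0 : 'I_2) (1 : 'I_2) => P G o l; ring.
Qed.

Lemma ipM_comp f k (F : R -> R) (d : R) p : CM S 1 f -> is_derive (f p) (1 : R) F d ->
  ipM g (F \o f) k p = d * ipM g f k p.
Proof.
move=> Cf dF; rewrite /ipM; set i := chart_at S p; set x := chart i p.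
have ip : dom i p by exact: chart_at_dom.
have ix : cod i x by exact: chart_cod.
have fx : (f \o param i) x = f p by rewrite /= chartK.
have dF' : is_derive ((f \o param i) x) (1 : R) F d by rewrite fx.
have E b : partial b ((F \o f) \o param i) x = d * partial b (f \o param i) x.
  exact: (partial_comp1 b (CkS_diff (Cf i) ix) dF').
rewrite !ipfE /sum2 !E.
move: (@partial R) (gradf (ginv (gmat g i))) (0 : 'I_2) (1 : 'I_2) => P G o l; ring.
Qed.

Lemma ipM_cst (c : R) k p : ipM g (fun=> c) k p = 0.
Proof.
rewrite /ipM; set i := chart_at S p.
have -> : (fun=> c) \o param i = cst c by [].
by rewrite ipfE /sum2 !partial_cst /= !mul0r addr0.
Qed.

Variable u : M -> R.
Hypothesis Cu : forall n, CM S n u.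

Let W := ipM g u u.
Let L := lapM g u.

Lemma CM_energy n : CM S n W. Proof. exact: CM_ip. Qed.
Lemma CM_laplacian n : CM S n L. Proof. exact: CM_lap. Qed.

Lemma grad_norm2E p : grad_norm2 g u p = W p.
Proof.
have ip := chart_at_dom S p.
exact: (norm2_gradE (@posdef_gmat _ _ _ g (chart_at S p)) (u \o param (chart_at S p)) (chart_cod ip)).
Qed.

Lemma energy_ge0 p : 0 <= W p.
Proof.
rewrite -grad_norm2E /grad_norm2 /norm2_coord; set i := chart_at S p; set a := grad_coord _ _ _.
have [_ pos] := posdef_gmat g (chart_cod (chart_at_dom S p)).
have [->|/pos/ltW //] := eqVneq a 0.
by rewrite mul0mx mul0mx mxE.
Qed.

Lemma bochnerM p : L p ^+ 2 + ipM g L u p - 2^-1 * lapM g W p =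
  2 * hess_det g u p - gauss_curvature g p * W p.
Proof.
set i := chart_at S p; have ix : cod i (chart i p) by exact: chart_cod (chart_at_dom S p).
have := local_bochner (open_cod i) (Ck_gmat g i) (@posdef_gmat _ _ _ g i) (Cu^~ i) ix.
have EL y : cod i y -> (L \o param i) y = lapf (gmat g i) (u \o param i) y.
  exact: (lapM_param g (Cu 2)).
have EW y : cod i y -> (W \o param i) y = ipf (ginv (gmat g i)) (u \o param i) (u \o param i) y.
  exact: (ipM_param g (Cu 1) (Cu 1)).
rewrite -(eq_on_ipf (ginv (gmat g i)) (open_cod i) ix EL (fun y _ => erefl ((u \o param i) y))).
rewrite -(eq_on_lapf (gmat g i) (open_cod i) ix EW).
exact.
Qed.

Lemma weightM p : L p * ipM g W u p - 2^-1 * ipM g W W p = 2 * W p * hess_det g u p.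
Proof.
set i := chart_at S p; have ix : cod i (chart i p) by exact: chart_cod (chart_at_dom S p).
have := local_weight (open_cod i) (Ck_gmat g i) (@posdef_gmat _ _ _ g i) (Cu^~ i) ix.
have EW y : cod i y -> (W \o param i) y = ipf (ginv (gmat g i)) (u \o param i) (u \o param i) y.
  exact: (ipM_param g (Cu 1) (Cu 1)).
rewrite -(eq_on_ipf (ginv (gmat g i)) (open_cod i) ix EW EW).
rewrite -(eq_on_ipf (ginv (gmat g i)) (open_cod i) ix EW (fun y _ => erefl ((u \o param i) y))).
exact.
Qed.

Hypothesis M_compact : compact [set: M].

(** By [bochnerM] and [weightM], [h] is the divergence of [phi (L Du - DW / 2)], where [d] stands
    for the derivative of [phi] as a function of [W]. A divergence of constant sign has integral
    zero, hence vanishes. *)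
Lemma divergence_signed (phi d : M -> R) (s : R) (h := fun p =>
    phi p * (2 * hess_det g u p - gauss_curvature g p * W p) + d p * (2 * W p * hess_det g u p)) :
  s = 1 \/ s = -1 -> (forall n, CM S n phi) ->
  (forall k p, ipM g phi k p = d p * ipM g W k p) ->
  (forall p, 0 <= s * h p) -> forall p, h p = 0.
Proof.
(* The field is a combination of [Du] and [DW] with coefficients [v1] and [v2]; including the sign
   [s] makes its divergence non-negative. *)
move=> s1 Cphi dphi h0; have [Phi [P0 PD Ppos]] := surface_integral g M_compact.
pose v1 p := s * (phi p * L p); pose v2 p := s * (- 2^-1 * phi p).
have Cv1 n : CM S n v1 := CM_mul (CM_cst n s) (CM_mul (Cphi n) (@CM_laplacian n)).
have Cv2 n : CM S n v2 := CM_mul (CM_cst n s) (CM_mul (CM_cst n _) (Cphi n)).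
have ip_cst (c : R) f k p : CM S 1 f -> ipM g (fun p => c * f p) k p = c * ipM g f k p.
  by move=> Cf; rewrite (ipM_mul k p (CM_cst 1 c) Cf) ipM_cst mulr0 addr0.
pose k1 p := v1 p * lapM g u p + ipM g v1 u p; pose k2 p := v2 p * lapM g W p + ipM g v2 W p.
have hE p : s * h p = k1 p + k2 p.
  have CpL : CM S 1 (fun p => phi p * L p) := CM_mul (Cphi 1%N) (@CM_laplacian 1).
  have Cp2 : CM S 1 (fun p => - 2^-1 * phi p) := CM_mul (CM_cst 1 _) (Cphi 1%N).
  rewrite /k1 /k2 (ip_cst _ _ _ _ CpL) (ip_cst _ _ _ _ Cp2) (ip_cst _ _ _ _ (Cphi 1%N)).
  rewrite (ipM_mul u p (Cphi 1%N) (@CM_laplacian 1)) !dphi /h -bochnerM -weightM /v1 /v2 -/L.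
  move: (L p) (ipM g L u p) (ipM g W u p) (ipM g W W p) (lapM g W p) (phi p) (d p) => *; ring.
have Ck1 : CM S 0 k1 by apply: CM_add; [exact: CM_mul (@Cv1 0) (@CM_laplacian 0)|exact: CM_ip].
have Ck2 : CM S 0 k2.
  by apply: CM_add; [exact: CM_mul (@Cv2 0) (CM_lap g (@CM_energy 2))|exact: CM_ip (@Cv2 1) (@CM_energy 1)].
move=> p; have : k1 p + k2 p = 0.
  apply: (Ppos (fun p => k1 p + k2 p)); first exact: CM_add.
    by move=> q; rewrite -hE.
  by rewrite PD // !P0 ?addr0 //; exact: CM_energy.
rewrite -hE => /eqP; rewrite mulf_eq0 => /orP[|/eqP //].
by case: s1 => ->; rewrite ?oppr_eq0 oner_eq0.
Qed.

(** The divergence bounds [s K_M W c] from above and is 0, so [W] vanishes wherever the curvature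
    does not; density and continuity give the other points. The positive factor [c] is where the two
    equations differ. *)
Lemma energy_eq0 (phi d c : M -> R) (s : R) : s = 1 \/ s = -1 ->
  (forall n, CM S n phi) -> (forall k p, ipM g phi k p = d p * ipM g W k p) ->
  (forall p, 0 <= s * gauss_curvature g p) -> dense [set p | 0 < s * gauss_curvature g p] ->
  (forall p, 0 < c p) ->
  (forall p, s * gauss_curvature g p * W p * c p <=
    s * (phi p * (2 * hess_det g u p - gauss_curvature g p * W p) + d p * (2 * W p * hess_det g u p))) ->
  forall p, W p = 0.
Proof.
move=> s1 Cphi dphi K0 Kd c0 le.
have h0 := divergence_signed s1 Cphi dphi (fun p => le_trans (mulr_ge0 (mulr_ge0 (K0 p) (energy_ge0 p)) (ltW (c0 p))) (le p)).
have Wpos p : 0 < s * gauss_curvature g p -> W p = 0.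
  move=> Kp; apply/eqP; rewrite eq_le energy_ge0 andbT.
  have := le p; rewrite h0 mulr0 -(pmulr_rle0 (W p) Kp) -(pmulr_lle0 _ (c0 p)).
  exact.
have cW : continuous W := CM_continuous (@CM_energy 0).
move=> p; apply/eqP/negPn/negP => Wp.
have oW : open [set q | W q != 0].
  apply: (@open_comp _ _ W [set t : R | t != 0]); first by move=> q _; exact: cW.
  exact: open_neq.
have [q [/= Wq Kq]] := Kd _ (ex_intro _ p Wp) oW.
by rewrite Wpos // eqxx in Wq.
Qed.

Lemma energy0_partial i x b : (forall p, W p = 0) -> cod i x -> partial b (u \o param i) x = 0.
Proof.
move=> W0 ix; have := ipM_param g (Cu 1) (Cu 1) ix; rewrite -/W W0.
rewrite -(norm2_gradE (@posdef_gmat _ _ _ g i) (u \o param i) ix) /norm2_coord => /esym N0.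
have [_ pos] := posdef_gmat g ix.
have a0 : grad_coord (gmat g i) (u \o param i) x = 0.
  by apply/eqP/negPn/negP => /pos; rewrite N0 ltxx.
have uG : gmat g i x \in unitmx.
  by rewrite unitmxE unitfE gt_eqF // posdef_det //; exact: posdef_gmat.
have := congr1 (fun B : V => (B *m gmat g i x) 0 b) a0.
by rewrite /grad_coord mulmxKV // mul0mx !mxE.
Qed.

(** The level set of [u] through a point is closed by continuity, and open because [u] has zero
    differential in every coordinate box. *)
Lemma energy0_const (M_connected : connected [set: M]) :
  (forall p, W p = 0) -> exists c : R, forall p, u p = c.
Proof.
(* On an empty surface any constant will do. *)
move=> W0; have [[p0 _]|noM] := pselect (exists p : M, True); last first.
  by exists 0 => p; case: noM; exists p.
exists (u p0).
have cu : continuous u := CM_continuous (Cu 0).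
have oB : open [set p | u p = u p0].
  rewrite openE => p /= up; pose i := chart_at S p; have ip : dom i p by exact: chart_at_dom.
  have [r r0 Br] := open_box (open_cod i) (chart_cod ip).
  have N : nbhs p (dom i `&` chart i @^-1` box (chart i p) r).
    apply: filterI; first by apply: open_nbhs_nbhs; split=> //; exact: dom_open.
    by apply: (chart_continuous ip); exact: nbhs_box.
  apply: filterS N => q [iq Bq]; rewrite /= -up.
  (* The box is convex, so the mean value theorem applies along the segment from [chart i p] to
     [chart i q]. *)
  pose f := u \o param i; pose b := chart i p; pose v := chart i q - b.
  have Bs (t : R) : `|t| <= `|1 : R| -> cod i (b + t *: v).
    rewrite normr1 => t1; apply: Br; apply/boxP.
    have key (c : 'I_2) : `|chart i q 0 c - b 0 c| <= r -> `|(b + t *: v) 0 c - b 0 c| <= r.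
      rewrite !mxE addrAC subrr add0r normrM; apply: le_trans.
      by rewrite ler_piMl.
    by have /boxP[h0 h1] := Bq; split; exact: key.
  have df (t : R) (tt : `|t| <= `|1 : R|) : differentiable f (b + t *: v) := CkS_diff (Cu 1%N i) (Bs t tt).
  have [t tt] := line_MVT (fun t tt => diff_derivable (v := v) (df t tt)).
  rewrite deriveE; last exact: df.
  rewrite diff_partial; last exact: df.
  rewrite !(energy0_partial _ W0 (Bs t tt)) !mulr0 addr0 mulr0 => /eqP.
  by rewrite subr_eq0 scale1r /v addrC subrK /f /= !chartK // => /eqP.
have := M_connected [set p | u p = u p0]; move=> H p.
have -> // : [set p | u p = u p0] p.
rewrite H //; first by exists p0.
- by exists [set p | u p = u p0] => //; rewrite setTI.
exists [set p | u p = u p0]; last by rewrite setTI.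
apply: (@preimage_closed _ _ u [set t : R | t = u p0]); last exact: closed_eq.
by move=> q _; exact: cu.
Qed.

End Rigidity.

(** * Constant functions as solutions *)

Section ConstantFunctions.
Context {R : realType} {M : topologicalType} (S : smooth_surface R M).
Variable g : riemannian_metric S.
Variables (u : M -> R) (c : R).
Hypothesis uc : forall p, u p = c.

Let ucst (i : atlas S) : u \o param i = cst c.
Proof. by apply/funext => x; exact: uc. Qed.

Lemma const_smooth : smooth_fun S u.
Proof.
move=> i s x _; rewrite ucst.
have [a ->] : exists a : R, iter_partial s (cst c) = cst a.
  elim: s => [|b s [a IH]]; first by exists c.
  by exists 0; rewrite /= IH partial_cst.
by split=> [|b]; [exact: cst_continuous|exact: derivable_cst].
Qed.

Lemma const_grad_norm2 p : grad_norm2 g u p = 0.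
Proof.
rewrite /grad_norm2 ucst /grad_coord /norm2_coord.
have -> : \row_b partial b (cst c) (chart (chart_at S p) p) = 0.
  by apply/rowP => b; rewrite !mxE partial_cst.
by rewrite !mul0mx mxE.
Qed.

Lemma const_hess_det p : hess_det g u p = 0.
Proof.
rewrite /hess_det ucst frame_det_quot; last exact: posdef_gmat (chart_cod (chart_at_dom S p)).
have -> : hess_coord (gmat g (chart_at S p)) (cst c) (chart (chart_at S p) p) = 0.
  by apply/matrixP => a b; rewrite !mxE sum_ord2 !partial_cst /= !mulr0 addr0 subr0.
by rewrite det_mx2 !mxE mulr0 subrr mul0r.
Qed.

Lemma const_solution_plus K : entire_solution_plus g K u <-> K = gauss_curvature g.
Proof.
split=> [[_ E]|->].
  by apply/funext => p; have := E p; rewrite const_grad_norm2 const_hess_det !addr0 expr1n !mul1r.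
by split=> [|p]; [exact: const_smooth|rewrite const_grad_norm2 const_hess_det !addr0 expr1n !mul1r].
Qed.

Lemma const_solution_minus K : entire_solution_minus g K u <-> K = gauss_curvature g.
Proof.
split=> [[_ E]|->].
  by apply/funext => p; have [] := E p; rewrite const_grad_norm2 const_hess_det !subr0 expr1n !mul1r.
split=> [|p]; first exact: const_smooth.
by rewrite const_grad_norm2 const_hess_det !subr0 expr1n !mul1r.
Qed.

End ConstantFunctions.

(** * Both equations for a curvature of sign [s] *)

Section SignedCurvature.
Context {R : realType} {M : topologicalType} (S : smooth_surface R M).
Variable g : riemannian_metric S.
Hypotheses (M_compact : compact [set: M]) (M_connected : connected [set: M]).
Variable s : R.
Hypotheses (s1 : s = 1 \/ s = -1) (K0 : forall p, 0 <= s * gauss_curvature g p).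
Hypothesis Kd : dense [set p | 0 < s * gauss_curvature g p].

Lemma plus_rigidity (K u : M -> R) : (forall p, s * gauss_curvature g p <= s * K p) ->
  entire_solution_plus g K u <-> (exists c : R, forall p, u p = c) /\ K = gauss_curvature g.
Proof.
move=> KK; split=> [sol|[[c uc] KE]]; last exact/(const_solution_plus g uc).
have [su eqn] := sol; have Cu n : CM S n u := CM_smooth n su.
have [c uc] : exists c : R, forall p, u p = c.
  apply: (@energy0_const _ _ S g u Cu M_connected).
  (* The factor [1 + 2 W] comes from 2 (1 + W)^2 - 2 (1 + W) - W = W (1 + 2 W), the coefficient of
     [K_M] once [K] is compared with it. *)
  apply: (@energy_eq0 _ _ S g u Cu M_compact (fun=> 1) (fun=> 0) (fun p => 1 + 2 * ipM g u u p) s s1) => //.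
  - by move=> n; exact: CM_cst.
  - by move=> k p; rewrite mul0r ipM_cst.
  - by move=> p; rewrite ltr_pwDl // mulr_ge0 //; exact: energy_ge0.
  move=> p; have := eqn p; rewrite grad_norm2E //.
  have := KK p; have := energy_ge0 g u p; move: (ipM g u u p) (hess_det g u p) (gauss_curvature g p) (K p) => w h k k'.
  move=> w0 kk E; rewrite mul0r addr0 mul1r.
  have -> : h = (1 + w) ^+ 2 * k' - (1 + w) * k by rewrite E; ring.
  have w1 : 0 <= (1 + w) ^+ 2 by exact: sqr_ge0.
  have := ler_wpM2l w1 kk; clear; rewrite -subr_ge0 => e.
  rewrite -subr_ge0; have -> : s * (2 * ((1 + w) ^+ 2 * k' - (1 + w) * k) - k * w) - s * k * w * (1 + 2 * w)
    = 2 * ((1 + w) ^+ 2 * (s * k') - (1 + w) ^+ 2 * (s * k)) by ring.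
  by rewrite mulr_ge0.
by split; [exists c|exact/(const_solution_plus g uc)].
Qed.

Lemma minus_rigidity (K u : M -> R) : (forall p, s * K p <= s * gauss_curvature g p) ->
  entire_solution_minus g K u <-> (exists c : R, forall p, u p = c) /\ K = gauss_curvature g.
Proof.
move=> KK; split=> [sol|[[c uc] KE]]; last exact/(const_solution_minus g uc).
have [su eqn] := sol; have Cu n : CM S n u := CM_smooth n su.
have W1 p : 0 < 1 - ipM g u u p.
  by have [_] := eqn p; rewrite grad_norm2E // subr_gt0.
have [c uc] : exists c : R, forall p, u p = c.
  apply: (@energy0_const _ _ S g u Cu M_connected).
  apply: (@energy_eq0 _ _ S g u Cu M_compact (fun p => (1 - ipM g u u p)^-1)
    (fun p => (1 - ipM g u u p) ^- 2) (fun p => (1 - ipM g u u p)^-1) s s1) => //.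
  - move=> n; apply: CM_inv => [p|]; first by rewrite gt_eqF.
    by apply: CM_add (CM_cst n 1) _; apply: CM_opp; exact: CM_energy.
  - move=> k p; apply: (@ipM_comp _ _ S g (ipM g u u) k (fun t : R => (1 - t)^-1)); first exact: CM_energy.
    by apply: is_derive_inv_subr; rewrite gt_eqF.
  - by move=> p; rewrite invr_gt0.
  move=> p; have := eqn p; rewrite grad_norm2E // => -[+ _].
  have := KK p; have := W1 p; move: (ipM g u u p) (hess_det g u p) (gauss_curvature g p) (K p) => w h k k'.
  move=> w0 kk E.
  have -> : h = (1 - w) * k - (1 - w) ^+ 2 * k' by rewrite E; ring.
  have n0 : 1 - w != 0 by rewrite gt_eqF.
  (* The powers of [1 - W] cancel and the difference of the two sides is a multiple of [K_M - K]
     alone. *)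
  rewrite -subr_ge0; set X := (X in 0 <= X).
  have -> : X = 2 * (s * k - s * k') by rewrite /X; field.
  by rewrite mulr_ge0 // subr_ge0.
by split; [exists c|exact/(const_solution_minus g uc)].
Qed.

End SignedCurvature.

Theorem corollary11 (R : realType) (M : topologicalType)
    (S : smooth_surface R M) (g : riemannian_metric S)
    (M_compact : compact [set: M]) (M_connected : connected [set: M]) :
  ((forall p, 0 <= gauss_curvature g p) ->
   dense [set p | 0 < gauss_curvature g p] ->
   (forall K u : M -> R, smooth_fun S K ->
      (forall p, gauss_curvature g p <= K p) ->
      (entire_solution_plus g K u <->
       (exists c : R, forall p, u p = c) /\ K = gauss_curvature g)) /\
   (forall K u : M -> R, smooth_fun S K ->
      (forall p, K p <= gauss_curvature g p) ->
      (entire_solution_minus g K u <->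
       (exists c : R, forall p, u p = c) /\ K = gauss_curvature g)))
  /\
  ((forall p, gauss_curvature g p <= 0) ->
   dense [set p | gauss_curvature g p < 0] ->
   (forall K u : M -> R, smooth_fun S K ->
      (forall p, K p <= gauss_curvature g p) ->
      (entire_solution_plus g K u <->
       (exists c : R, forall p, u p = c) /\ K = gauss_curvature g)) /\
   (forall K u : M -> R, smooth_fun S K ->
      (forall p, gauss_curvature g p <= K p) ->
      (entire_solution_minus g K u <->
       (exists c : R, forall p, u p = c) /\ K = gauss_curvature g))).
Proof.
split=> K0 Kd.
  have K1 p : 0 <= 1 * gauss_curvature g p by rewrite mul1r.
  have Kd1 : dense [set p | 0 < 1 * gauss_curvature g p].
    by under eq_set do rewrite mul1r.
  split=> K u _ KK; [apply: (plus_rigidity M_compact M_connected (or_introl erefl) K1 Kd1)|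
    apply: (minus_rigidity M_compact M_connected (or_introl erefl) K1 Kd1)] => p;
    by rewrite !mul1r.
have K1 p : 0 <= -1 * gauss_curvature g p by rewrite mulN1r oppr_ge0.
have Kd1 : dense [set p | 0 < -1 * gauss_curvature g p].
  by under eq_set do rewrite mulN1r oppr_gt0.
split=> K u _ KK; [apply: (plus_rigidity M_compact M_connected (or_intror erefl) K1 Kd1)|
  apply: (minus_rigidity M_compact M_connected (or_intror erefl) K1 Kd1)] => p;
  by rewrite !mulN1r lerN2.
Qed.
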